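(* Let $T$ be a rational knot shadow with at least one crossing, played as a position of the knotting-unknotting game. If $T\stackrel{1}{\Rightarrow}O$ for some odd-even shadow $O$, then $T$ is a win for the Unknotter under perfect play, no matter which player moves first. Otherwise, if $T$ has an even number of crossings then $T$ is a win for the second player, and if $T$ has an odd number of crossings then $T$ is a win for the first player.
   Context: A knot pseudodiagram is a knot projection (a closed curve in the plane, or sphere, with finitely many transverse double points) in which each crossing is either resolved (over/under data given) or unresolved. A shadow is a pseudodiagram in which every crossing is unresolved. Pseudodiagrams are regarded up to planar isotopy and ordinary Reidemeister moves, so that connected sum $\#$ is well defined. The knotting-unknotting game on a pseudodiagram: two players, the Knotter and the Unknotter, alternately choose an unresolved crossing and resolve it (either way); when no unresolved crossings remain, the Unknotter wins iff the resulting knot is the unknot, otherwise the Knotter wins. Let $*$ denote the one-crossing kink diagram of the unknot with its crossing unresolved. Write $P\stackrel{1}{\to}Q$ (pseudo Reidemeister I move) if $Q$ is obtained from $P$ by deleting an unresolved kink, equivalently $P=Q\#*$; and $P\stackrel{1}{\Rightarrow}Q$ if $Q$ is obtained from $P$ by zero or more such moves (up to equivalence). Rational shadows: let $[~]$ denote the basic two-string tangle whose closure is the crossingless unknot. Recursively, $[a_1,\ldots,a_n]$ is obtained from $[a_1,\ldots,a_{n-1}]$ by reflecting across a $45^\circ$ axis and adding $a_n$ half-twists on the right (Conway's construction). $[(b_1),\ldots,(b_n)]$ ($b_i\in\mathbb N$) denotes the same construction with all twist crossings unresolved; this is a rational shadow, and the same notation denotes its closure obtained by joining the two top endpoints and the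 two bottom endpoints. It is a rational knot shadow if the closure has one component. An odd-even shadow is a rational shadow $[(a_1),\ldots,(a_n)]$ in which exactly one of $a_1$ and $a_n$ is odd and all other $a_i$ are even. *)

(* Defs.v *)
From mathcomp Require Import all_boot.
From Stdlib Require Import Relations.Relation_Operators.

Set Implicit Arguments.
Unset Strict Implicit.
Unset Printing Implicit Defensive.

(* Link pseudodiagrams on the sphere are encoded by planar diagram codes.  Each
   edge of the projection carries a label in [nat].  A crossing lists the labels
   of its four edge ends in counterclockwise order, so slots 0, 2 form one of
   its strands and slots 1, 3 the other.  Its state is
     None         unresolved,
     Some true    the strand through slots 0, 2 is over,
     Some false   the strand through slots 1, 3 is over.
   Circles without crossings have no edge ends and are counted separately, so
   that the crossingless unknot is [PD 1 [::]]. *)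
Definition crossing : Type := (option bool * 4.-tuple nat)%type.

Record pseudodiagram := PD { loops : nat; crossings : seq crossing }.

Definition num_crossings (D : pseudodiagram) := size (crossings D).

Definition relabel_crossing (f : nat -> nat) (c : crossing) : crossing :=
  (c.1, [tuple of map f c.2]).

Definition relabel (f : nat -> nat) (D : pseudodiagram) :=
  PD (loops D) (map (relabel_crossing f) (crossings D)).

(* The same crossing, read off starting from its next edge end. *)
Definition rotate_crossing (c : crossing) : crossing :=
  (omap negb c.1, [tuple of rot 1 c.2]).

(* Planar reflection, the over strand staying over. *)
Definition reflect_crossing (c : crossing) : crossing :=
  (c.1, [tuple of rot 3 (rev c.2)]).

Definition rename (x y z : nat) := if z == y then x else z.

(* [fuse id ps D] glues the edges x and y for each pair (x, y) in ps in turn.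
   Gluing an edge to itself closes it up into a circle without crossings.  The
   accumulator f maps each label to its label after the gluings already done. *)
Fixpoint fuse (f : nat -> nat) (ps : seq (nat * nat)) (D : pseudodiagram) :=
  match ps with
  | [::] => relabel f D
  | (x, y) :: ps' =>
      if f x == f y then fuse f ps' (PD (loops D).+1 (crossings D))
      else fuse (rename (f x) (f y) \o f) ps' D
  end.

Section Projection.
Variable D : pseudodiagram.

(* Crossing i together with slot j is an edge end. *)
Definition edge_end : finType := ('I_(num_crossings D) * 'I_4)%type.

Definition label (d : edge_end) : nat :=
  tnth (tnth (in_tuple (crossings D)) d.1).2 d.2.

Definition mate (d : edge_end) : edge_end :=
  odflt d [pick d' | (d' != d) && (label d' == label d)].

Definition turn (d : edge_end) : edge_end := (d.1, ordS d.2).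

Definition opposite (d : edge_end) : edge_end := turn (turn d).

Definition well_labelled :=
  [forall d : edge_end, #|[pred d' | label d' == label d]| == 2].

Definition num_components :=
  n_comp [rel d d' | (d' == mate d) || (d' == opposite d)] edge_end + loops D.

Definition num_faces := fcard (turn \o mate) edge_end.

(* Euler's formula V - E + F = 2 with E = 2 V; a circle without crossings
   contributes V = E = 0 and F = 2.  It characterizes planarity for connected
   projections, in particular for those with one component. *)
Definition euler_planar := num_faces + 2 * loops D == num_crossings D + 2.

Definition knot_pseudodiagram :=
  [&& well_labelled, num_components == 1 & euler_planar].

End Projection.

(* Change of the presentation of a diagram up to isotopy of the sphere. *)
Inductive same_projection : pseudodiagram -> pseudodiagram -> Prop :=
| same_perm l cs cs' of perm_eq cs cs' : same_projection (PD l cs) (PD l cs')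
| same_relabel f D of injective f : same_projection D (relabel f D)
| same_rotate l c cs :
    same_projection (PD l (c :: cs)) (PD l (rotate_crossing c :: cs)).

Definition isotopic := clos_refl_sym_trans pseudodiagram same_projection.

(* Deletion of a kink whose crossing has state s. *)
Inductive delete_kink (s : option bool) : pseudodiagram -> pseudodiagram -> Prop :=
| DeleteKink x a b l cs :
    delete_kink s (PD l ((s, [tuple x; x; a; b]) :: cs))
                  (fuse id [:: (a, b)] (PD l cs)).

(* In R2 the strands b-x-d and a-y-c bound a bigon with sides x and y, and one
   of them is over at both crossings.  In R3 the strands a1-a2, b1-b2 and c1-c2
   bound a triangle; a1-a2 is over (or under) both others and is moved across
   their crossing, which is listed last. *)
Inductive reidemeister : pseudodiagram -> pseudodiagram -> Prop :=
| R1 o D D' of delete_kink (Some o) D D' : reidemeister D D'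
| R2 o x y a b c d l cs :
    reidemeister
      (PD l [:: (Some o, [tuple x; a; b; y]), (Some (~~ o), [tuple c; x; y; d]) & cs])
      (fuse id [:: (b, d); (a, c)] (PD l cs))
| R3 o o' u v w a1 a2 b1 b2 c1 c2 l cs :
    reidemeister
      (PD l [:: (Some o, [tuple w; u; a1; b1]), (Some o, [tuple a2; v; w; c1]),
                (Some o', [tuple b2; c2; u; v]) & cs])
      (PD l [:: (Some o, [tuple a2; b2; w; u]), (Some o, [tuple w; c2; a1; v]),
                (Some o', [tuple u; v; b1; c1]) & cs]).

Definition knot_step (R : pseudodiagram -> pseudodiagram -> Prop) D D' :=
  [/\ knot_pseudodiagram D, knot_pseudodiagram D' & R D D'].

(* Knot pseudodiagrams up to isotopy and Reidemeister moves.  That both sides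
   of a step are planar matters for the inverse of R2, where it forces the two
   edges to lie on a common face. *)
Definition equivalent := clos_refl_sym_trans pseudodiagram
  (knot_step (fun D D' => same_projection D D' \/ reidemeister D D')).

Definition unknot (D : pseudodiagram) := equivalent D (PD 1 [::]).

Definition pseudo_R1s := clos_refl_trans pseudodiagram
  (fun P Q => equivalent P Q \/ knot_step (delete_kink None) P Q).

Inductive player := Knotter | Unknotter.

Definition opponent p := if p is Knotter then Unknotter else Knotter.

Definition default_crossing : crossing := (None, [tuple 0; 0; 0; 0]).

Definition unresolved (D : pseudodiagram) (i : nat) :=
  (i < num_crossings D) && ((nth default_crossing (crossings D) i).1 == None).

Definition resolve (D : pseudodiagram) (i : nat) (o : bool) :=
  PD (loops D) (set_nth default_crossing (crossings D) i
                  (Some o, (nth default_crossing (crossings D) i).2)).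

Definition final_win (p : player) (D : pseudodiagram) :=
  if p is Unknotter then unknot D else ~ unknot D.

(* [wins p m D]: p has a winning strategy from D when m is to move. *)
Inductive wins (p : player) : player -> pseudodiagram -> Prop :=
| wins_final m D of (forall i, ~~ unresolved D i) & final_win p D : wins p m D
| wins_own D i o of unresolved D i & wins p (opponent p) (resolve D i o) :
    wins p p D
| wins_opponent D of (exists i, unresolved D i)
    & (forall i o, unresolved D i -> wins p p (resolve D i o)) :
    wins p (opponent p) D.

(* A two-string tangle: a pseudodiagram with four loose edges.  A label occurs
   twice among the edge ends at the crossings and the four endpoints. *)
Record tangle :=
  Tangle { nw : nat; ne : nat; sw : nat; se : nat; tcrossings : seq crossing }.

Definition empty_tangle := Tangle 0 1 0 1 [::].

(* Reflection across the axis through the NW and SE endpoints. *)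
Definition reflect (t : tangle) :=
  Tangle (nw t) (sw t) (ne t) (se t) (map reflect_crossing (tcrossings t)).

(* The labels 0, ..., 2 k + 1 are in use in a tangle with k crossings. *)
Definition half_twist (t : tangle) :=
  let k := size (tcrossings t) in
  Tangle (nw t) (2 * k + 2) (sw t) (2 * k + 3)
    ((None, [tuple 2 * k + 2; ne t; se t; 2 * k + 3]) :: tcrossings t).

Definition rational_tangle (a : seq nat) :=
  foldl (fun t n => iter n half_twist (reflect t)) empty_tangle a.

Definition tangle_closure (t : tangle) :=
  fuse id [:: (nw t, ne t); (sw t, se t)] (PD 0 (tcrossings t)).

Definition rational_shadow (a : seq nat) := tangle_closure (rational_tangle a).

Definition rational_knot_shadow (T : pseudodiagram) :=
  (exists a, isotopic T (rational_shadow a)) /\ num_components T = 1.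

(* Exactly one of the first and the last entry is odd; in a sequence of length
   one these are the same entry. *)
Definition odd_even (a : seq nat) :=
  exists i, [/\ i < size a, i = 0 \/ i = (size a).-1
             & forall j, j < size a -> odd (nth 0 a j) = (j == i)].

Definition odd_even_shadow (O : pseudodiagram) :=
  exists2 a, odd_even a & isotopic O (rational_shadow a).

(* Main.v *)
(** By Reidemeister II a resolved rational diagram depends only on the signed sum of
    each twist block, and Fox colourings modulo the continuant of these sums show
    that it is knotted when the continuant has absolute value at least 2.  The player
    who moves last can answer a crossing of a block by an opposite one of the same
    block, so that two crossings of a block may be dropped.  In this way the
    Unknotter, moving last, reduces every rational knot shadow to the circle, while
    the Knotter reduces every sequence that does not normalize to an odd-even one to
    one of four short sequences, which are settled by exhaustive search.  On an
    odd-even shadow the Unknotter wins without the last move as well, answering in the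
    same block until the odd block is used up.  Unresolved kinks act as tempo moves
    that change nothing. *)

Require Import Defs.
From mathcomp Require Import all_boot all_algebra zify ring.
From Stdlib Require Import Relations.Relation_Operators.

Set Implicit Arguments.
Unset Strict Implicit.
Unset Printing Implicit Defensive.

Import GRing.Theory Num.Theory.

(** This is why rational diagrams are handled as words in two operations, the reflection and the
    half twist: planarity and the number of components follow by induction on the word. A
    Reidemeister II move in the middle of a word escapes such an induction, because later operations
    bury the two crossings. These operations are therefore handed over to a second, outer tangle,
    until the two crossings lie on the border between both tangles.

    The game is separated from the topology twice. Equivalent diagrams simulate each other move by
    move, so that winning is an invariant; and a rational shadow becomes a game of giving signs to
    variables, decided by the list of block sums. Since removing a kink changes who moves last,
    [strong_win] and [knotter_wins] quantify over the number of tempo moves, which makes them stable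
    under the reductions. All reductions keep the parity of the numerator of the fraction, which
    tells knots from links. *)

(** * Labels, relabelling and the gluing of edges *)

Definition labels (cs : seq crossing) : seq nat :=
  flatten [seq val c.2 | c <- cs].

Notation rl f cs := (map (relabel_crossing f) cs).

Lemma crossingP (c : crossing) :
  exists s p q r u, c = (s, [tuple p; q; r; u]).
Proof.
case: c => s [[|p [|q [|r [|u [|z t]]]]] ht] //; exists s, p, q, r, u.
by congr pair; apply: val_inj.
Qed.

Lemma labels_cons c cs : labels (c :: cs) = val c.2 ++ labels cs.
Proof. by []. Qed.

Lemma labels_cat cs cs' : labels (cs ++ cs') = labels cs ++ labels cs'.
Proof. by rewrite /labels map_cat flatten_cat. Qed.

Lemma labels_rl f cs : labels (rl f cs) = map f (labels cs).
Proof. by rewrite /labels map_flatten -!map_comp. Qed.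

Lemma labels_perm cs cs' : perm_eq cs cs' -> perm_eq (labels cs) (labels cs').
Proof. by move=> h; apply/perm_flatten/perm_map. Qed.

Lemma relabel_crossing_comp f g c :
  relabel_crossing f (relabel_crossing g c) = relabel_crossing (f \o g) c.
Proof.
by rewrite /relabel_crossing /=; congr pair; apply: val_inj; rewrite /= -map_comp.
Qed.

Lemma rl_comp f g cs : rl f (rl g cs) = rl (f \o g) cs.
Proof. by rewrite -map_comp; apply: eq_map => c /=; rewrite relabel_crossing_comp. Qed.

Lemma eq_relabel_crossing f g (c : crossing) :
  {in val c.2, f =1 g} -> relabel_crossing f c = relabel_crossing g c.
Proof.
by move=> h; rewrite /relabel_crossing; congr pair; apply: val_inj; apply/eq_in_map.
Qed.

Lemma eq_rl f g cs : {in labels cs, f =1 g} -> rl f cs = rl g cs.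
Proof.
move=> h; apply/eq_in_map => c hc; apply: eq_relabel_crossing => z hz; apply: h.
by apply/flattenP; exists (val c.2) => //; apply: map_f.
Qed.

Lemma rl_id cs : rl id cs = cs.
Proof.
rewrite -[RHS]map_id; apply: eq_map => -[s t] /=; rewrite /relabel_crossing /=.
by congr pair; apply: val_inj; rewrite /= map_id.
Qed.

Lemma rl_id_in f cs : {in labels cs, f =1 id} -> rl f cs = cs.
Proof. by move=> /eq_rl ->; rewrite rl_id. Qed.

(** The relabelling performed by [fuse], split off, like the number of new circles in [nloops], so
    that both can be studied apart from the crossings. *)
Fixpoint fm (f : nat -> nat) (ps : seq (nat * nat)) : nat -> nat :=
  match ps with
  | [::] => f
  | (x, y) :: ps' =>
      if f x == f y then fm f ps' else fm (rename (f x) (f y) \o f) ps'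
  end.

Fixpoint nloops (f : nat -> nat) (ps : seq (nat * nat)) : nat :=
  match ps with
  | [::] => 0
  | (x, y) :: ps' =>
      if f x == f y then (nloops f ps').+1
      else nloops (rename (f x) (f y) \o f) ps'
  end.

Lemma fuse_fm f ps l cs :
  fuse f ps (PD l cs) = PD (l + nloops f ps) (rl (fm f ps) cs).
Proof.
elim: ps f l => [|[x y] ps IH] f l /=; first by rewrite addn0.
by case: eqP => _; rewrite IH // addSnnS.
Qed.

Lemma fm_factor f ps x y : f x = f y -> fm f ps x = fm f ps y.
Proof.
elim: ps f => [|[a b] ps IH] f //= e; case: eqP => _; apply: IH => //=.
by rewrite e.
Qed.

Lemma fm_glue f ps x y : (x, y) \in ps -> fm f ps x = fm f ps y.
Proof.
elim: ps f => [|[a b] ps IH] f //=; rewrite inE => /orP[/eqP[-> ->]|h].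
  case: eqP => [e|/eqP e]; apply: fm_factor => //=.
  by rewrite /rename eqxx; case: eqP.
by case: eqP => _; apply: IH.
Qed.

Definition glues (T : Type) (g : nat -> T) (ps : seq (nat * nat)) :=
  forall x y, (x, y) \in ps -> g x = g y.

(** The universal property of the quotient by the gluings: [fm] picks a representative of each
    class, and a map that respects the pairs does not see the choice. Comparisons of differently
    glued diagrams rest on this. *)
Lemma fm_univ (T : Type) (g : nat -> T) f ps :
  glues g ps -> (forall z, g (f z) = g z) -> forall z, g (fm f ps z) = g z.
Proof.
elim: ps f => [|[a b] ps IH] f //= hg hf z.
have hab : g a = g b by apply: hg; rewrite mem_head.
have hg' : glues g ps by move=> x y h; apply: hg; rewrite inE h orbT.
case: eqP => _; apply: IH => // t /=; rewrite /rename.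
by case: eqP => [e|//]; rewrite hf hab -hf -e hf.
Qed.

Notation gl := (fm id).

Lemma gl_univ (T : Type) (g : nat -> T) ps : glues g ps -> forall z, g (gl ps z) = g z.
Proof. by move=> h; apply: fm_univ. Qed.

Lemma fuse_comp g f ps l cs :
  fuse (g \o f) ps (PD l cs) =
  fuse g [seq (f p.1, f p.2) | p <- ps] (PD l (rl f cs)).
Proof.
elim: ps g l => [|[x y] ps IH] g l /=; first by rewrite /relabel /= rl_comp.
by case: ifP => _; rewrite -IH.
Qed.

Lemma fuse_map f ps l cs :
  fuse f ps (PD l cs) =
  fuse id [seq (f p.1, f p.2) | p <- ps] (PD l (rl f cs)).
Proof. exact: (fuse_comp id). Qed.

Lemma fuse_cons x y ps l cs :
  fuse id ((x, y) :: ps) (PD l cs) =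
  if x == y then fuse id ps (PD l.+1 cs)
  else fuse id [seq (rename x y p.1, rename x y p.2) | p <- ps]
                (PD l (rl (rename x y) cs)).
Proof. by rewrite /=; case: eqP => // _; rewrite fuse_map. Qed.

Lemma fuse_cat ps ps' l cs :
  fuse id (ps ++ ps') (PD l cs) =
  fuse id [seq (gl ps p.1, gl ps p.2) | p <- ps'] (fuse id ps (PD l cs)).
Proof.
have gen f : fuse f (ps ++ ps') (PD l cs) =
   fuse id [seq (fm f ps p.1, fm f ps p.2) | p <- ps'] (fuse f ps (PD l cs)).
  elim: ps f l => [|[x y] ps IH] f l /=; first by rewrite fuse_map.
  by case: eqP => _; apply: IH.
exact: gen.
Qed.

(** * Isotopy *)

Lemma iso_refl D : isotopic D D. Proof. exact: rst_refl. Qed.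
Lemma iso_sym D D' : isotopic D D' -> isotopic D' D. Proof. exact: rst_sym. Qed.
Lemma iso_trans D2 D1 D3 : isotopic D1 D2 -> isotopic D2 D3 -> isotopic D1 D3.
Proof. exact: rst_trans. Qed.
Lemma iso_perm l cs cs' : perm_eq cs cs' -> isotopic (PD l cs) (PD l cs').
Proof. by move=> h; apply/rst_step/same_perm. Qed.

Lemma iso_relabel D f : {in labels (crossings D) &, injective f} ->
  isotopic D (relabel f D).
Proof.
case: D => l cs /= hf.
pose M := (\max_(z <- labels cs) f z).+1.
(* Labels not in use are shifted beyond all values of [f], which makes the map injective on all of
   [nat], as [same_relabel] demands. *)
pose g z := if z \in labels cs then f z else z + M.
have hM z : z \in labels cs -> f z < M.
  by move=> hz; rewrite ltnS (@leq_bigmax_seq _ _ predT f _ hz).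
have gI : injective g.
  move=> x y; rewrite /g; case: ifP => hx; case: ifP => hy; first exact: hf.
  - by move=> e; move: (hM _ hx); rewrite e; lia.
  - by move=> e; move: (hM _ hy); rewrite -e; lia.
  - by move/addIn.
have -> : relabel f (PD l cs) = relabel g (PD l cs).
  by rewrite /relabel /=; congr PD; apply: eq_rl => z hz; rewrite /g hz.
exact/rst_step/same_relabel.
Qed.

Definition cyc (c c' : crossing) := exists n, c' = iter n rotate_crossing c.

Lemma rotate_crossing4 c : iter 4 rotate_crossing c = c.
Proof.
have [s [p [q [r [u ->]]]]] := crossingP c.
rewrite /= /rotate_crossing /=; congr pair; first by case: s => // -[].
exact: val_inj.
Qed.

Lemma cyc_refl c : cyc c c. Proof. by exists 0. Qed.
Lemma cyc_sym c c' : cyc c c' -> cyc c' c.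
Proof.
(* Four rotations are the identity, so [3 * n] more of them undo [n]. *)
case=> n ->; exists (3 * n); rewrite -iterD addnC -mulSn.
by elim: n => // n IH; rewrite mulnS iterD -IH rotate_crossing4.
Qed.

Inductive cyceq : seq crossing -> seq crossing -> Prop :=
| cyceq_nil : cyceq [::] [::]
| cyceq_cons c c' cs cs' : cyc c c' -> cyceq cs cs' -> cyceq (c :: cs) (c' :: cs').

(** The same crossings, listed in another order and each read off from any of its ends. Permuting
    before rotating is a normal form; [cyceq_perm] restores it under composition. *)
Definition ceq cs cs' := exists2 cs1, perm_eq cs cs1 & cyceq cs1 cs'.

Lemma cyceq_refl cs : cyceq cs cs.
Proof. elim: cs => [|c cs IH]; constructor => //; exact: cyc_refl. Qed.

Lemma ceq_refl cs : ceq cs cs.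
Proof. by exists cs => //; apply: cyceq_refl. Qed.

Lemma ceq_cons c c' cs cs' : cyc c c' -> ceq cs cs' -> ceq (c :: cs) (c' :: cs').
Proof.
by move=> h [x px cx]; exists (c :: x); rewrite ?perm_cons //; constructor.
Qed.

Lemma perm_ceq cs cs' : perm_eq cs cs' -> ceq cs cs'.
Proof. by move=> h; exists cs' => //; apply: cyceq_refl. Qed.

Lemma cyceq_perm a b c : cyceq a b -> perm_eq b c -> exists2 b', perm_eq a b' & cyceq b' c.
Proof.
elim: c a b => [|x c IH] a b h.
  move/perm_nilP => e; rewrite e in h; inversion h; exists [::] => //; constructor.
move=> p; have xb : x \in b by rewrite (perm_mem p) mem_head.
have {xb} : exists a1 y a2 b1 b2, [/\ a = a1 ++ y :: a2, b = b1 ++ x :: b2, cyc y x,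
    cyceq (a1 ++ a2) (b1 ++ b2) & True].
  elim: h xb {p} => // y y' a' b' cy h IH'; rewrite inE; case: eqP => [->|_] /=.
    by exists [::], y, a', [::], b'.
  case/IH' => a1 [z [a2 [b1 [b2 [-> -> cz h2 _]]]]].
  exists (y :: a1), z, a2, (y' :: b1), b2; split=> //=; constructor=> //.
case=> a1 [y [a2 [b1 [b2 [ea eb cy h2 _]]]]].
have p2 : perm_eq (b1 ++ b2) c.
  move: p; rewrite eb -cat1s perm_catCA /= perm_cons //.
have [b' p3 h3] := IH _ _ h2 p2.
exists (y :: b'); last by constructor.
by rewrite ea -cat1s perm_catCA /= perm_cons.
Qed.

Lemma cyceq_trans a b c : cyceq a b -> cyceq b c -> cyceq a c.
Proof.
move=> h; elim: h c => // x y a' b' [n ->] h IH c h2; inversion h2 as [|? ? ? ? hc]; subst.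
constructor; last exact: IH.
by case: hc => m ->; exists (m + n); rewrite iterD.
Qed.

Lemma ceq_trans b a c : ceq a b -> ceq b c -> ceq a c.
Proof.
case=> x px cx [y py cy]; have [b' p1 c1] := cyceq_perm cx py.
exists b'; [exact: perm_trans px p1|exact: cyceq_trans c1 cy].
Qed.

Lemma cyceq_sym a b : cyceq a b -> cyceq b a.
Proof. by elim=> *; constructor=> //; apply: cyc_sym. Qed.

Lemma ceq_sym a b : ceq a b -> ceq b a.
Proof.
case=> x px /cyceq_sym cx; rewrite perm_sym in px.
by have [b' p c] := cyceq_perm cx px; exists b'.
Qed.

Lemma ceq_labels a b : ceq a b -> perm_eq (labels a) (labels b).
Proof.
case=> x px cx; apply: (perm_trans (labels_perm px)).
elim: cx {px} => // c c' cs cs' [n ->] _ IH; rewrite !labels_cons; apply: perm_cat => //.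
by elim: n => //= n /perm_trans; apply; rewrite perm_sym perm_rot.
Qed.

Lemma ceq_iso l a b : ceq a b -> isotopic (PD l a) (PD l b).
Proof.
case=> x px cx; apply: (iso_trans (iso_perm l px)).
suff gen pre : isotopic (PD l (pre ++ x)) (PD l (pre ++ b)) by exact: (gen [::]).
elim: cx pre {px} => [|c c' cs cs' [n ->] _ IH] pre; first exact: iso_refl.
have pm d ds : perm_eq (pre ++ d :: ds) (d :: pre ++ ds).
  by rewrite -cat1s perm_catCA.
apply: (@iso_trans (PD l (iter n rotate_crossing c :: pre ++ cs))).
  apply: (iso_trans (iso_perm l (pm _ _))).
  elim: n => [|n IHn]; first exact: iso_refl.
  by apply: (iso_trans IHn); apply/rst_step/same_rotate.
apply: iso_sym; apply: (iso_trans (iso_perm l (pm _ _))); apply: iso_sym.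
exact: (IH (_ :: pre)).
Qed.

(** Two finite sets mapped onto each other have the same size, which forces injectivity. A
    relabelling thus need not be checked for injectivity by hand; a relabelling back suffices. *)
Lemma surj_inj_in (L L' : seq nat) h k :
  L' =i map h L -> L =i map k L' -> {in L &, injective h}.
Proof.
move=> h1 h2.
have s1 : size (undup L') <= size (undup L).
  rewrite -(size_map h (undup L)); apply: uniq_leq_size; first exact: undup_uniq.
  move=> z; rewrite mem_undup h1 => /mapP[t ht ->]; apply: map_f.
  by rewrite mem_undup.
have s2 : size (undup L) <= size (undup L').
  rewrite -(size_map k (undup L')); apply: uniq_leq_size; first exact: undup_uniq.
  move=> z; rewrite mem_undup h2 => /mapP[t ht ->]; apply: map_f.
  by rewrite mem_undup.
have u : uniq (map h (undup L)).
  apply: (@leq_size_uniq _ (undup L')); first exact: undup_uniq.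
    by move=> z; rewrite mem_undup h1 => /mapP[t ht ->]; apply: map_f; rewrite mem_undup.
  by rewrite size_map.
move=> x y; rewrite -![_ \in L]mem_undup => hx hy e.
rewrite -(nth_index 0 hx) -(nth_index 0 hy); congr (nth _ _ _).
apply/eqP; rewrite -(nth_uniq (h 0) _ _ u) ?size_map ?index_mem //.
by rewrite !(nth_map 0) ?index_mem // !nth_index // e.
Qed.

Lemma iso_mutual l h k cs cs' :
  ceq (rl h cs) cs' -> ceq (rl k cs') cs -> isotopic (PD l cs) (PD l cs').
Proof.
move=> h1 h2; apply: iso_trans (ceq_iso l h1); apply: (@iso_relabel (PD l cs)) => /=.
apply: (@surj_inj_in _ (labels cs') h k) => z.
  by rewrite -(perm_mem (ceq_labels h1)) labels_rl.
by rewrite -(perm_mem (ceq_labels h2)) labels_rl.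
Qed.

(** [f] and [g] go between the labels before gluing. Since each respects the pairs glued on its own
    side, both descend to relabellings of the glued diagrams. *)
Lemma iso_glued l ps ps' f g cs cs' :
  glues (gl ps' \o f) ps -> glues (gl ps \o g) ps' ->
  ceq (rl (gl ps' \o f) cs) (rl (gl ps') cs') ->
  ceq (rl (gl ps \o g) cs') (rl (gl ps) cs) ->
  isotopic (PD l (rl (gl ps) cs)) (PD l (rl (gl ps') cs')).
Proof.
move=> h1 h2 c1 c2; apply: (@iso_mutual l (gl ps' \o f) (gl ps \o g)).
  rewrite rl_comp (@eq_rl _ (gl ps' \o f)) // => z _.
  exact: gl_univ.
rewrite rl_comp (@eq_rl _ (gl ps \o g)) // => z _.
exact: gl_univ.
Qed.

(** * Well-labelled diagrams and their components *)

Definition wll (L : seq nat) := forall z, z \in L -> count_mem z L = 2.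

Lemma labelE D (d : edge_end D) :
  label d = nth 0 (nth default_crossing (crossings D) d.1).2 d.2.
Proof. by rewrite /label !(tnth_nth 0) (tnth_nth default_crossing). Qed.

Lemma card_label D z :
  #|[pred d : edge_end D | label d == z]| = count_mem z (labels (crossings D)).
Proof.
rewrite -sum1_card big_mkcond /= -(pair_bigA _ (fun i j => if label ((i, j) : edge_end D) == z then 1 else 0)) /=.
rewrite /labels count_flatten sumnE !big_map [RHS]big_tnth.
apply: eq_bigr => i _; rewrite -sum1_count [RHS]big_mkcond /= [RHS]big_tuple.
exact: eq_bigr.
Qed.

Lemma label_mem D (d : edge_end D) : label d \in labels (crossings D).
Proof.
rewrite -has_pred1 has_count -card_label; apply/card_gt0P; exists d.
by rewrite inE eqxx.
Qed.

Lemma mem_label D z : z \in labels (crossings D) -> exists d : edge_end D, label d = z.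
Proof.
rewrite -has_pred1 has_count -card_label => /card_gt0P[d]; rewrite inE => /eqP h.
by exists d.
Qed.

Lemma wlP D : reflect (wll (labels (crossings D))) (well_labelled D).
Proof.
apply: (iffP forallP) => [h z /mem_label[d <-]|h d].
  by rewrite -card_label; apply/eqP/h.
by rewrite card_label h ?label_mem.
Qed.

Lemma wl_mate D (d : edge_end D) : well_labelled D ->
  [/\ mate d != d, label (mate d) = label d &
      forall d', d' != d -> label d' = label d -> d' = mate d].
Proof.
move=> /forallP/(_ d)/eqP h.
have hc : #|[pred d' | (d' != d) && (label d' == label d)]| = 1.
  move: h; rewrite (cardD1 d) inE eqxx add1n => -[<-].
  by apply: eq_card => x; rewrite !inE.
have := card1P (introT eqP hc); case=> y hy.
have m : mate d = y.
  rewrite /mate; case: pickP => [x hx|/(_ y)] /=; first by have := hy x; rewrite !inE hx => /esym/eqP.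
  by have := hy y; rewrite !inE eqxx => ->.
rewrite m; have := hy y; rewrite !inE eqxx => /andP[-> /eqP ->]; split=> // d' n e.
by have := hy d'; rewrite !inE n e eqxx => /esym/eqP.
Qed.

Lemma mateK D : well_labelled D -> involutive (@mate D).
Proof.
move=> wl d; have [n e _] := wl_mate d wl; have [_ _ u] := wl_mate (mate d) wl.
by apply/esym/u; rewrite 1?eq_sym.
Qed.

Lemma ordS4 (j : 'I_4) : ordS (ordS (ordS (ordS j))) = j.
Proof. by apply: val_inj; case: j => [[|[|[|[|j]]]] hj]. Qed.

Lemma turn4 D (d : edge_end D) : turn (turn (turn (turn d))) = d.
Proof. by case: d => i j; rewrite /turn /= ordS4. Qed.

Lemma turn_inj D : injective (@turn D).
Proof. by move=> d d' e; rewrite -[d]turn4 -[d']turn4 e. Qed.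

Lemma oppositeK D : involutive (@opposite D).
Proof. by move=> d; rewrite /opposite turn4. Qed.

Definition comp_rel D : rel (edge_end D) :=
  [rel d d' | (d' == mate d) || (d' == opposite d)].

Lemma comp_rel_sym D : well_labelled D -> connect_sym (@comp_rel D).
Proof.
move=> wl; apply: sym_connect_sym => d d'; rewrite /comp_rel /=.
rewrite eq_sym (inv_eq (mateK wl)); congr orb.
by rewrite eq_sym (inv_eq (@oppositeK D)).
Qed.

Lemma face_inj D : well_labelled D -> injective (@turn D \o @mate D).
Proof.
by move=> wl; apply: inj_comp; [exact: turn_inj | exact: can_inj (mateK wl)].
Qed.

(** An equivalence of graphs in a weak sense: [h] and [r] are inverse only up to connectedness, and
    [a] is only a closed part, so that a component can be split off before the comparison. *)
Lemma n_comp_adj (T T' : finType) (e : rel T) (e' : rel T') (a : pred T)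
  (h : T' -> T) (r : T -> T') :
  connect_sym e -> connect_sym e' -> closed e a ->
  (forall x', h x' \in a) ->
  (forall x' y', e' x' y' -> connect e (h x') (h y')) ->
  (forall x y, x \in a -> e x y -> connect e' (r x) (r y)) ->
  (forall x', connect e' x' (r (h x'))) ->
  (forall x, x \in a -> connect e x (h (r x))) ->
  n_comp e a = n_comp e' T'.
Proof.
move=> se se' ca ha hh hr rh hr'.
rewrite (adjunction_n_comp h se se' ca); last first.
  apply: RelAdjunction => [x ax|x' y' _]; first by exists (r x); apply: hr'.
  apply/idP/idP.
    case/connectP=> p + ->; elim: p x' => [|z p IH] x' //= /andP[xz pz].
    exact: connect_trans (hh _ _ xz) (IH _ pz).
  move=> c; apply: (connect_trans (rh _)); rewrite se'; apply: (connect_trans (rh _)).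
  rewrite se'; case/connectP: c => p + ->; move: (ha x') => {}ha.
  elim: p (h x') ha => [|z p IH] x ax //= /andP[xz pz].
  apply: connect_trans (hr _ _ ax xz) (IH _ _ pz).
  by rewrite -(ca _ _ xz).
by apply: eq_n_comp_r => x'; rewrite !inE; apply: ha.
Qed.

Lemma loops_components D : well_labelled D -> num_components D = 1 -> crossings D != [::] -> loops D = 0.
Proof.
case: D => l [|c cs] //= wl h _.
have : 0 < n_comp (@comp_rel (PD l (c :: cs))) (edge_end (PD l (c :: cs))).
  pose d0 : edge_end (PD l (c :: cs)) := (ord0, ord0).
  apply/card_gt0P; exists (fingraph.root (@comp_rel _) d0).
  by rewrite inE /= andbT roots_root //; apply: comp_rel_sym.
by move: h; rewrite /num_components /comp_rel /=; lia.
Qed.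

Definition slot (c : crossing) j := nth 0 (val c.2) j.

Definition strand_const (chi : nat -> bool) (c : crossing) :=
  (chi (slot c 0) == chi (slot c 2)) && (chi (slot c 1) == chi (slot c 3)).

Definition const_on (T : eqType) (f : nat -> T) (L : seq nat) :=
  forall x y, x \in L -> y \in L -> f x = f y.

Lemma strand_rl chi f c :
  strand_const chi (relabel_crossing f c) = strand_const (chi \o f) c.
Proof. by have [s [p [q [r [u ->]]]]] := crossingP c. Qed.

Lemma strands_rl chi f cs :
  all (strand_const chi) (rl f cs) = all (strand_const (chi \o f)) cs.
Proof. by rewrite all_map; apply: eq_all => c /=; rewrite strand_rl. Qed.

(** Edges are two-coloured instead of traversed: a colouring constant along strands is constant on
    components. Together with [components1_intro] this turns having one component into a statement
    about colourings, which is easily followed through gluings. *)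
Lemma components1_const D chi : well_labelled D -> num_components D = 1 ->
  all (strand_const chi) (crossings D) -> const_on chi (labels (crossings D)).
Proof.
move=> wl h1 /allP hc _ _ /mem_label[d <-] /mem_label[d' <-].
have hn : n_comp (@comp_rel D) (edge_end D) <= 1.
  by move: h1; rewrite /num_components /comp_rel; lia.
have sy := comp_rel_sym wl.
have cd : connect (@comp_rel D) d d'.
  apply/(fingraph.rootP sy)/(card_le1_eqP hn); rewrite inE /= ?andbT roots_root //.
have cl : closed (@comp_rel D) [pred x | chi (label x) == chi (label d)].
  move=> x y /= /orP[/eqP ->|/eqP ->]; rewrite !inE; first by have [_ ->] := wl_mate x wl.
  have /hc : nth default_crossing (crossings D) x.1 \in crossings D by apply: mem_nth.
  rewrite !labelE /opposite /turn /=; case: (x.2) => -[|[|[|[|j]]]] //= hj;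
  by move=> /andP[/eqP e1 /eqP e2]; rewrite /slot in e1 e2; rewrite ?e1 ?e2.
by have := closed_connect cl cd; rewrite !inE eqxx => /esym/eqP.
Qed.

Lemma components1_intro D : well_labelled D -> loops D = 0 -> crossings D != [::] ->
  (forall chi, all (strand_const chi) (crossings D) -> const_on chi (labels (crossings D))) ->
  num_components D = 1.
Proof.
case: D => l [|c cs] //= wl l0 _ h; subst l; rewrite /num_components addn0.
set D := PD _ _ in wl h *.
have sy := comp_rel_sym wl.
pose d0 : edge_end D := (ord0, ord0).
(* [chi] marks the edges on the component of [d0]. *)
pose chi z := [exists d : edge_end D, (label d == z) && connect (@comp_rel D) d0 d].
have lab d : chi (label d) = connect (@comp_rel D) d0 d.
  apply/existsP/idP => [[d' /andP[/eqP e cd]]|cd]; last by exists d; rewrite eqxx.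
  case: (d' =P d) => [<- //|/eqP n]; have [_ _ /(_ _ n e) m] := wl_mate d wl.
  apply: (connect_trans cd); rewrite sy; apply: connect1.
  by rewrite /comp_rel /= m eqxx.
have opp d : connect (@comp_rel D) d0 (opposite d) = connect (@comp_rel D) d0 d.
  have cc : connect (@comp_rel D) d (opposite d) by apply: connect1; rewrite /comp_rel /= eqxx orbT.
  by apply/idP/idP => hh; apply: (connect_trans hh) => //; rewrite sy.
have : all (strand_const chi) (crossings D).
  apply/(all_nthP default_crossing) => i hi.
  have L j (hj : j < 4) : chi (slot (nth default_crossing (crossings D) i) j) =
     connect (@comp_rel D) d0 (Ordinal hi, Ordinal hj).
    by rewrite -lab labelE.
  rewrite /strand_const !L; apply/andP; split; apply/eqP; rewrite -opp; congr connect;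
  by rewrite /opposite /turn /=; congr pair; apply: val_inj.
move/h => hcst.
apply/eqP; rewrite eqn_leq; apply/andP; split.
  apply/card_le1_eqP => x y; rewrite !inE !andbT => /eqP rx /eqP ry; rewrite -rx -ry.
  have all0 d : connect (@comp_rel D) d0 d.
    by rewrite -lab (hcst (label d) (label d0)) ?label_mem // lab connect0.
  by apply/(fingraph.rootP sy)/(@connect_trans _ _ d0); rewrite // sy.
apply/card_gt0P; exists (fingraph.root (@comp_rel D) d0).
by rewrite inE /= andbT roots_root.
Qed.

Definition pair_labels (ps : seq (nat * nat)) := flatten [seq [:: p.1; p.2] | p <- ps].

Definition all_labels cs ps := labels cs ++ pair_labels ps.

Lemma count_rename x y z L : x != y ->
  count_mem z (map (rename x y) L) =
  if z == x then count_mem x L + count_mem y L else if z == y then 0 else count_mem z L.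
Proof.
move=> n; rewrite count_map; elim: L => [|t L /= ->]; first by case: (z == x); case: (z == y).
rewrite /rename /= ; case: (t =P y) => [->|/eqP ty].
  case: (z =P x) => [->|/eqP zx]; first by rewrite eqxx eq_sym (negbTE n); lia.
  by rewrite [x == z]eq_sym (negbTE zx) [y == z]eq_sym; case: (z == y).
case: (z =P x) => [->|/eqP zx]; first by lia.
by case: (z =P y) => [->|/eqP zy] //; rewrite ?(negbTE ty).
Qed.

Lemma pair_labels_map f ps :
  pair_labels [seq (f p.1, f p.2) | p <- ps] = map f (pair_labels ps).
Proof. by rewrite /pair_labels map_flatten -!map_comp. Qed.

(** Equivalent to [wll], but speaking of all labels at once, which makes it convenient for the
    renaming in a gluing step, where one label disappears. *)
Definition okl (L : seq nat) := forall z, (count_mem z L == 0) || (count_mem z L == 2).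

Lemma okl_wll L : okl L -> wll L.
Proof.
move=> h z; rewrite -has_pred1 has_count; case/orP: (h z) => /eqP -> //.
Qed.

Lemma wll_okl L : wll L -> okl L.
Proof.
move=> h z; case: (boolP (z \in L)) => [/h -> //|].
by move/count_memPn => ->.
Qed.

Lemma okl_perm L L' : perm_eq L L' -> okl L -> okl L'.
Proof. by move=> /permP p h z; rewrite -p. Qed.

Lemma okl_rename x y L : okl (x :: y :: L) -> x != y -> okl (map (rename x y) L).
Proof.
move=> h n z; rewrite count_rename //.
move: (h x) (h y) (h z) => /=; rewrite !eqxx [y == x]eq_sym (negbTE n).
case: (z =P x) => [->|/eqP zx].
  by move=> /orP[/eqP|/eqP] h1 /orP[/eqP|/eqP] h2 _; apply/orP; lia.
by rewrite [x == z]eq_sym (negbTE zx) [y == z]eq_sym; case: (z == y).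
Qed.

Lemma all_labels_cons x y cs ps :
  perm_eq (all_labels cs ((x, y) :: ps)) (x :: y :: all_labels cs ps).
Proof.
apply/permPl; exact: (perm_catCA (labels cs) [:: x; y] (pair_labels ps)).
Qed.

Lemma all_labels_rename x y cs ps :
  all_labels (rl (rename x y) cs) [seq (rename x y p.1, rename x y p.2) | p <- ps]
  = map (rename x y) (all_labels cs ps).
Proof. by rewrite /all_labels labels_rl pair_labels_map map_cat. Qed.

Lemma okl_same x L : okl (x :: x :: L) -> (x \notin L) /\ okl L.
Proof.
move=> h; have hx : x \notin L.
  by have := h x; rewrite /= eqxx => hh; apply/count_memPn; move: hh; case: (count _ _) => [|n].
split=> // z; have := h z => /=; case: (x =P z) => [<-|_] //.
by rewrite (count_memPn hx).
Qed.

Lemma fuse_okl ps l cs : okl (all_labels cs ps) ->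
  okl (labels (crossings (fuse id ps (PD l cs)))).
Proof.
have [n hn] := ubnP (size ps); elim: n ps l cs hn => // n IH [|[x y] ps] l cs hn h.
  by rewrite /= rl_id; move: h; rewrite /all_labels /= cats0.
have {h} h := okl_perm (all_labels_cons x y cs ps) h.
rewrite fuse_cons; case: eqP => [e|/eqP n0].
  by apply: IH => //; rewrite e in h; have [] := okl_same h.
apply: IH; first by rewrite size_map.
by rewrite all_labels_rename; apply: okl_rename.
Qed.

Lemma fuse_wl ps l cs : okl (all_labels cs ps) -> well_labelled (fuse id ps (PD l cs)).
Proof. by move=> h; apply/wlP/okl_wll/fuse_okl. Qed.

Lemma nil_of_labels cs : labels cs = [::] -> cs = [::].
Proof. by case: cs => // c cs; have [s [p [q [r [u ->]]]]] := crossingP c. Qed.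

(** The colouring criterion, read off before gluing. Each gluing is one induction step; if it closes
    up a circle, that circle has to be the whole diagram. *)
Lemma fuse_components1 ps cs : okl (all_labels cs ps) -> all_labels cs ps != [::] ->
  (forall chi, all (strand_const chi) cs -> glues chi ps -> const_on chi (all_labels cs ps)) ->
  num_components (fuse id ps (PD 0 cs)) = 1.
Proof.
have [n hn] := ubnP (size ps); elim: n ps cs hn => // n IH [|[x y] ps] cs hn ok ne h.
  rewrite /= /relabel /= rl_id; rewrite /all_labels /= cats0 in ok ne h.
  apply: components1_intro => //; first exact/wlP/okl_wll.
    by move: ne; case: (cs).
  by move=> chi /h; apply.
have p := all_labels_cons x y cs ps; have ok' := okl_perm p ok.
rewrite fuse_cons; case: eqP => [e|/eqP n0].
  rewrite -{}e in ok' h p *.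
  have [hx ok2] := okl_same ok'.
  (* The colouring that singles out the closed edge [x] respects all strands and pairs, since [x]
     occurs nowhere else. *)
  have : const_on (pred1 x) (all_labels cs ((x, x) :: ps)).
    have hL z : z \in all_labels cs ps -> (z == x) = false.
      by move=> hz; apply: contraNF hx => /eqP <-.
    apply: h => [|z t].
      apply/allP => c hc; have hs j : j < 4 -> pred1 x (slot c j) = false.
        move=> hj; apply: hL; rewrite mem_cat; apply/orP; left.
        by apply/flattenP; exists (val c.2); [apply: map_f|apply: mem_nth; rewrite size_tuple].
      by rewrite /strand_const !hs.
    rewrite inE => /orP[/eqP[-> ->]//|hp].
    have pl u : u \in [:: z; t] -> u \in all_labels cs ps.
      move=> hu; rewrite mem_cat; apply/orP; right; apply/flattenP; exists [:: z; t] => //.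
      by apply/mapP; exists (z, t).
    by rewrite /= !hL // pl // !inE eqxx ?orbT.
  move=> cst; have E : all_labels cs ps = [::].
    apply/eqP; apply: contraT => ne'; case El : (all_labels cs ps) => [|z L]; first by rewrite El in ne'.
    have := cst x z; rewrite !(perm_mem p) El !inE !eqxx ?orbT => /(_ isT isT) /= /esym/eqP e.
    by move: hx; rewrite El e mem_head.
  move: E; rewrite /all_labels; case El : (labels cs) => [|//] /=.
  rewrite (nil_of_labels El); case: ps {hn ok h p ok' hx ok2 cst ne} => [|[]] // _.
  rewrite /= /num_components /= -[RHS]add0n; congr addn.
  by apply: eq_card0 => -[[]].
apply: IH; first by rewrite size_map.
- by rewrite all_labels_rename; apply: okl_rename.
- rewrite all_labels_rename; case El : (all_labels cs ps) => [|//].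
  by have := ok' x; rewrite El /= eqxx [y == x]eq_sym (negbTE n0).
move=> chi; rewrite strands_rl => h1 h2.
have g : glues (chi \o rename x y) ((x, y) :: ps).
  move=> z t; rewrite inE => /orP[/eqP[-> ->]|hzt] /=.
    by rewrite /rename eqxx; case: eqP.
  by apply: h2; apply/mapP; exists (z, t).
rewrite all_labels_rename => _ _ /mapP[z hz ->] /mapP[t ht ->].
by apply: (h _ h1 g); rewrite (perm_mem p) !inE ?hz ?ht !orbT.
Qed.

(** * Invariance of components and faces under bijections of edge ends *)

Lemma n_comp_bij (T T' : finType) (e : rel T) (e' : rel T') (h : T' -> T) :
  connect_sym e -> connect_sym e' -> bijective h ->
  (forall x' y', e' x' y' -> connect e (h x') (h y')) ->
  (forall x' y', e (h x') (h y') -> connect e' x' y') ->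
  n_comp e T = n_comp e' T'.
Proof.
move=> se se' [r hK rK] h1 h2; apply: (@n_comp_adj _ _ _ _ _ h r) => //.
- by move=> x y _; rewrite -{1}[x]rK -{1}[y]rK => /h2.
- by move=> x; rewrite hK.
- by move=> x _; rewrite rK.
Qed.

(** Components and faces depend only on how edge ends are joined and ordered around crossings, and
    they do not distinguish the two orientations of the sphere. *)
Lemma darts_iso D D' (h : edge_end D -> edge_end D') :
  injective h -> loops D' = loops D -> num_crossings D' = num_crossings D ->
  (forall d d', (label (h d) == label (h d')) = (label d == label d')) ->
  (forall d, h (turn d) = turn (h d)) \/ (forall d, turn (h (turn d)) = h d) ->
  well_labelled D ->
  [/\ well_labelled D', num_components D' = num_components D &
      num_faces D' = num_faces D].
Proof.
move=> hI hl hn hlab ht wl.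
have bh : bijective h by apply: inj_card_bij => //; rewrite !card_prod !card_ord hn.
have [r hK rK] := bh.
have wl' : well_labelled D'.
  apply/forallP => d'; rewrite -[d']rK; move/forallP: wl => /(_ (r d')) /eqP <-.
  rewrite -!sum1_card (reindex h) /=; last exact: onW_bij.
  by apply/eqP/eq_bigl => d; rewrite !inE hlab.
have hm d : mate (h d) = h (mate d).
  have [n e _] := wl_mate d wl; have [_ _ u] := wl_mate (h d) wl'.
  by apply/esym/u; [rewrite (inj_eq hI)|apply/eqP; rewrite hlab e].
have ho d : opposite (h d) = h (opposite d).
  case: ht => ht; first by rewrite /opposite !ht.
  by rewrite -{1}[d]oppositeK {1 2 3}/opposite !ht.
have ec : num_components D' = num_components D.
  rewrite /num_components hl; congr addn.
  apply: (n_comp_bij (comp_rel_sym wl') (comp_rel_sym wl) bh) => x y.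
    by rewrite /comp_rel /= => /orP[/eqP->|/eqP->]; apply: connect1;
       rewrite /= ?hm ?ho eqxx ?orbT.
  rewrite /comp_rel /= hm ho !(inj_eq hI) => e; exact: connect1.
have ef : num_faces D' = num_faces D.
  have s := fconnect_sym (face_inj wl); have s' := fconnect_sym (face_inj wl').
  case: ht => ht.
    apply: (n_comp_bij s' s bh) => x y /=.
      by move/eqP=> <-; apply: connect1; rewrite /= hm ht.
    by rewrite hm -ht (inj_eq hI) => e; apply: connect1.
  (* A reversal carries the walk around a face to the walk backwards; through [h \o mate] the two
     face maps become inverse to each other. *)
  have bh' : bijective (h \o @mate D) by apply: bij_comp => //; apply: inv_bij (mateK wl).
  apply: (n_comp_bij s' s bh') => x y /=.
    move/eqP=> <-; rewrite s'; apply: connect1 => /=.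
    by rewrite hm (mateK wl) ht.
  rewrite hm (mateK wl) => /eqP e; rewrite s; apply: connect1 => /=.
  by move: e; rewrite -(ht (mate y)) => /turn_inj/hI ->.
by split.
Qed.

Lemma darts_map D D' (sg k : nat -> nat) (g : nat -> nat) :
  loops D' = loops D -> num_crossings D' = num_crossings D ->
  {in gtn (num_crossings D) &, injective sg} ->
  (forall i, i < num_crossings D -> sg i < num_crossings D) ->
  {in labels (crossings D) &, injective g} ->
  (forall i j, i < num_crossings D -> j < 4 ->
     slot (nth default_crossing (crossings D') (sg i)) ((j + k i) %% 4) =
     g (slot (nth default_crossing (crossings D) i) j)) ->
  well_labelled D ->
  [/\ well_labelled D', num_components D' = num_components D &
      num_faces D' = num_faces D].
Proof.
move=> hl hn sI sL gI hs.
have hb i : i < num_crossings D -> sg i < num_crossings D' by rewrite hn; apply: sL.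
pose h (d : edge_end D) : edge_end D' :=
  (Ordinal (hb _ (ltn_ord d.1)), Ordinal (ltn_pmod (d.2 + k d.1) (isT : 0 < 4))).
have lab d : label (h d) = g (label d) by rewrite !labelE /h /= -!/(slot _ _) hs.
apply: (@darts_iso _ _ h) => //.
- move=> [i j] [i' j'] [] /sI e1 e2.
  have {}e1 : i = i' by apply/val_inj/e1; rewrite inE ltn_ord.
  rewrite -{}e1 in e2 *; congr pair; apply/val_inj/eqP => /=.
  move/eqP: e2; rewrite eqn_modDr !modn_small ?ltn_ord //.
- by move=> d d'; rewrite !lab (inj_in_eq gI) ?label_mem.
left=> -[i j]; rewrite /h /turn /=; congr pair; apply/val_inj => /=.
by rewrite modnDml -addn1 -[in RHS]addn1 modnDml addnAC.
Qed.

Definition same_shape D D' := well_labelled D ->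
  [/\ well_labelled D', num_components D' = num_components D, num_faces D' = num_faces D,
      loops D' = loops D & num_crossings D' = num_crossings D].

Lemma shape_map D D' (sg k : nat -> nat) (g : nat -> nat) :
  loops D' = loops D -> num_crossings D' = num_crossings D ->
  {in gtn (num_crossings D) &, injective sg} ->
  (forall i, i < num_crossings D -> sg i < num_crossings D) ->
  {in labels (crossings D) &, injective g} ->
  (forall i j, i < num_crossings D -> j < 4 ->
     slot (nth default_crossing (crossings D') (sg i)) ((j + k i) %% 4) =
     g (slot (nth default_crossing (crossings D) i) j)) ->
  same_shape D D'.
Proof. by move=> hl hn hs hi hg hlab wl; have [] := darts_map hl hn hs hi hg hlab wl. Qed.

Lemma shape_knot D D' : same_shape D D' -> knot_pseudodiagram D -> knot_pseudodiagram D'.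
Proof.
move=> h /and3P[/h[wl' ec ef hl hn] hc he].
by apply/and3P; split; rewrite ?ec // /euler_planar ef hl hn.
Qed.

Lemma same_projection_shape D D' : same_projection D D' -> same_shape D D' /\ same_shape D' D.
Proof.
case=> {D D'} [l cs cs' p|f D fI|l c cs].
- suff gen a b : perm_eq a b -> same_shape (PD l a) (PD l b).
    by split; apply: gen => //; rewrite perm_sym.
  move=> {cs cs'}p; have [Is pI eb] := perm_iotaP default_crossing p.
  have sI : size Is = size a by rewrite (perm_size pI) size_iota (perm_size p).
  have u : uniq Is by rewrite (perm_uniq pI) iota_uniq.
  apply: (@shape_map _ _ (nth 0 Is) (fun _ => 0) id) => //; rewrite /num_crossings /=.
  + by rewrite (perm_size p).
  + move=> i j; rewrite !inE /= => hi hj /eqP.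
    by rewrite nth_uniq ?sI // => /eqP.
  + move=> i hi; rewrite -sI in hi; have := mem_nth 0 hi.
    by rewrite (perm_mem pI) mem_iota (perm_size p).
  + by move=> i j hi hj; rewrite addn0 modn_small // [in RHS]eb (nth_map 0) ?sI.
- have fI' : {in labels (crossings D) &, injective f} by move=> x y _ _; apply: fI.
  have hs i j : i < num_crossings D -> j < 4 ->
     slot (nth default_crossing (crossings (relabel f D)) i) j =
     f (slot (nth default_crossing (crossings D) i) j).
    move=> hi hj; rewrite /= (nth_map default_crossing) //.
    by rewrite /slot /= (nth_map 0) ?size_tuple.
  split.
    apply: (@shape_map _ _ id (fun _ => 0) f) => //; first exact: size_map.
    by move=> i j hi hj; rewrite addn0 modn_small // hs.
  pose M := (\max_(z <- labels (crossings D)) f z).+1.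
  pose g z := if z \in map f (labels (crossings D)) then nth 0 (labels (crossings D)) (index z (map f (labels (crossings D)))) else z.
  have gK z : z \in labels (crossings D) -> g (f z) = z.
    by move=> hz; rewrite /g map_f // nth_index_map.
  apply: (@shape_map _ _ id (fun _ => 0) g) => //.
  + exact/esym/size_map.
  + by rewrite labels_rl => _ _ /mapP[x hx ->] /mapP[y hy ->]; rewrite !gK // => ->.
  + rewrite /num_crossings /= size_map => i j hi hj; rewrite addn0 modn_small // hs // gK //.
    have := label_mem ((Ordinal hi, Ordinal hj) : edge_end D).
    by rewrite labelE.
- split.
    (* The rotation moves slot [j] to slot [j - 1], which is [j + 3] modulo 4; the way back adds
       1. *)
    apply: (@shape_map _ _ id (fun i => if i == 0 then 3 else 0) id) => //.
    move=> [|i] j hi hj; last by rewrite addn0 modn_small.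
    by have [s [p [q [r [u ->]]]]] := crossingP c; case: j hj => [|[|[|[|]]]].
  apply: (@shape_map _ _ id (fun i => if i == 0 then 1 else 0) id) => //.
  move=> [|i] j hi hj; last by rewrite addn0 modn_small.
  by have [s [p [q [r [u ->]]]]] := crossingP c; case: j hj => [|[|[|[|]]]].
Qed.

Lemma same_shape_trans D1 D2 D3 : same_shape D1 D2 -> same_shape D2 D3 -> same_shape D1 D3.
Proof. by move=> h h' /h[/h'[w -> -> -> ->] -> -> -> ->]. Qed.

Lemma isotopic_shape D D' : isotopic D D' -> same_shape D D' /\ same_shape D' D.
Proof.
elim=> {D D'} [D D' /same_projection_shape|D|D D' _ []|D D1 D2 _ [h1 h2] _ [h3 h4]] //.
by split; [apply: same_shape_trans h1 h3|apply: same_shape_trans h4 h2].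
Qed.

Lemma isotopic_knot D D' : isotopic D D' -> knot_pseudodiagram D = knot_pseudodiagram D'.
Proof. by move=> /isotopic_shape[h h']; apply/idP/idP; apply: shape_knot. Qed.

Lemma same_projection_knot D D' : same_projection D D' ->
  knot_pseudodiagram D = knot_pseudodiagram D'.
Proof. by move=> h; apply/isotopic_knot/rst_step. Qed.

Lemma knot_states l cs cs' : map snd cs = map snd cs' ->
  knot_pseudodiagram (PD l cs) = knot_pseudodiagram (PD l cs').
Proof.
suff gen a b : map snd a = map snd b -> knot_pseudodiagram (PD l a) -> knot_pseudodiagram (PD l b).
  by move=> e; apply/idP/idP; apply: gen.
move=> {cs cs'} e; have es : size b = size a by rewrite -(size_map snd b) -e size_map.
apply/shape_knot/(@shape_map _ _ id (fun _ => 0) id) => //= i j hi hj.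
rewrite addn0 modn_small // /slot -!(nth_map _ (snd default_crossing) snd) ?es //.
by rewrite e.
Qed.

Definition refl (D : pseudodiagram) := PD (loops D) (map reflect_crossing (crossings D)).

Lemma reflect_crossingK : involutive reflect_crossing.
Proof.
move=> c; have [s [p [q [r [u ->]]]]] := crossingP c.
by congr pair; apply: val_inj.
Qed.

Lemma reflK : involutive refl.
Proof. by case=> l cs; rewrite /refl /= (mapK reflect_crossingK). Qed.

Lemma refl_darts D : well_labelled D ->
  [/\ well_labelled (refl D), num_components (refl D) = num_components D &
      num_faces (refl D) = num_faces D].
Proof.
move: D => E.
have hb i : i < num_crossings E -> i < num_crossings (refl E).
  by rewrite /num_crossings /= size_map.
(* The reflection of a crossing keeps slot 0 and reverses the cyclic order. *)
pose h (d : edge_end E) : edge_end (refl E) :=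
  (Ordinal (hb _ (ltn_ord d.1)), Ordinal (ltn_pmod (4 - d.2) (isT : 0 < 4))).
have lab d : label (h d) = label d.
  case: d => [i [j hj]]; rewrite !labelE /h /= (nth_map default_crossing) //.
  have [s [p [q [r [u ->]]]]] := crossingP (nth default_crossing (crossings E) i).
  by case: j hj => [|[|[|[|]]]].
apply: (@darts_iso _ _ h) => //.
- move=> [i [j hj]] [i' [j' hj']] [] e1 e2; congr pair; apply: val_inj => //=.
  by case: j hj e2 => [|[|[|[|]]]] //; case: j' hj' => [|[|[|[|]]]].
- exact: size_map.
- by move=> d d'; rewrite !lab.
right=> -[i [j hj]]; rewrite /h /turn /=; congr pair; apply: val_inj => /=.
by case: j hj => [|[|[|[|]]]].
Qed.

Lemma refl_knot D : knot_pseudodiagram (refl D) = knot_pseudodiagram D.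
Proof.
suff gen E : knot_pseudodiagram E -> knot_pseudodiagram (refl E).
  by apply/idP/idP; last exact: gen; move/gen; rewrite reflK.
move=> /and3P[wl hc he]; have [wl' ec ef] := refl_darts wl.
by apply/and3P; split; rewrite ?ec // /euler_planar ef /num_crossings /= size_map.
Qed.

(** * Counting faces when a crossing is doubled or a kink deleted *)

Lemma dart_eq D (d d' : edge_end D) :
  d.1 = d'.1 :> nat -> d.2 = d'.2 :> nat -> d = d'.
Proof. by case: d d' => [i j] [i' j'] /= /val_inj -> /val_inj ->. Qed.

Lemma mate_eq D (d d' : edge_end D) : well_labelled D ->
  d' != d -> label d' = label d -> mate d = d'.
Proof. by move=> wl n e; have [_ _ u] := wl_mate d wl; rewrite (u d'). Qed.

Notation face D := (@turn D \o @mate D).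

Lemma connect_face1 D (d : edge_end D) : connect (frel (face D)) d (turn (mate d)).
Proof. by apply: connect1; rewrite /= eqxx. Qed.

(** Doubling a crossing creates a single new face, the bigon between the two copies; the other faces
    run past it as before. The number of crossings grows by one as well, so Euler's formula is
    kept. *)
Lemma faces_twist l s s1 s2 a b c d x y cs :
  let D1 := PD l ((s, [tuple a; b; c; d]) :: cs) in
  let D2 := PD l [:: (s1, [tuple a; x; y; d]), (s2, [tuple x; b; c; y]) & cs] in
  well_labelled D1 -> well_labelled D2 -> num_faces D2 = (num_faces D1).+1.
Proof.
move=> D1 D2 wl1 wl2.
pose mk i (j : 'I_4) : edge_end D2 := (inord i, j).
pose o1 : 'I_4 := Ordinal (isT : 1 < 4); pose o2 : 'I_4 := Ordinal (isT : 2 < 4).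
pose o3 : 'I_4 := Ordinal (isT : 3 < 4); pose o0 : 'I_4 := Ordinal (isT : 0 < 4).
have mkv i j : i < (size cs).+2 -> (mk i j).1 = i :> nat by move=> hi; rewrite inordK.
(* Slots 1 and 2 of the old crossing go to the second copy, slots 0 and 3 to the first. *)
pose h1 i (j : 'I_4) := if i is i'.+1 then i'.+2 else (((j : nat) == 1) || ((j : nat) == 2) : nat).
pose h (e : edge_end D1) : edge_end D2 := mk (h1 e.1 e.2) e.2.
pose r (e : edge_end D2) : edge_end D1 := (inord (e.1).-1, e.2).
have h1b (e : edge_end D1) : h1 e.1 e.2 < (size cs).+2.
  by case: e => [[[|i] hi] j] //=; case: (_ || _).
have hv (e : edge_end D1) : (h e).1 = h1 e.1 e.2 :> nat by apply: mkv.
have rv (e : edge_end D2) : (r e).1 = (e.1).-1 :> nat.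
  by rewrite inordK //; case: e => [[[|i] hi] j].
have hK e : r (h e) = e.
  apply: dart_eq => //; rewrite rv hv; case: e => [[[|i] hi] j] //=.
  by case: (_ || _).
have hI : injective h by exact: can_inj hK.
have lab e : label (h e) = label e.
  rewrite !labelE hv /=; case: e => [[[|i] hi] [j hj]] //=.
  by case: j hj => [|[|[|[|]]]].
have hm e : mate (h e) = h (mate e).
  have [n e1 _] := wl_mate e wl1.
  by apply: mate_eq => //; rewrite ?(inj_eq hI) // !lab.
have s1' := fconnect_sym (face_inj wl1); have s2' := fconnect_sym (face_inj wl2).
have m01 : mate (mk 0 o1) = mk 1 o0.
  by apply: mate_eq => //; rewrite ?labelE ?mkv // xpair_eqE /= andbF.
have m10 : mate (mk 1 o0) = mk 0 o1 by rewrite -m01 (mateK wl2).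
have m02 : mate (mk 0 o2) = mk 1 o3.
  by apply: mate_eq => //; rewrite ?labelE ?mkv // xpair_eqE /= andbF.
have m13 : mate (mk 1 o3) = mk 0 o2 by rewrite -m02 (mateK wl2).
have tmk i j : turn (mk i j) = mk i (ordS j) by [].
have S0 : ordS o0 = o1 by apply: val_inj.
have S1 : ordS o1 = o2 by apply: val_inj.
have S2 : ordS o2 = o3 by apply: val_inj.
have S3 : ordS o3 = o0 by apply: val_inj.
have f01 : turn (mate (mk 0 o1)) = mk 1 o1 by rewrite m01 tmk S0.
have f13 : turn (mate (mk 1 o3)) = mk 0 o3 by rewrite m13 tmk S2.
have f02 : turn (mate (mk 0 o2)) = mk 1 o0 by rewrite m02 tmk S3.
have f10 : turn (mate (mk 1 o0)) = mk 0 o2 by rewrite m10 tmk S1.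
(* The orbit of the face map that is the bigon. *)
pose A : pred (edge_end D2) := [pred e | e \in [:: mk 0 o2; mk 1 o0]].
have cA : fclosed (face D2) A.
  apply: (intro_closed s2') => e e' /= /eqP <-; rewrite !inE => /orP[]/eqP->.
    by rewrite f02 eqxx orbT.
  by rewrite f10 eqxx.
have cA' : fclosed (face D2) [predC A].
  by move=> e e' /cA; rewrite !inE => ->.
(* Besides the bigon, two ends of the doubled edges lie outside the image of [h]; the next step of
   the face map leads from them into the image. *)
have dec e : [\/ e \in A, e = mk 0 o1, e = mk 1 o3 | e = h (r e)].
  case: (ltnP 1 e.1) => h0.
    constructor 4; apply: dart_eq => //; rewrite hv rv.
    by case: (nat_of_ord e.1) h0 => [|[|i]].
  have E : e = mk e.1 e.2 by apply: dart_eq => //; rewrite mkv // (leq_ltn_trans h0).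
  have Ej : e.2 \in [:: o0; o1; o2; o3].
    by case: (e.2) => [[|[|[|[|]]]] hj] //; rewrite !inE -!val_eqE.
  have hr i j : i < 2 -> i = h1 0 j -> mk i j = h (r (mk i j)).
    move=> hi ei; apply: dart_eq => //.
    by rewrite hv rv !mkv ?(leq_trans hi) //; case: i hi ei => [|[|i]].
  rewrite E; move: h0; case: (nat_of_ord e.1) => [|[|i]] // _; move: Ej; rewrite !inE;
    case/or4P => /eqP ->; rewrite ?eqxx ?orbT;
    try (by constructor 1); try (by constructor 2); try (by constructor 3);
    by constructor 4; apply: hr.
rewrite /num_faces (n_compC A) -[RHS]add1n; congr addn.
  rewrite -(n_comp_connect s2' (mk 0 o2)); apply: eq_n_comp_r => e.
  apply/idP/idP => [|ce]; last first.
    by have := closed_connect cA ce; rewrite !inE eqxx /= => <-.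
  rewrite !inE => /orP[]/eqP ->; first exact: connect0.
  by rewrite -f02; apply: connect_face1.
apply: (@n_comp_adj _ _ _ _ _ h r) => //.
- move=> e; rewrite !inE; apply/negP => /orP[]/eqP eh.
    have e2 : e.2 = 2 :> nat by rewrite -[e.2]/((h e).2) eh.
    have := hv e; rewrite eh mkv //; case: (nat_of_ord e.1) => [|i] //=.
    by rewrite e2.
  have e2 : e.2 = 0 :> nat by rewrite -[e.2]/((h e).2) eh.
  have := hv e; rewrite eh mkv //; case: (nat_of_ord e.1) => [|i] //=.
  by rewrite e2.
- move=> e e' /= /eqP <-; apply: (@connect_trans _ _ (turn (mate (h e)))).
    exact: connect_face1.
  rewrite hm; move: (mate e) => {e'}e.
  have [i0|i0] := posnP e.1; last first.
    suff -> : h (turn e) = turn (h e) by apply: connect0.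
    apply: dart_eq => //; rewrite /turn /= !inordK //=.
      by case: e i0 => [[[|i] hi] j].
    exact: (h1b (e.1, _)).
  have Ej : e.2 \in [:: o0; o1; o2; o3].
    by case: (e.2) => [[|[|[|[|]]]] hj] //; rewrite !inE -!val_eqE.
  have E : turn (h e) = mk (h1 0 e.2) (ordS e.2) by rewrite /h tmk i0.
  have E' : h (turn e) = mk (h1 0 (ordS e.2)) (ordS e.2) by rewrite /h /turn /= i0.
  rewrite E E'; move: Ej; rewrite !inE => /or4P[]/eqP->; rewrite ?S0 ?S1 ?S2 ?S3 /=;
  try exact: connect0.
    by rewrite -f01; apply: connect_face1.
  by rewrite -f13; apply: connect_face1.
- move=> e e' nA /= /eqP <-; case: (dec e) => [eA|->|->|E].
  + by rewrite inE /= eA in nA.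
  + rewrite f01; suff -> : r (mk 0 o1) = r (mk 1 o1) by apply: connect0.
    by apply: dart_eq => //; rewrite !rv !mkv.
  + rewrite f13; suff -> : r (mk 1 o3) = r (mk 0 o3) by apply: connect0.
    by apply: dart_eq => //; rewrite !rv !mkv.
  rewrite {2}E hm.
  have -> : r (turn (h (mate (r e)))) = turn (mate (r e)); last exact: connect_face1.
  by rewrite -{2}[mate (r e)]hK.
- by move=> e; rewrite hK connect0.
move=> e nA; case: (dec e) => [eA|->|->|<-].
- by rewrite inE /= eA in nA.
- suff -> : h (r (mk 0 o1)) = turn (mate (mk 0 o1)) by apply: connect_face1.
  by rewrite f01; apply: dart_eq => //; rewrite hv rv !mkv.
- suff -> : h (r (mk 1 o3)) = turn (mate (mk 1 o3)) by apply: connect_face1.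
  by rewrite f13; apply: dart_eq => //; rewrite hv rv !mkv.
exact: connect0.
Qed.

(** The face that disappears is the monogon of the kink, an orbit consisting of [q1] alone. *)
Lemma faces_kink l l0 s x a b cs :
  let D1 := PD l ((s, [tuple x; x; a; b]) :: cs) in
  let D0 := PD l0 (rl (rename a b) cs) in
  well_labelled D1 -> well_labelled D0 -> a != b ->
  num_faces D1 = (num_faces D0).+1.
Proof.
move=> D1 D0 wl1 wl0 nab.
pose q j (hj : j < 4) : edge_end D1 := (ord0, Ordinal hj).
pose q0 := q 0 isT; pose q1 := q 1 isT; pose q2 := q 2 isT; pose q3 := q 3 isT.
have qT (e : edge_end D1) : e.1 = 0 :> nat -> e \in [:: q0; q1; q2; q3].
  case: e => [i [[|[|[|[|j]]]] hj]] //= hi; rewrite !inE !xpair_eqE -!val_eqE /= hi ?orbT //.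
have tq0 : turn q0 = q1 by apply: dart_eq.
have tq1 : turn q1 = q2 by apply: dart_eq.
have tq2 : turn q2 = q3 by apply: dart_eq.
have tq3 : turn q3 = q0 by apply: dart_eq.
have m0 : mate q0 = q1 by apply: mate_eq => //; rewrite !labelE.
have m1 : mate q1 = q0 by rewrite -m0 (mateK wl1).
have in0 : forall e : edge_end D1, label e = x -> e \in [:: q0; q1].
  move=> e he; case: (e =P q0) => [->|/eqP n]; first by rewrite mem_head.
  have := mate_eq wl1 n; rewrite he labelE m0 => /(_ erefl) <-.
  by rewrite !inE eqxx orbT.
have nax : a != x.
  apply/eqP => e; have := in0 q2; rewrite labelE /= e => /(_ erefl).
  by rewrite !inE !xpair_eqE.
have nbx : b != x.
  apply/eqP => e; have := in0 q3; rewrite labelE /= e => /(_ erefl).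
  by rewrite !inE !xpair_eqE.
have hsz : size (rl (rename a b) cs) = size cs by rewrite size_map.
have hb (e : edge_end D0) : (e.1).+1 < (size cs).+1 by rewrite ltnS -hsz ltn_ord.
pose h (e : edge_end D0) : edge_end D1 := (Ordinal (hb e), e.2).
have hI : injective h by move=> e e' /= [e1 e2]; apply: dart_eq => //; rewrite e2.
have hinv (e : edge_end D1) : 0 < e.1 -> exists e0, e = h e0.
  move=> h0; have hi : (e.1).-1 < size (rl (rename a b) cs).
    by rewrite hsz -ltnS prednK.
  by exists (Ordinal hi, e.2); apply: dart_eq; rewrite //= prednK.
have lab e : label e = rename a b (label (h e)).
  rewrite !labelE /= (nth_map default_crossing) -?hsz //.
  by rewrite (nth_map 0) // size_tuple.
have mq (e : edge_end D1) : e \in [:: q2; q3] -> exists e0, mate e = h e0.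
  move=> he; have [n e1 _] := wl_mate e wl1.
  apply: hinv; rewrite lt0n; apply/negP => /eqP/qT; rewrite !inE.
  move: he n e1; rewrite !inE => /orP[]/eqP -> n e1 /or4P[]/eqP E; move: e1 n;
    rewrite E !labelE /= => e1; move: nax nbx nab; by rewrite ?e1 ?eqxx.
(* [al] and [be] are the ends at which the two edges leaving the kink arrive; the deletion joins
   them. *)
have [al mal] : exists al, mate q2 = h al by apply: mq; rewrite !inE eqxx.
have [be mbe] : exists be, mate q3 = h be by apply: mq; rewrite !inE eqxx orbT.
have mhal : mate (h al) = q2 by rewrite -mal (mateK wl1).
have mhbe : mate (h be) = q3 by rewrite -mbe (mateK wl1).
have lal : label (h al) = a.
  by have [_ e _] := wl_mate q2 wl1; rewrite -mal e labelE.
have lbe : label (h be) = b.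
  by have [_ e _] := wl_mate q3 wl1; rewrite -mbe e labelE.
have nal : be != al.
  by apply: contra nab => /eqP e; rewrite -lal -lbe e.
have m0al : mate al = be.
  by apply: mate_eq => //; rewrite !lab lal lbe /rename eqxx (negbTE nab).
have m0be : mate be = al by rewrite -m0al (mateK wl0).
have mh e : e != al -> e != be -> mate (h e) = h (mate e).
  move=> na nb; have [n1 e1 u] := wl_mate (h e) wl1.
  have [e' E'] : exists e', mate (h e) = h e'.
    apply: hinv; rewrite lt0n; apply/negP => /eqP/qT; rewrite !inE.
    case/or4P => /eqP eq; have := congr1 (@mate D1) eq; rewrite (mateK wl1) => E.
    - by have := congr1 (fun e : edge_end D1 => e.1 : nat) E; rewrite m0.
    - by have := congr1 (fun e : edge_end D1 => e.1 : nat) E; rewrite m1.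
    - by move: E na; rewrite mal => /hI ->; rewrite eqxx.
    by move: E nb; rewrite mbe => /hI ->; rewrite eqxx.
  rewrite E' (@mate_eq _ e e') //; last by rewrite !lab -E' e1.
  by rewrite -(inj_eq hI) -E'.
have sf1 := fconnect_sym (face_inj wl1); have sf0 := fconnect_sym (face_inj wl0).
have cA : fclosed (face D1) [pred e | e == q1].
  apply: (intro_closed sf1) => e e' /= /eqP <-; rewrite !inE => /eqP ->.
  by rewrite /= m1 tq0.
pose r (e : edge_end D1) : edge_end D0 :=
  if e.1 == 0 :> nat then (if e == q3 then al else be) else (insubd al.1 (e.1).-1, e.2).
have hK e : r (h e) = e.
  rewrite /r /=; case: e => i j; congr pair; apply: val_inj.
  by rewrite val_insubd /= ltn_ord.
have n03 : q0 == q3 = false by apply/negP => /eqP/(congr1 (fun e : edge_end D1 => e.2 : nat)).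
have n23 : q2 == q3 = false by apply/negP => /eqP/(congr1 (fun e : edge_end D1 => e.2 : nat)).
have rq0 : r q0 = be by rewrite /r n03.
have rq2 : r q2 = be by rewrite /r n23.
have rq3 : r q3 = al by rewrite /r (eqxx q3).
have th e : turn (h e) = h (turn e) by apply: dart_eq.
have dec e : e \in [:: q0; q1; q2; q3] \/ exists e0, e = h e0.
  case: (posnP e.1) => [/qT|/hinv]; [by left|by right].
rewrite /num_faces (n_compC [pred e | e == q1]) -[RHS]add1n; congr addn.
  rewrite -(n_comp_connect sf1 q1); apply: eq_n_comp_r => e.
  apply/idP/idP => [/eqP ->|ce]; first exact: connect0.
  by have := closed_connect cA ce; rewrite !inE eqxx => <-.
apply: (@n_comp_adj _ _ _ _ _ h r) => //.
- by move=> e e' /cA; rewrite !inE => ->.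
- move=> e e' /= /eqP <-; apply: (@connect_trans _ _ (turn (mate (h e)))).
    exact: connect_face1.
  case: (e =P al) => [->|/eqP na].
    rewrite mhal tq2 m0al -th -mbe; exact: connect_face1.
  case: (e =P be) => [->|/eqP nb].
    rewrite mhbe tq3 m0be -th -mal; apply: (@connect_trans _ _ q2); last exact: connect_face1.
    by have := connect_face1 q0; rewrite m0 tq1.
  by rewrite mh // th connect0.
- move=> e e' ne /= /eqP <-; case: (dec e) => [|[e0 ->]].
    rewrite !inE => /or4P[]/eqP E; rewrite {}E in ne *.
    + by rewrite m0 tq1 rq0 rq2 connect0.
    + by case/negP: ne; apply/eqP.
    + by rewrite mal th hK rq2 -m0be connect_face1.
    by rewrite mbe th hK rq3 -m0al connect_face1.
  rewrite hK; case: (e0 =P al) => [->|/eqP na]; first by rewrite mhal tq2 rq3 connect0.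
  case: (e0 =P be) => [->|/eqP nb]; first by rewrite mhbe tq3 rq0 connect0.
  by rewrite mh // th hK connect_face1.
- by move=> e; rewrite hK connect0.
move=> e ne; case: (dec e) => [|[e0 ->]]; last by rewrite hK connect0.
have c0 : connect (frel (face D1)) (h be) q0.
  by have := connect_face1 (h be); rewrite mhbe tq3.
rewrite !inE => /or4P[]/eqP E; rewrite {}E in ne *.
- by rewrite rq0 sf1.
- by case/negP: ne; apply/eqP.
- rewrite rq2 sf1; apply: (connect_trans c0).
  by have := connect_face1 q0; rewrite m0 tq1.
rewrite rq3 sf1; have := connect_face1 (h al); by rewrite mhal tq2.
Qed.

Lemma faces_kink1 l s x a : x != a ->
  num_faces (PD l [:: (s, [tuple x; x; a; a])]) = 3.
Proof.
move=> n; set D := PD _ _.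
have wl : well_labelled D.
  apply/wlP => z; rewrite /= !inE => hz.
  rewrite !(eq_sym _ z); move: hz; case: (z =P x) => [->|_] /=; first by rewrite (negbTE n).
  by case: (z == a).
pose q j (hj : j < 4) : edge_end D := (ord0, Ordinal hj).
pose q0 := q 0 isT; pose q1 := q 1 isT; pose q2 := q 2 isT; pose q3 := q 3 isT.
have qT (e : edge_end D) : e \in [:: q0; q1; q2; q3].
  case: e => [[[|i] hi] [[|[|[|[|j]]]] hj]] //=; rewrite !inE !xpair_eqE -!val_eqE /= ?orbT //.
have m0 : mate q0 = q1 by apply: mate_eq => //; rewrite !labelE.
have m1 : mate q1 = q0 by rewrite -m0 (mateK wl).
have m2 : mate q2 = q3 by apply: mate_eq => //; rewrite !labelE.
have m3 : mate q3 = q2 by rewrite -m2 (mateK wl).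
have f0 : turn (mate q0) = q2 by rewrite m0; apply: dart_eq.
have f1 : turn (mate q1) = q1 by rewrite m1; apply: dart_eq.
have f2 : turn (mate q2) = q0 by rewrite m2; apply: dart_eq.
have f3 : turn (mate q3) = q3 by rewrite m3; apply: dart_eq.
have sf := fconnect_sym (face_inj wl).
have split1 d (A : pred (edge_end D)) : A =1 fconnect (face D) d ->
  n_comp (frel (face D)) A = 1.
  by move=> hA; rewrite -(n_comp_connect sf d); apply: eq_n_comp_r.
have fix1 d : turn (mate d) = d -> fconnect (face D) d =1 pred1 d.
  move=> hd e; apply/idP/eqP => [|->]; last exact: connect0.
  case/connectP => p; elim: p => [|z p IH] //= /andP[/eqP <-]; rewrite hd; exact: IH.
have c0 : fconnect (face D) q0 =1 [pred e | e \in [:: q0; q2]].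
  move=> e; apply/idP/idP; last first.
    rewrite !inE => /orP[]/eqP->; first exact: connect0.
    by rewrite -f0; apply: connect_face1.
  have cl : fclosed (face D) [pred e | e \in [:: q0; q2]].
    apply: (intro_closed sf) => u v /= /eqP <-; rewrite !inE => /orP[]/eqP->.
      by rewrite f0 eqxx orbT.
    by rewrite f2 eqxx.
  by move=> ce; have := closed_connect cl ce; rewrite !inE eqxx /= => <-.
rewrite /num_faces (n_compC [pred e | e \in [:: q0; q2]]) (split1 q0); last by move=> e; rewrite c0.
rewrite add1n; congr S.
rewrite /n_comp_mem; set A := predI _ _.
have -> : #|A| = #|[pred e | e \in [:: q1; q3]]|; last first.
  by rewrite (eq_card (_ : _ =i pred2 q1 q3)) ?card2 // => e; rewrite !inE.
apply: eq_card => e; rewrite !inE; have := qT e; rewrite !inE => /or4P[]/eqP ->; rewrite ?eqxx ?andbF //.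
  have -> : (q1 == q0) || (q1 == q2) = false by [].
  rewrite /= andbT; apply/eqP/esym; have := connect_root (frel (face D)) q1.
  by rewrite fix1 // => /eqP.
have -> : (q3 == q0) || (q3 == q2) = false by [].
rewrite /= andbT; apply/eqP/esym; have := connect_root (frel (face D)) q3.
by rewrite fix1 // => /eqP.
Qed.

(** Deleting a kink lowers the numbers of faces and crossings by one each, so planarity can be
    lifted from the smaller diagram. A kink with nothing else is treated apart, since its deletion
    leaves a circle without crossings. *)
Lemma delete_kink_knot s D D' : delete_kink s D D' -> well_labelled D ->
  num_components D = 1 -> knot_pseudodiagram D' -> knot_pseudodiagram D.
Proof.
case=> {D D'} x a b l cs wl hc; have l0 := loops_components wl hc isT; rewrite /= in l0; subst l.
move=> kD'; have := kD' => /and3P[wl' hc' he'].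
apply/and3P; split=> //; first by rewrite hc.
case: cs wl hc kD' wl' hc' he' => [|c cs] wl hc kD' wl' hc' he'.
  move/wlP: wl => wl; have := wl a; have := wl b; have := wl x.
  rewrite /= !inE !eqxx /= ?orbT [b == x]eq_sym [a == x]eq_sym [b == a]eq_sym.
  move=> /(_ isT) h1 /(_ isT) h2 /(_ isT) h3.
  have e : a = b by move: h1 h2 h3; case: (a =P b) => // _; case: (x == a); case: (x == b).
  subst b; have n : x != a by move: h1; case: (x == a).
  by rewrite /euler_planar faces_kink1.
have l0 : loops (fuse id [:: (a, b)] (PD 0 (c :: cs))) = 0.
  by apply: loops_components => //; [exact/eqP|rewrite fuse_fm].
have n : a != b by move: l0; rewrite fuse_fm /=; case: (a =P b).
have E : fuse id [:: (a, b)] (PD 0 (c :: cs)) = PD 0 (rl (rename a b) (c :: cs)).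
  by rewrite fuse_cons (negbTE n) /= /relabel /= !relabel_crossing_comp rl_comp.
rewrite E in wl' he'.
move: he'; rewrite /euler_planar (faces_kink wl wl' n) /num_crossings /= size_map.
by rewrite !muln0 !addn0 => /eqP ->.
Qed.

(** * Words of tangle operations *)

(* [None] stands for the reflection, [Some s] for a half twist whose crossing
   has state [s]; the first operation of a word is applied first. *)
Definition word := seq (option (option bool)).

Definition tw (s : option bool) (t : tangle) :=
  let k := size (tcrossings t) in
  Tangle (nw t) (2 * k + 2) (sw t) (2 * k + 3)
    ((s, [tuple 2 * k + 2; ne t; se t; 2 * k + 3]) :: tcrossings t).

Definition apply_op t (o : option (option bool)) :=
  if o is Some s then tw s t else Defs.reflect t.

Definition tangle_word (w : word) := foldl apply_op empty_tangle w.

Definition N (w : word) := tangle_closure (tangle_word w).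

Definition par_op (u : bool * bool) (o : option (option bool)) :=
  if o is Some _ then (u.1 (+) u.2, u.2) else (u.2, u.1).

(* the fraction of the tangle modulo 2 *)
Definition par (w : word) := foldl par_op (true, false) w.

Definition ends t := [:: nw t; ne t; sw t; se t].

Definition nlab t := 2 * size (tcrossings t) + 2.

Lemma tangle_rcons w o : tangle_word (rcons w o) = apply_op (tangle_word w) o.
Proof. by rewrite /tangle_word foldl_rcons. Qed.

Lemma par_rcons w o : par (rcons w o) = par_op (par w) o.
Proof. by rewrite /par foldl_rcons. Qed.

Lemma labels_reflect cs : perm_eq (labels (map reflect_crossing cs)) (labels cs).
Proof.
elim: cs => //= c cs IH; rewrite !labels_cons perm_cat //.
have [s [p [q [r [u ->]]]]] := crossingP c => /=.
by apply/permP => f /=; lia.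
Qed.

Lemma count_word w z : let t := tangle_word w in
  count_mem z (labels (tcrossings t) ++ ends t) = if z < nlab t then 2 else 0.
Proof.
elim/last_ind: w => [|w o IH] /=; first by case: z => [|[|z]].
rewrite tangle_rcons; move: IH; set t := tangle_word w => /= IH.
case: o => [s|] /=; last first.
  rewrite /nlab /= size_map -IH !count_cat (permP (labels_reflect _)) /ends /=; lia.
rewrite -/(labels _) /nlab /ends /=.
move: IH; rewrite /nlab /ends !count_cat /=.
case: (ltnP z (2 * _ + 2)) => h1; case: (ltnP z (2 * _ + 2)) => h2; lia.
Qed.

Lemma word_okl w : okl (labels (tcrossings (tangle_word w)) ++ ends (tangle_word w)).
Proof. by move=> z; rewrite count_word; case: ifP. Qed.

Lemma word_lt w z : z \in labels (tcrossings (tangle_word w)) ++ ends (tangle_word w) ->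
  z < nlab (tangle_word w).
Proof. by rewrite -has_pred1 has_count count_word; case: ifP. Qed.

Lemma N_wl w : well_labelled (N w).
Proof. by apply: fuse_wl; apply: word_okl. Qed.

(** The strings of the empty tangle carry the labels 0 and 1. Along the word, the differences of the
    colours at the endpoints are multiples of [d], with the fraction modulo 2 as coefficients. *)
Lemma word_strands w chi (t := tangle_word w) (d := chi 0 (+) chi 1) :
  all (strand_const chi) (tcrossings t) ->
  [/\ chi (nw t) = chi 0, chi (ne t) = chi 0 (+) ((par w).1 && d),
      chi (sw t) = chi 0 (+) ((par w).2 && d) &
      chi (se t) = chi 0 (+) (((par w).1 (+) (par w).2) && d)] /\
  (chi 0 = chi 1 -> forall z, z < nlab t -> chi z = chi 0).
Proof.
rewrite {}/t; elim/last_ind: w => [|w o IH].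
  move=> _; rewrite /= addbF /d addbA addbb; split=> // e [|[|z]] //.
rewrite tangle_rcons par_rcons; case: o => [s|] /=.
  case/andP=> /andP[/eqP /= e1 /eqP /= e2] /IH[[h1 h2 h3 h4] h5].
  rewrite /slot /= in e1 e2; rewrite e1 -e2 h1 h2 h3 h4; split.
    by split=> //; case: (par w) => -[] [] //=.
  move=> e z; rewrite /nlab /= => hz.
  have lz u : u \in ends (tangle_word w) -> chi u = chi 0.
    by move=> hu; apply: (h5 e); apply: word_lt; rewrite mem_cat hu orbT.
  case: (ltnP z (nlab (tangle_word w))) => [/(h5 e) //|]; rewrite /nlab => h.
  have [-> | ->] : z = 2 * size (tcrossings (tangle_word w)) + 2 \/
                   z = 2 * size (tcrossings (tangle_word w)) + 3 by clear -hz h; lia.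
    by rewrite e1 lz // !inE eqxx ?orbT.
  by rewrite -e2 lz // !inE eqxx ?orbT.
move=> h; have {}h : all (strand_const chi) (tcrossings (tangle_word w)).
  move: h; rewrite all_map; apply: sub_all => c /=.
  have [s [p [q [r [u ->]]]]] := crossingP c.
  by rewrite /strand_const /slot /= => /andP[-> /eqP->] /=.
have [[h1 h2 h3 h4] h5] := IH h; rewrite h1 h2 h3 h4; split.
  by split=> //; case: (par w) => -[] [].
by move=> e z; rewrite /nlab /= size_map; apply: h5.
Qed.

Lemma N_components w : (par w).1 -> num_components (N w) = 1.
Proof.
move=> hp; apply: fuse_components1.
- exact: word_okl.
- by rewrite /all_labels; case: (labels _).
move=> chi /word_strands [[h1 h2 h3 h4] h5] g.
have := g (nw (tangle_word w)) (ne (tangle_word w)); rewrite mem_head h1 h2 hp => /(_ isT) e.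
have {}e : chi 0 = chi 1 by move: e; case: (chi 0); case: (chi 1).
by move=> x y /word_lt/(h5 e) -> /word_lt/(h5 e) ->.
Qed.

Lemma rename_id x y z : z != y -> rename x y z = z.
Proof. by rewrite /rename => /negbTE ->. Qed.

Lemma rename_new x y : rename x y y = x.
Proof. by rewrite /rename eqxx. Qed.

(** * Planarity *)

Lemma N_tw w s (t := tangle_word w) :
  N (rcons w (Some s)) = PD 0 ((s, [tuple nw t; ne t; se t; sw t]) :: tcrossings t).
Proof.
rewrite /N tangle_rcons -/t /tangle_closure /=.
set k := size _.
have lt z : z \in labels (tcrossings t) ++ ends t -> z < 2 * k + 2.
  exact: word_lt.
have ltn z : z \in ends t -> z < 2 * k + 2 by move=> h; apply: lt; rewrite mem_cat h orbT.
have h1 := ltn (nw t); have h2 := ltn (ne t); have h3 := ltn (sw t); have h4 := ltn (se t).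
rewrite !inE !eqxx ?orbT in h1 h2 h3 h4.
move: h1 h2 h3 h4 => /(_ isT) h1 /(_ isT) h2 /(_ isT) h3 /(_ isT) h4.
have n1 : nw t == 2 * k + 2 = false by lia.
rewrite n1; have E1 : rename (nw t) (2 * k + 2) (sw t) = sw t by rewrite /rename; case: eqP => //; lia.
have E2 : rename (nw t) (2 * k + 2) (2 * k + 3) = 2 * k + 3 by rewrite /rename; case: eqP => //; lia.
rewrite /= E1 E2.
have n2 : sw t == 2 * k + 3 = false by lia.
rewrite n2 /relabel /=; congr PD; congr cons; last first.
  apply: rl_id_in => z hz; have := lt z; rewrite mem_cat hz => /(_ isT) zl.
  by rewrite /= !rename_id //; lia.
congr pair; apply: val_inj => /=; rewrite rename_new.
rewrite (@rename_id _ _ (2 * k + 3)) ?rename_new; last by lia.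
by rewrite !rename_id // ?rename_id //; lia.
Qed.

Lemma pd_outer_okl w s (t := tangle_word w) :
  okl (labels ((s, [tuple nw t; ne t; se t; sw t]) :: tcrossings t)).
Proof.
apply: okl_perm (word_okl w); rewrite labels_cons -/t; apply/permP => f.
by rewrite !count_cat /=; lia.
Qed.

(** Closing the tangle by one outer crossing is the form in which the induction runs along the word:
    a half twist doubles the outer crossing, and a reflection mirrors the whole diagram. *)
Lemma outer_euler w s (t := tangle_word w) :
  euler_planar (PD 0 ((s, [tuple nw t; ne t; se t; sw t]) :: tcrossings t)).
Proof.
have wl s' u : well_labelled (PD 0 ((s', [tuple nw (tangle_word u); ne (tangle_word u); se (tangle_word u); sw (tangle_word u)]) :: tcrossings (tangle_word u))).
  by apply/wlP/okl_wll/pd_outer_okl.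
rewrite {}/t; elim/last_ind: w s => [|w o IH] s.
  rewrite /euler_planar.
  have w0 : wll (labels [:: (omap negb s, [tuple 0; 0; 1; 1])]) by move=> [|[|z]].
  have [|||||||_ _ ->] := @darts_map (PD 0 [:: (omap negb s, [tuple 0; 0; 1; 1])])
    (PD 0 [:: (s, [tuple 0; 1; 1; 0])]) id (fun _ => 3) id; last by rewrite faces_kink1.
  - by [].
  - by [].
  - by move=> i j _ _.
  - by move=> i.
  - by move=> i j _ _.
  - by move=> [|i] [|[|[|[|j]]]].
  by apply/wlP.
have := IH s; move: (wl s w) (wl s (rcons w o)); rewrite tangle_rcons.
set t := tangle_word w => w1 w2; case: o w2 => [s'|] w2; rewrite /euler_planar /num_crossings /= !addn0 => /eqP e.
  by rewrite (faces_twist w1 w2) e.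
have [_ _ f] := refl_darts w1.
have E : refl (PD 0 ((s, [tuple nw t; ne t; se t; sw t]) :: tcrossings t)) =
   PD 0 ((s, [tuple nw t; sw t; se t; ne t]) :: [seq reflect_crossing i | i <- tcrossings t]).
  by rewrite /refl /=; congr (PD _ (_ :: _)); congr pair; apply: val_inj.
by rewrite -E f e size_map.
Qed.

Definition swap (a b z : nat) := if z == a then b else if z == b then a else z.

Lemma swapK a b : involutive (swap a b).
Proof.
move=> z; rewrite /swap; case: (z =P a) => [->|/eqP na].
  by rewrite eqxx; case: eqP.
by case: (z =P b) => [->|/eqP nb]; rewrite ?eqxx // (negbTE na) (negbTE nb).
Qed.

Lemma fuse_swap1 a b D : isotopic (fuse id [:: (a, b)] D) (fuse id [:: (b, a)] D).
Proof.
case: D => l cs; rewrite !fuse_cons [b == a]eq_sym; case: (a =P b) => _; first exact: iso_refl.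
rewrite /= /relabel /= !rl_id.
have -> : rl (rename b a) cs = rl (swap a b) (rl (rename a b) cs).
  rewrite rl_comp; apply: eq_rl => z _ /=; rewrite /rename /swap.
  case: (z =P a) => [->|/eqP na]; first by case: (a =P b) => [->|]; rewrite ?eqxx.
  by case: (z =P b) => [->|/eqP nb]; rewrite ?eqxx // (negbTE na) (negbTE nb).
apply: (@iso_relabel (PD l _)) => x y _ _; exact: (can_inj (swapK a b)).
Qed.

Lemma N_RR w : N (rcons (rcons w None) None) = N w.
Proof.
rewrite /N !tangle_rcons; case: (tangle_word w) => a b c d cs /=.
by rewrite /Defs.reflect /= (mapK reflect_crossingK).
Qed.

Lemma reflect_crossing4 s p q r u :
  reflect_crossing (s, [tuple p; q; r; u]) = (s, [tuple p; u; r; q]).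
Proof. by congr pair; apply: val_inj. Qed.

Lemma relabel_crossing4 f s p q r u :
  relabel_crossing f (s, [tuple p; q; r; u]) = (s, [tuple f p; f q; f r; f u]).
Proof. by congr pair; apply: val_inj. Qed.

Lemma fuse1 a b l cs : a != b -> fuse id [:: (a, b)] (PD l cs) = PD l (rl (rename a b) cs).
Proof. by move=> n; rewrite fuse_cons (negbTE n) /= /relabel /= rl_id. Qed.

Lemma word_ends w z (t := tangle_word w) : z \in ends t -> z < nlab t.
Proof. by move=> h; apply: word_lt; rewrite mem_cat h orbT. Qed.

Lemma nw_lt w : nw (tangle_word w) < nlab (tangle_word w).
Proof. by apply: word_ends; rewrite !inE eqxx. Qed.
Lemma ne_lt w : ne (tangle_word w) < nlab (tangle_word w).
Proof. by apply: word_ends; rewrite !inE eqxx ?orbT. Qed.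
Lemma sw_lt w : sw (tangle_word w) < nlab (tangle_word w).
Proof. by apply: word_ends; rewrite !inE eqxx ?orbT. Qed.
Lemma se_lt w : se (tangle_word w) < nlab (tangle_word w).
Proof. by apply: word_ends; rewrite !inE eqxx ?orbT. Qed.
Lemma lab_lt w z : z \in labels (tcrossings (tangle_word w)) -> z < nlab (tangle_word w).
Proof. by move=> h; apply: word_lt; rewrite mem_cat h. Qed.

(** The reflection makes the closure join the two endpoints just created by the twist, so that its
    crossing becomes a kink. *)
Lemma N_kink w s : exists D D', [/\ delete_kink s D D',
  N (rcons (rcons w (Some s)) None) = D & isotopic D' (N (rcons w None))].
Proof.
rewrite /N !tangle_rcons; set t := tangle_word w; rewrite /tangle_closure.
have h1 : nw t < nlab t := nw_lt w; have h2 : ne t < nlab t := ne_lt w.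
have h3 : sw t < nlab t := sw_lt w; have h4 : se t < nlab t := se_lt w.
pose l := nloops id [:: (nw t, sw t)]; pose g := gl [:: (nw t, sw t)].
pose rc := map reflect_crossing (tcrossings t).
have gx z : nlab t <= z -> g z = z.
  by move=> hz; rewrite /g /=; case: eqP => //= _; rewrite rename_id //; lia.
have gy z : z < nlab t -> g z < nlab t.
  by move=> hz; rewrite /g /=; case: eqP => //= _; rewrite /rename; case: eqP.
pose x := nlab t; pose y := (nlab t).+1.
have ex : 2 * size (tcrossings t) + 2 = x by [].
have ey : 2 * size (tcrossings t) + 3 = y by rewrite /y /nlab; lia.
have gX : g x = x by apply: gx.
have gY : g y = y by apply: gx; rewrite leqnSn.
have F cs ps : fuse id ((nw t, sw t) :: ps) (PD 0 cs) =
    fuse id [seq (g p.1, g p.2) | p <- ps] (PD l (rl g cs)).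
  by rewrite (fuse_cat [:: (nw t, sw t)]) fuse_fm.
exists (PD l ((s, [tuple x; x; g (se t); g (ne t)]) :: rl g rc)).
exists (fuse id [:: (g (se t), g (ne t))] (PD l (rl g rc))); split.
- exact: DeleteKink.
- rewrite /apply_op /tw /Defs.reflect /= -/(fuse id _ _) ex ey.
  rewrite -[LHS]/(fuse id [:: (nw t, sw t); (x, y)] (PD 0 (reflect_crossing (s, [tuple x; ne t; se t; y]) :: rc))).
  rewrite F (_ : [seq _ | p <- _] = [:: (x, y)]); last by rewrite /= gX gY.
  rewrite fuse1 ?neq_ltn ?ltnSn //= reflect_crossing4 !relabel_crossing4 gX gY rename_new.
  congr (PD _ (_ :: _)).
    rewrite (@rename_id x y x) ?neq_ltn ?ltnSn //.
    by rewrite !rename_id //; rewrite neq_ltn; have := gy _ h2; have := gy _ h4; rewrite /y; lia.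
  apply: rl_id_in => z; rewrite labels_rl => /mapP[u]; rewrite (perm_mem (labels_reflect _)) => /lab_lt hu ->.
  by rewrite rename_id // neq_ltn; have := gy _ hu; rewrite /y -/t; lia.
rewrite -[X in isotopic _ X]/(fuse id [:: (nw t, sw t); (ne t, se t)] (PD 0 rc)) F.
exact: fuse_swap1.
Qed.

Lemma par_RR u : par_op (par_op u None) None = u. Proof. by case: u. Qed.

Lemma knot_circle : knot_pseudodiagram (PD 1 [::]).
Proof.
have e0 (A : pred (edge_end (PD 1 [::]))) : #|A| = 0 by apply: eq_card0 => -[[]].
apply/and3P; split; first exact/wlP.
  by rewrite /num_components /n_comp_mem e0.
by rewrite /euler_planar /num_faces /n_comp_mem e0.
Qed.

(** A word ending in a twist is covered by [outer_euler]. In front of a final reflection a twist is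
    a kink and another reflection cancels, so the word gets shorter. *)
Lemma N_knot w : (par w).1 -> knot_pseudodiagram (N w).
Proof.
have [n hn] := ubnP (size w); elim: n w hn => // n IH.
elim/last_ind => [|w [s|] _] hn hp; first exact: knot_circle.
  have := hp => /N_components h1.
  apply/and3P; split; [exact: N_wl|exact/eqP|].
  by rewrite N_tw; apply: outer_euler.
elim/last_ind: w hn hp => [|w [s|] _]; rewrite ?size_rcons => hn hp //; last first.
  by rewrite N_RR; apply: IH; [rewrite -ltnS (ltn_trans _ hn)|move: hp; rewrite !par_rcons par_RR].
have [D [D' [hD eD iD]]] := N_kink w s.
apply: delete_kink_knot (N_wl _) (N_components hp) _; first by rewrite eD; exact: hD.
rewrite (isotopic_knot iD); apply: IH; first by rewrite size_rcons.
by move: hp; rewrite !par_rcons.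
Qed.

Lemma fuse_same ps ps' l cs : nloops id ps = nloops id ps' ->
  glues (gl ps') ps -> glues (gl ps) ps' ->
  isotopic (fuse id ps (PD l cs)) (fuse id ps' (PD l cs)).
Proof.
move=> hl h1 h2; rewrite !fuse_fm hl; apply: (@iso_glued _ _ _ id id) => //; exact: ceq_refl.
Qed.

Lemma glues_fm ps : glues (gl ps) ps.
Proof. by move=> x y; apply: fm_glue. Qed.

Lemma fuse_swap2 p1 p2 D : isotopic (fuse id [:: p1; p2] D) (fuse id [:: p2; p1] D).
Proof.
case: D p1 p2 => l cs [a b] [c d]; apply: fuse_same.
- rewrite /= /rename; do ! (case: eqP => //=); congruence.
- by move=> x y h; apply: fm_glue; move: h; rewrite !inE orbC.
- by move=> x y h; apply: fm_glue; move: h; rewrite !inE orbC.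
Qed.

(** * Mirror images of isotopies and moves *)

Lemma refl_crossing_relabel f c :
  reflect_crossing (relabel_crossing f c) = relabel_crossing f (reflect_crossing c).
Proof.
have [s [p [q [r [u ->]]]]] := crossingP c.
by congr pair; apply: val_inj.
Qed.

Lemma refl_rl f cs : map reflect_crossing (rl f cs) = rl f (map reflect_crossing cs).
Proof. by rewrite -!map_comp; apply: eq_map => c; exact: refl_crossing_relabel. Qed.

Lemma refl_fuse ps l cs :
  refl (fuse id ps (PD l cs)) = fuse id ps (PD l (map reflect_crossing cs)).
Proof. by rewrite !fuse_fm /refl /= refl_rl. Qed.

Lemma cyc_reflect c : cyc (reflect_crossing c) (reflect_crossing (rotate_crossing c)).
Proof.
exists 3; have [s [p [q [r [u ->]]]]] := crossingP c.
rewrite /= /rotate_crossing /reflect_crossing /=; congr pair; last exact: val_inj.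
by case: s => //= b; rewrite negbK.
Qed.

Lemma refl_same_projection D D' : same_projection D D' -> isotopic (refl D) (refl D').
Proof.
case=> {D D'} [l cs cs' p|f [l cs] fI|l c cs].
- by apply: iso_perm; apply: perm_map.
- rewrite /refl /= refl_rl; exact/rst_step/(@same_relabel f (PD l _)).
by apply: ceq_iso; apply: ceq_cons; [apply: cyc_reflect|apply: ceq_refl].
Qed.

Lemma refl_isotopic D D' : isotopic D D' -> isotopic (refl D) (refl D').
Proof.
elim=> {D D'} [D D' /refl_same_projection //|D|D D' _|D D1 D2 _ h1 _ h2].
- exact: iso_refl.
- exact: iso_sym.
exact: iso_trans h1 h2.
Qed.

Lemma cyc4 s p q r u n c :
  iter n rotate_crossing (s, [tuple p; q; r; u]) = c -> cyc (s, [tuple p; q; r; u]) c.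
Proof. by move=> <-; exists n. Qed.

Ltac cyc_solve n := apply: (@cyc4 _ _ _ _ _ n); rewrite /= /rotate_crossing /=;
  congr pair; try (by apply: val_inj); by rewrite ?negbK.

Lemma refl_kink s D D' : delete_kink s D D' -> exists D1 D2,
  [/\ isotopic (refl D) D1, delete_kink (omap negb s) D1 D2 & isotopic D2 (refl D')].
Proof.
case=> x a b l cs; set cs' := map reflect_crossing cs.
exists (PD l ((omap negb s, [tuple x; x; b; a]) :: cs')), (fuse id [:: (b, a)] (PD l cs')).
split; last by rewrite refl_fuse; apply: fuse_swap1.
- apply: ceq_iso; apply: ceq_cons (ceq_refl _); rewrite reflect_crossing4.
  apply: (@cyc4 _ _ _ _ _ 3); rewrite /= /rotate_crossing /=; congr pair; last exact: val_inj.
  by case: s => //= o; rewrite negbK.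
- exact: DeleteKink.
Qed.

Lemma perm_swap2 (T : eqType) (a b : T) s : perm_eq [:: a, b & s] [:: b, a & s].
Proof. by apply/permP => f /=; rewrite addnCA. Qed.

(** In the mirror each pattern reappears with its crossings read from other ends: the two sides of
    the bigon trade places, and so do the two crossings on the moving strand of the triangle. *)
Lemma refl_reidemeister D D' : reidemeister D D' -> exists D1 D2,
  [/\ isotopic (refl D) D1, reidemeister D1 D2 & isotopic D2 (refl D')].
Proof.
case=> {D D'} [o D D' /refl_kink[D1 [D2 [h1 h2 h3]]]|o x y a b c d l cs|o o' u v w a1 a2 b1 b2 c1 c2 l cs].
- by exists D1, D2; split=> //; apply: (R1 h2).
- set cs' := map reflect_crossing cs.
  exists (PD l [:: (Some (~~ o), [tuple y; b; a; x]), (Some (~~ ~~ o), [tuple d; y; x; c]) & cs']).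
  exists (fuse id [:: (a, c); (b, d)] (PD l cs')); split; last by rewrite refl_fuse; apply: fuse_swap2.
    apply: ceq_iso; rewrite /= !reflect_crossing4; apply: ceq_cons; last apply: ceq_cons (ceq_refl _).
      by cyc_solve 1.
    by cyc_solve 1.
  exact: R2.
set cs' := map reflect_crossing cs.
exists (PD l [:: (Some o, [tuple w; v; a2; c1]), (Some o, [tuple a1; u; w; b1]),
                (Some (~~ o'), [tuple c2; b2; v; u]) & cs']).
exists (PD l [:: (Some o, [tuple a1; c2; w; v]), (Some o, [tuple w; b2; a2; u]),
                (Some (~~ o'), [tuple v; u; c1; b1]) & cs']); split.
- apply: ceq_iso; rewrite /= !reflect_crossing4.
  apply: (@ceq_trans ([:: (Some o, [tuple a2; c1; w; v]); (Some o, [tuple w; b1; a1; u])] ++ (Some o', [tuple b2; v; u; c2]) :: cs')).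
    by apply: perm_ceq; apply: perm_swap2.
  apply: ceq_cons; first by cyc_solve 2.
  apply: ceq_cons; first by cyc_solve 2.
  by apply: ceq_cons (ceq_refl _); cyc_solve 3.
- exact: R3.
apply: iso_sym; apply: ceq_iso; rewrite /= !reflect_crossing4.
apply: (@ceq_trans ([:: (Some o, [tuple w; v; a1; c2]); (Some o, [tuple a2; u; w; b2])] ++ (Some o', [tuple u; c1; b1; v]) :: cs')).
  by apply: perm_ceq; apply: perm_swap2.
apply: ceq_cons; first by cyc_solve 2.
apply: ceq_cons; first by cyc_solve 2.
by apply: ceq_cons (ceq_refl _); cyc_solve 3.
Qed.

(** * Equivalence of knot pseudodiagrams *)

Lemma eqv_refl D : equivalent D D. Proof. exact: rst_refl. Qed.
Lemma eqv_sym D D' : equivalent D D' -> equivalent D' D. Proof. exact: rst_sym. Qed.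
Lemma eqv_trans D2 D1 D3 : equivalent D1 D2 -> equivalent D2 D3 -> equivalent D1 D3.
Proof. exact: rst_trans. Qed.

Lemma isotopic_equivalent D D' : knot_pseudodiagram D -> isotopic D D' -> equivalent D D'.
Proof.
move=> + h; elim: h => {D D'} [D D' h|D|D D' h IH|D D1 D2 h1 IH1 h2 IH2] k.
- by apply: rst_step; split=> //; [rewrite -(same_projection_knot h)|left].
- exact: eqv_refl.
- by apply/eqv_sym/IH; rewrite (isotopic_knot h).
by apply: eqv_trans (IH1 k) (IH2 _); rewrite -(isotopic_knot h1).
Qed.

Lemma move_equivalent D D1 D2 D' : knot_pseudodiagram D -> knot_pseudodiagram D' ->
  isotopic D D1 -> reidemeister D1 D2 -> isotopic D2 D' -> equivalent D D'.
Proof.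
move=> k k' h1 h2 h3; have k1 : knot_pseudodiagram D1 by rewrite -(isotopic_knot h1).
have k2 : knot_pseudodiagram D2 by rewrite (isotopic_knot h3).
apply: (eqv_trans (isotopic_equivalent k h1)).
apply: (@eqv_trans D2); last exact: isotopic_equivalent h3.
by apply: rst_step; split=> //; right.
Qed.

Lemma refl_equivalent D D' : equivalent D D' -> equivalent (refl D) (refl D').
Proof.
elim=> {D D'} [D D' [k k' h]|D|D D' _|D D1 D2 _ h1 _ h2].
- have [rk rk'] : knot_pseudodiagram (refl D) /\ knot_pseudodiagram (refl D').
    by rewrite !refl_knot.
  case: h => [/refl_same_projection|/refl_reidemeister [D1 [D2 [h1 h2 h3]]]].
    exact: isotopic_equivalent.
  exact: move_equivalent h1 h2 h3.
- exact: eqv_refl.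
- exact: eqv_sym.
exact: eqv_trans h1 h2.
Qed.

Lemma unknot_refl D : unknot D -> unknot (refl D).
Proof. exact: refl_equivalent. Qed.

Lemma refl_pseudo_R1s D D' : pseudo_R1s D D' -> pseudo_R1s (refl D) (refl D').
Proof.
elim=> {D D'} [D D' [h|[k k' h]]|D|D D1 D2 _ h1 _ h2].
- by apply: rt_step; left; apply: refl_equivalent.
- have [rk rk'] : knot_pseudodiagram (refl D) /\ knot_pseudodiagram (refl D').
    by rewrite !refl_knot.
  have [D1 [D2 [h1 h2 h3]]] := refl_kink h.
  have k1 : knot_pseudodiagram D1 by rewrite -(isotopic_knot h1).
  have k2 : knot_pseudodiagram D2 by rewrite (isotopic_knot h3).
  apply: (@rt_trans _ _ _ D1); first by apply: rt_step; left; apply: isotopic_equivalent.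
  apply: (@rt_trans _ _ _ D2); first by apply: rt_step; right.
  by apply: rt_step; left; apply: isotopic_equivalent.
- exact: rt_refl.
exact: rt_trans h1 h2.
Qed.

Lemma components_no_crossing l : num_components (PD l [::]) = l.
Proof.
rewrite /num_components /= -[RHS]add0n; congr addn.
by apply: eq_card0 => -[[]].
Qed.

Lemma loops_eq D D' : well_labelled D -> well_labelled D' ->
  num_components D = 1 -> num_components D' = 1 ->
  (crossings D == [::]) = (crossings D' == [::]) -> loops D = loops D'.
Proof.
move=> wl wl' c1 c2; case E : (crossings D == [::]) => /esym E'.
  move: c1 c2 E E'; case: (D) => l cs; case: (D') => l' cs' /= + + /eqP e /eqP e'.
  by rewrite e e' !components_no_crossing => -> ->.
by rewrite !loops_components ?E ?E'.
Qed.

(** Knot diagrams with equally many crossings have equally many circles, so only the relabellings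
    have to be supplied. *)
Lemma iso_fuse ps ps' f g cs cs' :
  well_labelled (fuse id ps (PD 0 cs)) -> well_labelled (fuse id ps' (PD 0 cs')) ->
  num_components (fuse id ps (PD 0 cs)) = 1 -> num_components (fuse id ps' (PD 0 cs')) = 1 ->
  size cs = size cs' ->
  glues (gl ps' \o f) ps -> glues (gl ps \o g) ps' ->
  ceq (rl (gl ps' \o f) cs) (rl (gl ps') cs') ->
  ceq (rl (gl ps \o g) cs') (rl (gl ps) cs) ->
  isotopic (fuse id ps (PD 0 cs)) (fuse id ps' (PD 0 cs')).
Proof.
move=> w w' c c' hs g1 g2 h1 h2.
have hl : loops (fuse id ps (PD 0 cs)) = loops (fuse id ps' (PD 0 cs')).
  by apply: loops_eq => //; rewrite !fuse_fm -!size_eq0 !size_map hs.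
move: hl; rewrite !fuse_fm !add0n => /= ->; exact: iso_glued h1 h2.
Qed.

(** * Turning a rational diagram around *)

(* [t] is closed up by the mirror image of [v]; the labels of [t] are made even
   and those of [v] odd. *)
Definition Hpairs t v :=
  [:: (2 * nw v + 1, 2 * nw t); (2 * sw v + 1, 2 * sw t);
      (2 * se t, 2 * se v + 1); (2 * ne t, 2 * ne v + 1)].

Definition evens t := rl (fun z => 2 * z) (tcrossings t).
Definition odds v := rl (fun z => 2 * z + 1) (map reflect_crossing (tcrossings v)).

Definition H (w1 w2 : word) :=
  fuse id (Hpairs (tangle_word w1) (tangle_word w2))
       (PD 0 (evens (tangle_word w1) ++ odds (tangle_word w2))).

(** The determinant of two fractions modulo 2; if it is odd, the two tangles glued together form a
    single component. *)
Definition det (u v : bool * bool) := (u.1 && v.2) (+) (u.2 && v.1).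

Lemma count_even (z : nat) L : count_mem z [seq 2 * x | x <- L] = if odd z then 0 else count_mem z./2 L.
Proof.
rewrite count_map; elim: L => [|x L /= ->]; first by case: ifP.
have -> : (2 * x == z) = ~~ odd z && (x == z./2) by lia.
by case: (odd z).
Qed.

Lemma count_odd (z : nat) L : count_mem z [seq 2 * x + 1 | x <- L] = if odd z then count_mem z./2 L else 0.
Proof.
rewrite count_map; elim: L => [|x L /= ->]; first by case: ifP.
have -> : (2 * x + 1 == z) = odd z && (x == z./2) by lia.
by case: (odd z).
Qed.

Lemma okl_double L L' : okl L -> okl L' ->
  okl ([seq 2 * x | x <- L] ++ [seq 2 * x + 1 | x <- L']).
Proof.
move=> h h' z; rewrite count_cat count_even count_odd; case: (odd z).
  exact: h'.
by rewrite addn0; apply: h.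
Qed.

Lemma labels_odds v : perm_eq (labels (odds v)) [seq 2 * x + 1 | x <- labels (tcrossings v)].
Proof. by rewrite /odds labels_rl; apply/perm_map/labels_reflect. Qed.

Lemma H_labels w1 w2 (t := tangle_word w1) (v := tangle_word w2) :
  perm_eq ([seq 2 * x | x <- labels (tcrossings t) ++ ends t] ++
           [seq 2 * x + 1 | x <- labels (tcrossings v) ++ ends v])
          (all_labels (evens t ++ odds v) (Hpairs t v)).
Proof.
rewrite /all_labels labels_cat !map_cat /evens labels_rl; apply/permP => f.
rewrite !count_cat (permP (labels_odds v)) /=; lia.
Qed.

Lemma H_wl w1 w2 : well_labelled (H w1 w2).
Proof.
apply: fuse_wl; apply: okl_perm (H_labels w1 w2) _.
by apply: okl_double; apply: word_okl.
Qed.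

Lemma strands_reflect chi cs :
  all (strand_const chi) (map reflect_crossing cs) = all (strand_const chi) cs.
Proof.
rewrite all_map; apply: eq_all => c /=; have [s [p [q [r [u ->]]]]] := crossingP c.
by rewrite /strand_const /slot /= [chi u == _]eq_sym.
Qed.

Lemma H_const w1 w2 chi (t := tangle_word w1) (v := tangle_word w2) :
  det (par w1) (par w2) ->
  all (strand_const chi) (evens t) -> all (strand_const chi) (odds v) ->
  glues chi (Hpairs t v) ->
  exists k, (forall z, z < nlab t -> chi (2 * z) = k) /\
            (forall z, z < nlab v -> chi (2 * z + 1) = k).
Proof.
move=> hd; rewrite /evens /odds !strands_rl strands_reflect.
move=> /word_strands [[a1 a2 a3 a4] a5] /word_strands [[b1 b2 b3 b4] b5] g.
have g1 := g (2 * nw v + 1) (2 * nw t); have g2 := g (2 * sw v + 1) (2 * sw t).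
have g4 := g (2 * ne t) (2 * ne v + 1).
rewrite !inE !eqxx ?orbT in g1 g2 g4.
move: (g1 isT) (g2 isT) (g4 isT); rewrite /= in a1 a2 a3 a4 a5 b1 b2 b3 b4 b5.
rewrite a1 a2 a3 b1 b2 b3 => e1 e2 e4.
have [e5 e6] : chi (2 * 0) = chi (2 * 1) /\ chi (2 * 0 + 1) = chi (2 * 1 + 1).
  move: hd e1 e2 e4; rewrite /det; case: (par w1) => -[] [] /=; case: (par w2) => -[] [] //=;
  case: (chi (2 * 0)); case: (chi (2 * 1)); case: (chi (2 * 0 + 1)); case: (chi (2 * 1 + 1)) => //.
exists (chi (2 * 0)); split=> z hz; first exact: a5.
by rewrite -e1 b5.
Qed.

Lemma H_components w1 w2 : det (par w1) (par w2) -> num_components (H w1 w2) = 1.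
Proof.
move=> hd; apply: fuse_components1.
- apply: okl_perm (H_labels w1 w2) _; by apply: okl_double; apply: word_okl.
- by rewrite /all_labels; case: (labels _).
move=> chi; rewrite all_cat => /andP[h1 h2] g.
have [k [k1 k2]] := H_const hd h1 h2 g.
have K z : z \in all_labels (evens (tangle_word w1) ++ odds (tangle_word w2)) (Hpairs (tangle_word w1) (tangle_word w2)) -> chi z = k.
  rewrite -(perm_mem (H_labels w1 w2)) mem_cat => /orP[]/mapP[u /word_lt hu ->].
    exact: k1.
  exact: k2.
by move=> x y /K -> /K ->.
Qed.

Lemma Hglue t v (G := gl (Hpairs t v)) :
  [/\ G (2 * nw v + 1) = G (2 * nw t), G (2 * sw v + 1) = G (2 * sw t),
      G (2 * se t) = G (2 * se v + 1) & G (2 * ne t) = G (2 * ne v + 1)].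
Proof. by split; apply: fm_glue; rewrite !inE eqxx ?orbT. Qed.

Lemma glues_H (g : nat -> nat) t v :
  g (2 * nw v + 1) = g (2 * nw t) -> g (2 * sw v + 1) = g (2 * sw t) ->
  g (2 * se t) = g (2 * se v + 1) -> g (2 * ne t) = g (2 * ne v + 1) ->
  glues g (Hpairs t v).
Proof.
by move=> h1 h2 h3 h4 x y; rewrite !inE => /or4P[]/eqP[-> ->].
Qed.

Lemma eq_ceq a b : a = b -> ceq a b. Proof. by move=> ->; apply: ceq_refl. Qed.

(** Reflecting the inner tangle or the outer one joins the four pairs of endpoints in the same way;
    only the crossings appear in a mirror. *)
Lemma H_reflect w1 w2 : det (par w1) (par (rcons w2 None)) ->
  isotopic (H (rcons w1 None) w2) (refl (H w1 (rcons w2 None))).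
Proof.
move=> hd; have hd' : det (par (rcons w1 None)) (par w2).
  by move: hd; rewrite !par_rcons /det; case: (par w1) => -[] []; case: (par w2) => -[] [].
have c1 := H_components hd; have c2 := H_components hd'.
have [wl1 c1' _] := refl_darts (H_wl w1 (rcons w2 None)).
rewrite c1 in c1'; move: wl1 c1'.
have -> : refl (H w1 (rcons w2 None)) =
   fuse id (Hpairs (tangle_word w1) (tangle_word (rcons w2 None)))
     (PD 0 (evens (tangle_word (rcons w1 None)) ++ odds (tangle_word w2))).
  rewrite /H refl_fuse map_cat !tangle_rcons; congr (fuse _ _ (PD _ (_ ++ _))).
    by rewrite /evens refl_rl.
  by rewrite /odds refl_rl /= (mapK reflect_crossingK).
move=> wl1 c1'; rewrite !tangle_rcons in wl1 c1' *.
have wl2 := H_wl (rcons w1 None) w2; rewrite /H !tangle_rcons in c2 wl2 *.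
set t := tangle_word w1 in wl1 c1' c2 wl2 *; set v := tangle_word w2 in wl1 c1' c2 wl2 *.
have [e1 e2 e3 e4] := Hglue t (apply_op v None).
have [f1 f2 f3 f4] := Hglue (apply_op t None) v.
by apply: (@iso_fuse _ _ id id) => //; try exact: ceq_refl; apply: glues_H.
Qed.

Lemma negb_opK (s : option bool) : omap negb (omap negb s) = s.
Proof. by case: s => //= b; rewrite negbK. Qed.

Lemma even_oddF x y : (2 * x == 2 * y + 1) = false. Proof. by lia. Qed.
Lemma odd_evenF x y : (2 * x + 1 == 2 * y) = false. Proof. by lia. Qed.
Lemma even_eq x y : (2 * x == 2 * y) = (x == y). Proof. by lia. Qed.
Lemma odd_eq x y : (2 * x + 1 == 2 * y + 1) = (x == y). Proof. by lia. Qed.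

Lemma cyc_rot3 s p q r u :
  cyc (omap negb s, [tuple p; q; r; u]) (s, [tuple u; p; q; r]).
Proof.
apply: (@cyc4 _ _ _ _ _ 3); rewrite /= /rotate_crossing /=; congr pair.
  by rewrite !negb_opK.
exact: val_inj.
Qed.

(** A twist on the border belongs to either side. The outer tangle reads its crossing from another
    end, which negates the state. *)
Lemma H_twist w1 w2 s : det (par (rcons w1 (Some s))) (par w2) ->
  isotopic (H (rcons w1 (Some s)) w2) (H w1 (rcons w2 (Some (omap negb s)))).
Proof.
move=> hd; have hd' : det (par w1) (par (rcons w2 (Some (omap negb s)))).
  by move: hd; rewrite !par_rcons /det; case: (par w1) => -[] []; case: (par w2) => -[] [].
have c1 := H_components hd; have c2 := H_components hd'.
have wl1 := H_wl (rcons w1 (Some s)) w2; have wl2 := H_wl w1 (rcons w2 (Some (omap negb s))).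
rewrite /H !tangle_rcons in c1 c2 wl1 wl2 *.
have t1 := nw_lt w1; have t2 := ne_lt w1; have t3 := sw_lt w1; have t4 := se_lt w1.
have tl := @lab_lt w1.
have v1 := nw_lt w2; have v2 := ne_lt w2; have v3 := sw_lt w2; have v4 := se_lt w2.
have vl := @lab_lt w2.
set t := tangle_word w1 in c1 c2 wl1 wl2 t1 t2 t3 t4 tl *.
set v := tangle_word w2 in c1 c2 wl1 wl2 v1 v2 v3 v4 vl *.
have [e1 e2 e3 e4] := Hglue t (apply_op v (Some (omap negb s))).
have [f1 f2 f3 f4] := Hglue (apply_op t (Some s)) v.
have nt : nlab t = 2 * size (tcrossings t) + 2 by [].
have nv : nlab v = 2 * size (tcrossings v) + 2 by [].
rewrite /= in e1 e2 e3 e4 f1 f2 f3 f4.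
set x := 2 * size (tcrossings t) + 2 in f1 f2 f3 f4 nt *.
set y := 2 * size (tcrossings t) + 3 in f1 f2 f3 f4 *.
set x' := 2 * size (tcrossings v) + 2 in e1 e2 e3 e4 nv *.
set y' := 2 * size (tcrossings v) + 3 in e1 e2 e3 e4 *.
have hy : y = x.+1 by rewrite /y addnS.
have hy' : y' = x'.+1 by rewrite /y' addnS.
(* The endpoints created by the twist are identified with the endpoints of the other side to which
   they are glued. *)
pose f z := if z == 2 * x then 2 * ne v + 1 else if z == 2 * y then 2 * se v + 1 else z.
pose g z := if z == 2 * x' + 1 then 2 * ne t else if z == 2 * y' + 1 then 2 * se t else z.
have fe z : z < nlab t -> f (2 * z) = 2 * z.
  by rewrite nt => hz; rewrite /f !even_eq hy !ltn_eqF // ltnS ltnW.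
have fo z : f (2 * z + 1) = 2 * z + 1 by rewrite /f !odd_evenF.
have fx : f (2 * x) = 2 * ne v + 1 by rewrite /f eqxx.
have fy : f (2 * y) = 2 * se v + 1 by rewrite /f eqxx even_eq hy gtn_eqF.
have go z : z < nlab v -> g (2 * z + 1) = 2 * z + 1.
  by rewrite nv => hz; rewrite /g !odd_eq hy' !ltn_eqF // ltnS ltnW.
have ge z : g (2 * z) = 2 * z by rewrite /g !even_oddF.
have gx : g (2 * x' + 1) = 2 * ne t by rewrite /g eqxx.
have gy : g (2 * y' + 1) = 2 * se t by rewrite /g eqxx odd_eq hy' gtn_eqF.
have E1 : evens (apply_op t (Some s)) = (s, [tuple 2 * x; 2 * ne t; 2 * se t; 2 * y]) :: evens t.
  by rewrite /evens /= relabel_crossing4.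
have E2 : odds (apply_op v (Some (omap negb s))) =
   (omap negb s, [tuple 2 * x' + 1; 2 * y' + 1; 2 * se v + 1; 2 * ne v + 1]) :: odds v.
  by rewrite /odds /= reflect_crossing4 relabel_crossing4.
have lev z : z \in labels (evens t) -> exists2 u, u < nlab t & z = 2 * u.
  by rewrite labels_rl => /mapP[u /tl hu ->]; exists u.
have lod z : z \in labels (odds v) -> exists2 u, u < nlab v & z = 2 * u + 1.
  by rewrite (perm_mem (labels_odds v)) => /mapP[u /vl hu ->]; exists u.
have Fid G : rl (G \o f) (evens t ++ odds v) = rl G (evens t ++ odds v).
  apply: eq_rl => z; rewrite labels_cat mem_cat => /orP[/lev|/lod] [u hu ->] /=.
    by rewrite fe.
  by rewrite fo.
have Gid G : rl (G \o g) (evens t ++ odds v) = rl G (evens t ++ odds v).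
  apply: eq_rl => z; rewrite labels_cat mem_cat => /orP[/lev|/lod] [u hu ->] /=.
    by rewrite ge.
  by rewrite go.
rewrite E1 E2 in c1 c2 wl1 wl2 *.
have pm G : ceq (rl G (evens t ++ (omap negb s, [tuple 2 * x' + 1; 2 * y' + 1; 2 * se v + 1; 2 * ne v + 1]) :: odds v))
  ((omap negb s, [tuple G (2 * x' + 1); G (2 * y' + 1); G (2 * se v + 1); G (2 * ne v + 1)]) :: rl G (evens t ++ odds v)).
  rewrite !map_cat /= relabel_crossing4; apply: perm_ceq; rewrite -cat1s.
  by apply/permPl; apply: perm_catCA.
apply: (@iso_fuse _ _ f g) => //.
- by rewrite !size_cat /= addnS.
- by apply: glues_H; rewrite /= ?fo ?fx ?fy ?fe // -?e1 -?e2.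
- apply: glues_H; rewrite /= ?ge ?gx ?gy ?go //.
- apply: ceq_trans (ceq_sym (pm _)); rewrite /= Fid relabel_crossing4 /= fx fy !fe //.
  apply: ceq_cons (ceq_refl _); rewrite e3 e4.
  exact/cyc_sym/cyc_rot3.
apply: ceq_trans (pm _) _; rewrite /= Gid relabel_crossing4 /= gx gy !go //.
apply: ceq_cons (ceq_refl _); rewrite f3 f4; exact: cyc_rot3.
Qed.

Lemma det_sym u v : det u v = det v u.
Proof. by case: u => -[] []; case: v => -[] []. Qed.

Definition flip z := if odd z then z.-1 else z.+1.

Lemma flip_even z : flip (2 * z) = 2 * z + 1.
Proof. by rewrite /flip; case: ifP => //; lia. Qed.

Lemma flip_odd z : flip (2 * z + 1) = 2 * z.
Proof. by rewrite /flip; case: ifP => //; lia. Qed.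

(** Inner and outer tangle trade places in a mirror; as one uses the even labels and the other the
    odd ones, [flip] is the relabelling. *)
Lemma H_swap w1 w2 : det (par w1) (par w2) -> isotopic (H w1 w2) (refl (H w2 w1)).
Proof.
move=> hd; have hd' : det (par w2) (par w1) by rewrite det_sym.
have c1 := H_components hd; have c2 := H_components hd'.
have [wl1 c1' _] := refl_darts (H_wl w2 w1).
rewrite c2 in c1'; move: wl1 c1'.
set t := tangle_word w1; set v := tangle_word w2.
have -> : refl (H w2 w1) = fuse id (Hpairs v t)
    (PD 0 (rl (fun z => 2 * z) (map reflect_crossing (tcrossings v)) ++ rl (fun z => 2 * z + 1) (tcrossings t))).
  rewrite /H refl_fuse map_cat; congr (fuse _ _ (PD _ (_ ++ _))); rewrite refl_rl //.
  by rewrite (mapK reflect_crossingK).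
move=> wl1 c1'; have wl2 := H_wl w1 w2.
have [e1 e2 e3 e4] := Hglue t v; have [f1 f2 f3 f4] := Hglue v t.
have pm (a b : seq crossing) G : ceq (rl G (a ++ b)) (rl G (b ++ a)).
  by apply: perm_ceq; apply: perm_map; apply/permPl/perm_catC.
apply: (@iso_fuse _ _ flip flip) => //.
- by rewrite !size_cat !size_map addnC.
- by apply: glues_H; rewrite /= !(flip_even, flip_odd).
- by apply: glues_H; rewrite /= !(flip_even, flip_odd).
- apply: ceq_trans (pm _ _ _); rewrite !map_cat /evens /odds !rl_comp; apply: eq_ceq.
  by congr cat; apply: eq_rl => z _ /=; rewrite ?flip_even ?flip_odd.
apply: ceq_trans (pm _ _ _); rewrite !map_cat /evens /odds !rl_comp; apply: eq_ceq.
by congr cat; apply: eq_rl => z _ /=; rewrite ?flip_even ?flip_odd.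
Qed.

(** The two closing arcs are themselves a tangle, the one obtained by a single reflection. *)
Lemma N_H w : (par w).1 -> isotopic (N w) (H w [:: None]).
Proof.
move=> hp; have hd : det (par w) (par [:: None]).
  by move: hp; rewrite /det /=; case: (par w) => -[] [].
have c1 := H_components hd; have c2 := N_components hp.
have wl1 := H_wl w [:: None]; have wl2 := N_wl w.
rewrite /H in c1 wl1 *; rewrite /N /tangle_closure in wl2 c2 *.
set t := tangle_word w in c1 c2 wl1 wl2 *.
have [e1 e2 e3 e4] := Hglue t (tangle_word [:: None]).
set v := tangle_word [:: None] in c1 wl1 e1 e2 e3 e4 *.
have E : odds v = [::] by [].
rewrite E cats0 in c1 wl1 *.
rewrite /= in e1 e2 e3 e4.
(* The labels 1 and 3 are those of the two outer strings. *)
pose g z := if odd z then (if z == 1 then nw t else sw t) else z./2.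
have ge z : g (2 * z) = z by rewrite /g mul2n odd_double doubleK.
set ps := [:: _; _] in c2 wl2 *.
have g1 : gl ps (nw t) = gl ps (ne t) by apply: fm_glue; rewrite !inE eqxx.
have g2 : gl ps (sw t) = gl ps (se t) by apply: fm_glue; rewrite !inE eqxx orbT.
apply: (@iso_fuse _ _ (fun z => 2 * z) g) => //.
- by rewrite size_map.
- move=> x y; rewrite !inE => /orP[]/eqP[-> ->] /=.
    by rewrite -e1 e4.
  by rewrite -e2 e3.
- by apply: glues_H; rewrite /= ?ge.
- by rewrite /evens rl_comp; apply: ceq_refl.
rewrite /evens rl_comp; apply: eq_ceq; apply: eq_rl => z _ /=.
by rewrite ge.
Qed.

Definition neg_op (o : option (option bool)) := omap (omap negb) o.
Definition negrev (w : word) := map neg_op (rev w).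
Definition num_refl (w : word) := count_mem None w.

Lemma iter_refl_isotopic n D D' : isotopic D D' -> isotopic (iter n refl D) (iter n refl D').
Proof. by move=> h; elim: n => //= n; apply: refl_isotopic. Qed.

Lemma iter_refl_equivalent n D D' : equivalent D D' -> equivalent (iter n refl D) (iter n refl D').
Proof. by move=> h; elim: n => //= n; apply: refl_equivalent. Qed.

Lemma negrev_rcons w o : negrev (rcons w o) = neg_op o :: negrev w.
Proof. by rewrite /negrev rev_rcons. Qed.

Lemma det_op u v o : det (par_op u o) v = det u (par_op v (neg_op o)).
Proof. by case: o => [s|]; case: u => -[] []; case: v => -[] []. Qed.

Lemma det_zip w1 u w2 : det (par (w1 ++ u)) (par w2) = det (par w1) (par (w2 ++ negrev u)).
Proof.
elim/last_ind: u w2 => [|u o IH] w2; first by rewrite /negrev /= !cats0.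
rewrite -rcons_cat par_rcons det_op negrev_rcons -par_rcons IH.
by rewrite cat_rcons.
Qed.

(** One operation after the other, the end of the inner word passes to the outer tangle, where it
    arrives in reverse order. *)
Lemma H_zip w1 u w2 : det (par (w1 ++ u)) (par w2) ->
  isotopic (H (w1 ++ u) w2) (iter (num_refl u) refl (H w1 (w2 ++ negrev u))).
Proof.
elim/last_ind: u w2 => [|u o IH] w2; first by rewrite /negrev /= !cats0 => _; apply: iso_refl.
have -> : num_refl (rcons u o) = num_refl u + (o == None).
  by rewrite /num_refl -cats1 count_cat /= addn0.
rewrite -rcons_cat negrev_rcons => hd.
have hd' : det (par (w1 ++ u)) (par (rcons w2 (neg_op o))).
  by rewrite par_rcons -det_op -par_rcons.
have := IH _ hd'; rewrite cat_rcons; case: o hd hd' => [s|] hd hd' h.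
  by rewrite addn0; apply: iso_trans h; apply: H_twist.
rewrite addn1; apply: iso_trans (H_reflect hd') _.
exact: refl_isotopic.
Qed.

(* Turning the diagram around reverses a word; it is seen in a mirror once for
   every reflection. *)
Lemma N_rev w u : (par w).1 -> rcons u None = None :: negrev w ->
  isotopic (N w) (iter (num_refl w) refl (N u)).
Proof.
move=> hp e; have hd : det (par w) (par [:: None]).
  by move: hp; rewrite /det /=; case: (par w) => -[] [].
apply: (iso_trans (N_H hp)); apply: (iso_trans (H_zip (w1 := [::]) hd)).
have hd2 : det (par [::]) (par (rcons u None)) by rewrite e -(det_zip [::] w [:: None]).
have hd3 : det (par [:: None]) (par u).
  by rewrite -[X in det (par X) _]/(rcons [::] None) par_rcons det_op -par_rcons.
have hd4 : det (par u) (par [:: None]) by rewrite det_sym.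
have hu : (par u).1 by move: hd4; rewrite /det /=; case: (par u) => -[] [].
apply: iter_refl_isotopic; rewrite cat1s -e.
apply: (iso_trans (H_swap hd2)); apply: iso_sym; apply: (iso_trans (N_H hu)).
by rewrite -[H u _]reflK; apply/refl_isotopic/iso_sym/(@H_reflect u [::]).
Qed.

Lemma iter_refl_knot n D : knot_pseudodiagram (iter n refl D) = knot_pseudodiagram D.
Proof. by elim: n => //= n <-; rewrite refl_knot. Qed.

(** * Reidemeister II moves inside a word *)

Lemma H_count w1 w2 (z : nat) (t := tangle_word w1) (v := tangle_word w2) :
  count_mem z (all_labels (evens t ++ odds v) (Hpairs t v)) =
  if odd z then (if z./2 < nlab v then 2 else 0) else (if z./2 < nlab t then 2 else 0).
Proof.
rewrite -(permP (H_labels w1 w2)) count_cat count_even count_odd !count_word.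
by case: (odd z); rewrite ?addn0.
Qed.

Lemma perm_R2_labels (x y a b c d n1 n2 n3 n4 : nat) X :
  perm_eq ([:: x; x; y; y] ++ X ++ [:: n1; n2; n3; n4; b; d; a; c])
    (([:: x; a; b; y] ++ [:: c; x; y; d] ++ X) ++ [:: n1; n2; n3; n4]).
Proof. by apply/permP => f; rewrite !count_cat /=; lia. Qed.

(** The edges leaving the second twist are named after the endpoints of the outer tangle to which
    they are glued. Then the two crossings match the pattern of [R2] literally, and the gluings made
    by the move are the two pairs of [Hpairs] missing in [ps0]. *)
Lemma H_R2 w1 w2 s : det (par w1) (par w2) -> exists2 D,
  isotopic (H (rcons (rcons w1 (Some (Some s))) (Some (Some (~~ s)))) w2) D &
  reidemeister D (H w1 w2).
Proof.
move=> hd; set W := rcons (rcons _ _) _.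
have hd' : det (par W) (par w2).
  by move: hd; rewrite !par_rcons /det; case: (par w1) => -[] []; case: (par w2) => -[] [].
have c1 := H_components hd'; have wl1 := H_wl W w2.
have t1 := nw_lt w1; have t2 := ne_lt w1; have t3 := sw_lt w1; have t4 := se_lt w1.
have tl := @lab_lt w1.
pose t := tangle_word w1; pose v := tangle_word w2.
rewrite -/t -/v in t1 t2 t3 t4 tl.
pose x1 := nlab t; pose y1 := x1.+1; pose x2 := x1.+2; pose y2 := x1.+3.
pose k1 : crossing := (Some s, [tuple 2 * x1; 2 * ne t; 2 * se t; 2 * y1]).
pose k2 : crossing := (Some (~~ s), [tuple 2 * ne v + 1; 2 * x1; 2 * y1; 2 * se v + 1]).
pose k2' : crossing := (Some (~~ s), [tuple 2 * x2; 2 * x1; 2 * y1; 2 * y2]).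
pose ps0 := [:: (2 * nw v + 1, 2 * nw t); (2 * sw v + 1, 2 * sw t)].
pose ps := ps0 ++ [:: (2 * y2, 2 * se v + 1); (2 * x2, 2 * ne v + 1)].
pose X := evens t ++ odds v.
have EH : H W w2 = fuse id ps (PD 0 [:: k2', k1 & X]).
  have ex1 : 2 * size (tcrossings t) + 2 = x1 by [].
  have ey1 : 2 * size (tcrossings t) + 3 = y1 by rewrite /y1 /x1 /nlab; lia.
  have ex2 : 2 * (size (tcrossings t)).+1 + 2 = x2 by rewrite /x2 /x1 /nlab; lia.
  have ey2 : 2 * (size (tcrossings t)).+1 + 3 = y2 by rewrite /y2 /x1 /nlab; lia.
  rewrite /H /W !tangle_rcons -/t -/v /Hpairs /evens /= -/(evens t) !relabel_crossing4 ex1 ey1 ex2 ey2.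
  by [].
rewrite EH in c1 wl1 *.
pose D := fuse id ps0 (PD 0 [:: k1, k2 & X]).
have pL : perm_eq ([:: 2 * x1; 2 * x1; 2 * y1; 2 * y1] ++ all_labels X (Hpairs t v))
    (all_labels [:: k1, k2 & X] ps0).
  exact: perm_R2_labels.
have okD : okl (all_labels [:: k1, k2 & X] ps0).
  apply: okl_perm pL _ => z; rewrite count_cat H_count -/t -/v /= -/x1.
  case: ifP => oz; first by case: ifP; lia.
  by case: ifP; rewrite /y1; lia.
have wlD : well_labelled D by apply: fuse_wl.
have cD : num_components D = 1.
  apply: fuse_components1; [exact: okD|by rewrite /all_labels labels_cons|].
  move=> chi /= /andP[/andP[/eqP a1 /eqP a2] /andP[/andP[/eqP a3 /eqP a4]]].
  rewrite /slot /= in a1 a2 a3 a4.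
  rewrite all_cat => /andP[h1 h2] g.
  have gH : glues chi (Hpairs t v).
    move=> x y; rewrite !inE => /or4P[]/eqP[-> ->].
    - by apply: g; rewrite !inE eqxx.
    - by apply: g; rewrite !inE eqxx orbT.
    - by rewrite -a1 a4.
    by rewrite a2 a3.
  have [k [b1 b2]] := H_const hd h1 h2 gH.
  have K z : z \in all_labels [:: k1, k2 & X] ps0 -> chi z = k.
    rewrite -(perm_mem pL) mem_cat => /orP[|].
      rewrite !inE !orbA orbb -orbA orbb => /orP[]/eqP->.
        by rewrite a1 b1.
      by rewrite -a2 b1.
    rewrite -(perm_mem (H_labels w1 w2)) mem_cat => /orP[]/mapP[u /word_lt hu ->].
      exact: b1.
    exact: b2.
  by move=> x y /K -> /K ->.
exists D; last first.
  set g := gl ps0.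
  have -> : H w1 w2 = fuse id [:: (g (2 * se t), g (2 * se v + 1)); (g (2 * ne t), g (2 * ne v + 1))]
      (PD (nloops id ps0) (rl g X)).
    rewrite /H -/t -/v -/X -[Hpairs t v]/(ps0 ++ [:: (2 * se t, 2 * se v + 1); (2 * ne t, 2 * ne v + 1)]).
    by rewrite fuse_cat [fuse id ps0 _]fuse_fm add0n.
  rewrite /D fuse_fm map_cons map_cons !relabel_crossing4 -/g add0n; exact: R2.
pose f z := if z == 2 * x2 then 2 * ne v + 1 else if z == 2 * y2 then 2 * se v + 1 else z.
have fe z : z < x2 -> f (2 * z) = 2 * z.
  by move=> hz; rewrite /f !even_eq !ltn_eqF // ltnS ltnW.
have fo z : f (2 * z + 1) = 2 * z + 1 by rewrite /f !odd_evenF.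
have fx : f (2 * x2) = 2 * ne v + 1 by rewrite /f eqxx.
have fy : f (2 * y2) = 2 * se v + 1 by rewrite /f eqxx even_eq gtn_eqF.
have lt2 z : z < nlab t -> z < x2 by move=> hz; apply: ltn_trans (ltnSn _); apply: ltn_trans (ltnSn _).
have lX z : z \in labels X -> f z = z.
  rewrite labels_cat mem_cat => /orP[].
    by rewrite labels_rl => /mapP[u /tl hu ->]; rewrite fe // lt2.
  by rewrite (perm_mem (labels_odds v)) => /mapP[u _ ->]; rewrite fo.
have G0 : glues (gl ps0) ps0 := @glues_fm _.
have G1 : glues (gl ps) ps := @glues_fm _.
apply: (@iso_fuse _ _ f id) => //.
- move=> a b; rewrite !inE => /or4P[]/eqP[-> ->] /=; rewrite ?fx ?fy ?fo ?fe ?lt2 //.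
  + by apply: G0; rewrite !inE eqxx.
  by apply: G0; rewrite !inE eqxx orbT.
- by move=> a b h; apply: G1; rewrite mem_cat h.
- set g0 := gl ps0; rewrite map_cons map_cons !relabel_crossing4 /=.
  have -> : rl (g0 \o f) X = rl g0 X by apply: eq_rl => z /lX /= ->.
  rewrite fx fy (fe x1) ?(fe y1) ?/x2 // !fe ?lt2 // /k1 /k2 !relabel_crossing4.
  by apply: perm_ceq; apply: perm_swap2.
set g1 := gl ps in G1 *; rewrite map_cons map_cons /k1 /k2 /k2' !relabel_crossing4 /=.
have <- : g1 (2 * x2) = g1 (2 * ne v + 1) by apply: G1; rewrite !inE eqxx !orbT.
have <- : g1 (2 * y2) = g1 (2 * se v + 1) by apply: G1; rewrite !inE eqxx !orbT.
rewrite !relabel_crossing4; by apply: perm_ceq; apply: perm_swap2.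
Qed.

Lemma par_cat w1 w2 : par (w1 ++ w2) = foldl par_op (par w1) w2.
Proof. by rewrite /par foldl_cat. Qed.

Lemma par_tw2 w1 s1 s2 w2 : par (w1 ++ [:: Some s1, Some s2 & w2]) = par (w1 ++ w2).
Proof. by rewrite !par_cat /=; case: (par w1) => -[] []. Qed.

(** What follows the two twists is moved to the outer tangle, so that they come to lie on the
    border, and is moved back afterwards. *)
Lemma N_R2 w1 w2 s : (par (w1 ++ w2)).1 ->
  equivalent (N (w1 ++ [:: Some (Some s), Some (Some (~~ s)) & w2])) (N (w1 ++ w2)).
Proof.
move=> hp; set W := w1 ++ [:: _, _ & _].
have hW : (par W).1 by rewrite par_tw2.
have d1 u : (par u).1 -> det (par u) (par [:: None]).
  by rewrite /det /=; case: (par u) => -[] [].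
have kW := N_knot hW; have k := N_knot hp.
have eW : W = rcons (rcons w1 (Some (Some s))) (Some (Some (~~ s))) ++ w2 by rewrite /W !cat_rcons.
have i1 : isotopic (N W) (iter (num_refl w2) refl
    (H (rcons (rcons w1 (Some (Some s))) (Some (Some (~~ s)))) ([:: None] ++ negrev w2))).
  by apply: (iso_trans (N_H hW)); rewrite eW; apply: H_zip; rewrite -eW; apply: d1.
have i2 : isotopic (N (w1 ++ w2)) (iter (num_refl w2) refl (H w1 ([:: None] ++ negrev w2))).
  by apply: (iso_trans (N_H hp)); apply: H_zip; apply: d1.
have hd : det (par w1) (par ([:: None] ++ negrev w2)) by rewrite -det_zip; apply: d1.
have [D h1 h2] := H_R2 s hd.
have kH : knot_pseudodiagram (H w1 ([:: None] ++ negrev w2)).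
  by rewrite -(iter_refl_knot (num_refl w2)) -(isotopic_knot i2).
have kHW : knot_pseudodiagram (H (rcons (rcons w1 (Some (Some s))) (Some (Some (~~ s)))) ([:: None] ++ negrev w2)).
  by rewrite -(iter_refl_knot (num_refl w2)) -(isotopic_knot i1).
apply: (eqv_trans (isotopic_equivalent kW i1)).
apply: eqv_trans (eqv_sym (isotopic_equivalent k i2)).
apply: iter_refl_equivalent; exact: move_equivalent kHW kH h1 h2 (iso_refl _).
Qed.

(** * Fox colourings *)

Definition fox (A : comNzRingType) (lam : nat -> A) (c : crossing) :=
  match c.1 with
  | Some true => (lam (slot c 0) == lam (slot c 2)) &&
                 (lam (slot c 1) + lam (slot c 3) == 2 * lam (slot c 0))%R
  | Some false => (lam (slot c 1) == lam (slot c 3)) &&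
                  (lam (slot c 0) + lam (slot c 2) == 2 * lam (slot c 1))%R
  | None => true
  end.

(** With values modulo [m] this is the failure of Fox [m]-colourability, which the unknot shares for
    every ring. *)
Definition monochrome (A : comNzRingType) (D : pseudodiagram) :=
  forall lam : nat -> A, all (fox lam) (crossings D) ->
    const_on lam (labels (crossings D)).

Lemma fox_rl (A : comNzRingType) (lam : nat -> A) f cs :
  all (fox lam) (rl f cs) = all (fox (lam \o f)) cs.
Proof.
rewrite all_map; apply: eq_all => c /=.
by have [s [p [q [r [u ->]]]]] := crossingP c.
Qed.

Lemma fox_rotate (A : comNzRingType) (lam : nat -> A) c :
  fox lam (rotate_crossing c) = fox lam c.
Proof.
have [s [p [q [r [u ->]]]]] := crossingP c; case: s => [[]|] //.
  rewrite /fox /slot /=; rewrite [lam r == lam p]eq_sym.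
  by case: (lam p =P lam r) => // ->.
by rewrite /fox /slot /= [(lam r + lam p)%R]addrC.
Qed.

Lemma eq_fox (A : comNzRingType) (lam lam' : nat -> A) cs :
  {in labels cs, lam =1 lam'} -> all (fox lam) cs = all (fox lam') cs.
Proof.
move=> h; apply: eq_in_all => c hc.
have hs j : j < 4 -> lam (slot c j) = lam' (slot c j).
  move=> hj; apply: h; apply/flattenP; exists (val c.2); first exact: map_f.
  by apply: mem_nth; rewrite size_tuple.
by rewrite /fox !hs.
Qed.

Lemma mono_same_projection (A : comNzRingType) D D' : same_projection D D' ->
  monochrome A D <-> monochrome A D'.
Proof.
case=> {D D'} [l cs cs' p|f [l cs] fI|l c cs].
- have pl := labels_perm p; split=> h lam hl x y hx hy; apply: h.
  + by rewrite (perm_all _ p).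
  + by rewrite /= (perm_mem pl).
  + by rewrite /= (perm_mem pl).
  + by rewrite /= -(perm_all _ p).
  + by rewrite /= -(perm_mem pl).
  + by rewrite /= -(perm_mem pl).
- split=> h lam hl x y; rewrite /= ?labels_rl.
    move=> /mapP[u hu ->] /mapP[v hv ->]; apply: (h (lam \o f)) => //.
    by move: hl; rewrite /= fox_rl.
  move=> hx hy; pose L := labels cs; pose g z := nth 0 L (index z (map f L)).
  have gK z : z \in L -> g (f z) = z by move=> hz; rewrite /g nth_index_map // => ? ? _ _ /fI.
  have e z : z \in L -> lam z = (lam \o g) (f z) by move=> hz; rewrite /= gK.
  rewrite (e x hx) (e y hy); apply: h; rewrite /= ?labels_rl ?map_f //.
  by rewrite fox_rl (eq_fox (lam' := lam)) // => z hz /=; rewrite gK.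
have pl : perm_eq (labels (rotate_crossing c :: cs)) (labels (c :: cs)).
  by rewrite !labels_cons perm_cat2r perm_rot.
split=> h lam hl x y hx hy; apply: h; rewrite /= ?fox_rotate //.
- by move: hl; rewrite /= fox_rotate.
- by rewrite -(perm_mem pl).
- by rewrite -(perm_mem pl).
- by rewrite (perm_mem pl).
by rewrite (perm_mem pl).
Qed.

(* The strands coloured like a fixed one form a union of components. *)
Lemma mono_up (A : comNzRingType) D (lam : nat -> A) new cs x :
  well_labelled D -> num_components D = 1 -> crossings D = new ++ cs ->
  const_on lam (labels cs) -> x \in labels (crossings D) ->
  all (strand_const (fun z => lam z == lam x)) new ->
  const_on lam (labels (crossings D)).
Proof.
move=> wl c1 e hc hx hn.
have hs : all (strand_const (fun z => lam z == lam x)) (crossings D).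
  rewrite e all_cat hn; apply/allP => c hc'.
  have hs j : j < 4 -> slot c j \in labels cs.
    move=> hj; apply/flattenP; exists (val c.2); first exact: map_f.
    by apply: mem_nth; rewrite size_tuple.
  by rewrite /strand_const (hc (slot c 0) (slot c 2)) ?(hc (slot c 1) (slot c 3)) ?hs // !eqxx.
have := components1_const wl c1 hs => k.
have K z : z \in labels (crossings D) -> lam z = lam x.
  by move=> hz; have := k z x hz hx; rewrite /= eqxx => /eqP.
by move=> y z /K -> /K ->.
Qed.

Lemma mono_down (A : comNzRingType) (lam : nat -> A) ps l cs : glues lam ps ->
  monochrome A (fuse id ps (PD l cs)) -> all (fox lam) cs -> const_on lam (labels cs).
Proof.
move=> g; rewrite fuse_fm => h hl x y hx hy.
have gk := gl_univ g; rewrite -(gk x) -(gk y); apply: h => /=.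
- by rewrite fox_rl -(eq_fox (lam := lam)) // => z _; rewrite /= gk.
- by rewrite labels_rl map_f.
by rewrite labels_rl map_f.
Qed.

(** The counterpart of [mono_down]: a colouring of the smaller diagram is extended over the edges
    that the move removes, whereas [mono_down] lets a colouring compatible with the gluings
    descend. *)
Lemma mono_lift (A : comNzRingType) ps l cs D :
  (forall lam' : nat -> A, exists lam : nat -> A, {in labels cs, lam =1 lam' \o gl ps} /\
     (all (fox lam) cs -> all (fox lam) (crossings D))) ->
  {subset labels cs <= labels (crossings D)} ->
  monochrome A D -> monochrome A (fuse id ps (PD l cs)).
Proof.
move=> hx sub h lam'; rewrite fuse_fm /= fox_rl => hl.
have [lam [e hk]] := hx lam'.
have hc := h lam (hk _); rewrite labels_rl => _ _ /mapP[u hu ->] /mapP[v hv ->].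
rewrite -[lam' (gl ps u)]/((lam' \o gl ps) u) -[lam' (gl ps v)]/((lam' \o gl ps) v).
rewrite -!e //; apply: hc; rewrite ?sub //.
by rewrite (eq_fox e).
Qed.

Lemma wll_once x (L : seq nat) : wll (x :: x :: L) -> x \notin L.
Proof. by move=> /wll_okl/okl_same[]. Qed.

Lemma wll_perm L L' : perm_eq L L' -> wll L -> wll L'.
Proof. by move=> p h; apply/okl_wll/(okl_perm p)/wll_okl. Qed.

Lemma notin_neq (x : nat) (L : seq nat) z : x \notin L -> z \in L -> (z == x) = false.
Proof. by move=> h hz; apply: contraNF h => /eqP <-. Qed.

Lemma mono_R1 (A : comNzRingType) o D D' : delete_kink (Some o) D D' ->
  knot_pseudodiagram D -> monochrome A D <-> monochrome A D'.
Proof.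
case=> {D D'} x a b l cs /and3P[wl /eqP c1 _].
have hx : x \notin [:: a, b & labels cs] by apply: wll_once; exact: (elimT (wlP (PD l _)) wl).
have gab : gl [:: (a, b)] a = gl [:: (a, b)] b by apply: fm_glue; rewrite mem_head.
set g := gl _ in gab.
split=> h.
  apply: mono_lift h => [lam'|z hz]; last first.
    by rewrite labels_cons /= !inE hz !orbT.
  exists (fun z => if z == x then lam' (g a) else lam' (g z)).
  split=> [z hz|hl]; first by rewrite (notin_neq hx) // !inE hz !orbT.
  rewrite /= hl andbT /fox /slot /= eqxx (notin_neq hx) ?mem_head //.
  rewrite (notin_neq hx (z := b)) ?inE ?eqxx ?orbT // gab.
  have e : (lam' (g b) + lam' (g b) = 2 * lam' (g b))%R by ring.
  by rewrite e !eqxx; case: (o).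
move=> lam /= /andP[hc hcs].
have [xa xb] : lam x = lam a /\ lam x = lam b.
  move: hc; rewrite /fox /slot /=; case: o {c1 wl} => /andP[/eqP e1 /eqP e2].
    by split=> //; move: e2; rewrite mulr_natl mulr2n => /addrI.
  by split=> //; move: e2; rewrite mulr_natl mulr2n => /addrI.
have gp : glues lam [:: (a, b)] by move=> u v; rewrite inE => /eqP[-> ->]; rewrite -xa.
apply: (mono_up (D := PD l _) (new := [:: _]) (x := x) wl c1 erefl) => //.
- exact: mono_down gp h hcs.
- by rewrite mem_head.
by rewrite /= /strand_const /slot /= -xa -xb !eqxx.
Qed.

Lemma mid (A : comNzRingType) (a y x : A) : (a + y = 2 * x)%R -> (a == x) = (y == x).
Proof.
rewrite mulr_natl mulr2n => e; apply/eqP/eqP => h; move: e; rewrite h.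
  by move/addrI.
by move/addIr.
Qed.

Lemma perm_bigon (x y a b c d : nat) L :
  perm_eq ([:: x; a; b; y] ++ [:: c; x; y; d] ++ L)
          ([:: x; x] ++ [:: y; y] ++ [:: a; b; c; d] ++ L).
Proof. by apply/permP => f; rewrite !count_cat /=; lia. Qed.

Lemma mono_R2 (A : comNzRingType) o x y a b c d l cs
  (D := PD l [:: (Some o, [tuple x; a; b; y]), (Some (~~ o), [tuple c; x; y; d]) & cs])
  (ps := [:: (b, d); (a, c)]) :
  knot_pseudodiagram D -> monochrome A D <-> monochrome A (fuse id ps (PD l cs)).
Proof.
case/and3P=> wl /eqP c1 _.
have p : perm_eq (labels (crossings D)) ([:: x; x] ++ [:: y; y] ++ [:: a; b; c; d] ++ labels cs).
  exact: perm_bigon.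
have p' : perm_eq (labels (crossings D)) ([:: y; y] ++ [:: x; x] ++ [:: a; b; c; d] ++ labels cs).
  by apply: (perm_trans p); apply/permPl; apply: (perm_catCA [:: x; x] [:: y; y]).
have hx := wll_once (wll_perm p (elimT (wlP D) wl)).
have hy := wll_once (wll_perm p' (elimT (wlP D) wl)).
have nx z : z \in [:: a; b; c; d] ++ labels cs -> (z == x) = false.
  by move=> hz; apply: notin_neq hx _; rewrite (mem_cat z [:: y; y]) hz orbT.
have ny z : z \in [:: a; b; c; d] ++ labels cs -> (z == y) = false.
  by move=> hz; apply: notin_neq hy _; rewrite (mem_cat z [:: x; x]) hz orbT.
have nxy : (y == x) = false by apply: (notin_neq hx); rewrite mem_head.
have g1 : gl ps b = gl ps d by apply: fm_glue; rewrite !inE eqxx.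
have g2 : gl ps a = gl ps c by apply: fm_glue; rewrite !inE eqxx orbT.
set g := gl ps in g1 g2.
split=> h.
  apply: mono_lift h => [lam'|z hz]; last by rewrite (perm_mem p) !mem_cat hz !orbT.
  (* The colours of the two sides of the bigon are forced by the outer edges and by which strand is
     over. *)
  pose X := (if o then lam' (g b) else 2 * lam' (g a) - lam' (g b))%R.
  pose Y := (if o then 2 * lam' (g b) - lam' (g a) else lam' (g a))%R.
  exists (fun z => if z == x then X else if z == y then Y else lam' (g z)).
  split=> [z hz|hl]; first by rewrite nx ?ny // mem_cat hz orbT.
  rewrite /= hl andbT /fox /slot /= !eqxx nxy.
  rewrite !nx ?ny ?mem_cat ?inE ?eqxx ?orbT // -g1 -g2 /X /Y.
  by case: (o) => /=; rewrite ?eqxx /= ?andbT; apply/andP; split; apply/eqP; ring.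
move=> lam /= /and3P[h1 h2 hcs].
have [ebd eac] : lam b = lam d /\ lam a = lam c.
  move: h1 h2; rewrite /fox /slot /=; case: o {D c1 wl p p'} => /= /andP[/eqP e1 /eqP e2] /andP[/eqP e3 /eqP e4].
    split; first by rewrite -e1.
    by move: e4; rewrite -e2 => /addIr.
  split; last by rewrite e1.
  by move: e4; rewrite e3 -e1 -e2 => /addrI.
have gp : glues lam ps by move=> u v; rewrite !inE => /orP[]/eqP[-> ->].
have hcst := mono_down gp h hcs.
pose k := if o then x else a.
apply: (mono_up (D := D) (new := [:: _; _]) (x := k) wl c1 erefl) => //.
  by rewrite (perm_mem p) !mem_cat !inE /k; case: o {D c1 wl p p' h1 h2 k}; rewrite eqxx ?orbT.
move: h1 h2; rewrite /fox /slot /= andbT /strand_const /slot /= /k; case: o {D c1 wl p p' k} => /= /andP[/eqP e1 /eqP e2] /andP[/eqP e3 /eqP e4].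
  have m1 := mid e2; have m2 : (lam c == lam x) = (lam y == lam x) by apply: mid; rewrite e4 e3.
  by rewrite -e1 -e3 m1 m2 !eqxx.
have m1 := mid e2; have m2 : (lam x == lam a) = (lam d == lam a) by apply: mid; rewrite e4 eac.
by rewrite -e1 -eac m1 -m2 m1 !eqxx.
Qed.

Lemma mono_isotopic (A : comNzRingType) D D' : isotopic D D' ->
  monochrome A D <-> monochrome A D'.
Proof.
by elim=> {D D'} [D D' /mono_same_projection //|D|D D' _ ->|D D1 D2 _ -> _ ->].
Qed.

Lemma perm_triangle (u v w a1 a2 b1 b2 c1 c2 : nat) L :
  perm_eq ([:: w; u; a1; b1] ++ [:: a2; v; w; c1] ++ [:: b2; c2; u; v] ++ L)
   ([:: u; u] ++ [:: v; v] ++ [:: w; w] ++ [:: a1; a2; b1; b2; c1; c2] ++ L).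
Proof. by apply/permP => f; rewrite !count_cat /=; lia. Qed.

Lemma perm_triangle' (u v w a1 a2 b1 b2 c1 c2 : nat) L :
  perm_eq ([:: a2; b2; w; u] ++ [:: w; c2; a1; v] ++ [:: u; v; b1; c1] ++ L)
   ([:: u; u] ++ [:: v; v] ++ [:: w; w] ++ [:: a1; a2; b1; b2; c1; c2] ++ L).
Proof. by apply/permP => f; rewrite !count_cat /=; lia. Qed.

Lemma addr_solve (A : comNzRingType) (x y z : A) : (x + y = z -> x = z - y)%R.
Proof. by move=> <-; rewrite addrK. Qed.

(** A colouring after the move is carried back by keeping the outer colours and recomputing the
    sides of the triangle. Once the outer edges are known to share a colour, the sides follow. *)
Lemma mono_R3 (A : comNzRingType) o o' u v w a1 a2 b1 b2 c1 c2 l cs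
  (D := PD l [:: (Some o, [tuple w; u; a1; b1]), (Some o, [tuple a2; v; w; c1]),
                (Some o', [tuple b2; c2; u; v]) & cs])
  (D' := PD l [:: (Some o, [tuple a2; b2; w; u]), (Some o, [tuple w; c2; a1; v]),
                (Some o', [tuple u; v; b1; c1]) & cs]) :
  well_labelled D -> monochrome A D -> monochrome A D'.
Proof.
move=> wl h lam' /= /and4P[h1 h2 h3 hcs].
pose outer := [:: a1; a2; b1; b2; c1; c2] ++ labels cs.
have p : perm_eq (labels (crossings D)) ([:: u; u] ++ [:: v; v] ++ [:: w; w] ++ outer).
  exact: perm_triangle.
have p' : perm_eq (labels (crossings D')) ([:: u; u] ++ [:: v; v] ++ [:: w; w] ++ outer).
  exact: perm_triangle'.
have pv : perm_eq (labels (crossings D)) ([:: v; v] ++ [:: u; u] ++ [:: w; w] ++ outer).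
  by apply: (perm_trans p); apply/permPl; apply: (perm_catCA [:: u; u] [:: v; v]).
have pw : perm_eq (labels (crossings D)) ([:: w; w] ++ [:: u; u] ++ [:: v; v] ++ outer).
  by apply: (perm_trans p); rewrite catA; apply/permPl; apply: (perm_catCA ([:: u; u] ++ [:: v; v]) [:: w; w]).
have wlD := elimT (wlP D) wl.
have hu := wll_once (wll_perm p wlD); have hv := wll_once (wll_perm pv wlD).
have hw := wll_once (wll_perm pw wlD).
have nu z : z \in outer -> (z == u) = false.
  by move=> hz; apply: notin_neq hu _; rewrite (mem_cat z ([:: v; v] ++ [:: w; w])) hz orbT.
have nv z : z \in outer -> (z == v) = false.
  by move=> hz; apply: notin_neq hv _; rewrite (mem_cat z ([:: u; u] ++ [:: w; w])) hz orbT.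
have nw' z : z \in outer -> (z == w) = false.
  by move=> hz; apply: notin_neq hw _; rewrite (mem_cat z ([:: u; u] ++ [:: v; v])) hz orbT.
have nvu : (v == u) = false by apply: (notin_neq hu); rewrite mem_head.
have nwu : (w == u) = false by apply: (notin_neq hu); rewrite !inE eqxx ?orbT.
have nwv : (w == v) = false by apply: (notin_neq hv); rewrite !inE eqxx ?orbT.
pose U := (if o then 2 * lam' a1 - lam' b1 else lam' b1)%R.
pose V := (if o then 2 * lam' a1 - lam' c1 else lam' c1)%R.
pose W := (if o then lam' a1 else 2 * lam' b1 - lam' a1)%R.
pose lam z := if z == u then U else if z == v then V else if z == w then W else lam' z.
have eo z : z \in outer -> lam z = lam' z by move=> hz; rewrite /lam nu ?nv ?nw'.
have eu : lam u = U by rewrite /lam eqxx.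
have ev : lam v = V by rewrite /lam nvu eqxx.
have ew : lam w = W by rewrite /lam nwu nwv eqxx.
have oa1 : a1 \in outer by rewrite !inE eqxx ?orbT.
have oa2 : a2 \in outer by rewrite !inE eqxx ?orbT.
have ob1 : b1 \in outer by rewrite !inE eqxx ?orbT.
have ob2 : b2 \in outer by rewrite !inE eqxx ?orbT.
have oc1 : c1 \in outer by rewrite !inE eqxx ?orbT.
have oc2 : c2 \in outer by rewrite !inE eqxx ?orbT.
have hl : all (fox lam) (crossings D).
  rewrite /= (eq_fox (lam' := lam')) ?hcs ?andbT; last first.
    by move=> z hz; rewrite eo // mem_cat hz orbT.
  move: h1 h2 h3; rewrite /fox /slot /= eu ev ew !eo // /U /V /W.
  move=> h1 h2 h3.
  have [eu' ev'] : lam' u = (if o' then lam' b1 else 2 * lam' c1 - lam' b1)%R /\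
                   lam' v = (if o' then 2 * lam' b1 - lam' c1 else lam' c1)%R.
    case: (o') h3 => /andP[/eqP e5 /eqP e6]; split=> //.
    - by rewrite -e5 -e6; ring.
    - by rewrite -e5 -e6; ring.
  clear h3; rewrite eu' ev' in h1 h2.
  case: (o) h1 h2 => /= /andP[/eqP e1 /eqP e2] /andP[/eqP e3 /eqP e4].
    have eb2 := addr_solve e2; have ec2 := addr_solve e4.
    by rewrite eb2 ec2 e1 e3 !eqxx /=; case: (o'); do ?[apply/andP; split]; apply/eqP; ring.
  have ew' : lam' w = (2 * lam' c2 - lam' a1)%R := addr_solve e4.
  have ea2 := addr_solve e2; rewrite ea2 ew' e1 e3.
  by case: (o'); do ?[apply/andP; split]; apply/eqP; ring.
have hc := h lam hl.
have so z : z \in outer -> z \in labels (crossings D).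
  by move=> hz; rewrite (perm_mem p) (mem_cat z ([:: u; u] ++ [:: v; v] ++ [:: w; w])) hz orbT.
have ho z t : z \in outer -> t \in outer -> lam' z = lam' t.
  by move=> hz ht; rewrite -!eo //; apply: hc; apply: so.
have [k1 [k2 k3]] : lam' w = lam' a1 /\ lam' u = lam' a1 /\ lam' v = lam' a1.
  move: h1 h2; rewrite /fox /slot /= (ho a2 a1) // (ho b2 a1) // (ho c2 a1) //.
  case: (o) => /= /andP[/eqP e1 /eqP e2] /andP[/eqP e3 /eqP e4].
    split=> //; rewrite -e3 in e4.
    have two (x y : A) : (x + y = 2 * x)%R -> y = x by rewrite mulr_natl mulr2n => /addrI.
    by rewrite (two _ _ e2) (two _ _ e4).
  rewrite -e3 -e1; split=> //; move: e4; rewrite mulr_natl mulr2n.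
  by move/addIr.
have K z : z \in labels (crossings D') -> lam' z = lam' a1.
  rewrite (perm_mem p') (mem_cat z [:: u; u]) (mem_cat z [:: v; v]) (mem_cat z [:: w; w]).
  rewrite !inE !orbb => /or4P[/eqP->|/eqP->|/eqP->|hz] //; exact: ho.
by move=> x y /K -> /K ->.
Qed.

Lemma mono_reidemeister (A : comNzRingType) D D' :
  knot_pseudodiagram D -> knot_pseudodiagram D' -> reidemeister D D' ->
  monochrome A D <-> monochrome A D'.
Proof.
move=> k k' h; case: h k k' => {D D'} [o D D' h k _|o x y a b c d l cs k _|o o' u v w a1 a2 b1 b2 c1 c2 l cs k k'].
- exact: mono_R1 h k.
- exact: mono_R2.
have [wl _ _] := and3P k; have [wl' _ _] := and3P k'.
split; first exact: mono_R3.
(* The inverse of R3 is R3 again, up to reading every crossing from the opposite end: [E] presents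
   the diagram after the move in this way, and [E'] the one before it. *)
pose E := PD l [:: (Some o, [tuple w; u; a2; b2]), (Some o, [tuple a1; v; w; c2]),
                   (Some o', [tuple b1; c1; u; v]) & cs].
pose E' := PD l [:: (Some o, [tuple a1; b1; w; u]), (Some o, [tuple w; c1; a2; v]),
                    (Some o', [tuple u; v; b2; c2]) & cs].
have rot2 s p q r t : cyc (Some s, [tuple p; q; r; t]) (Some s, [tuple r; t; p; q]).
  by cyc_solve 2.
set D := PD l _ in wl *; set D' := PD l _ in wl' *.
have i1 : isotopic D' E by apply: ceq_iso; do 3!(apply: ceq_cons; first exact: rot2); exact: ceq_refl.
have i2 : isotopic E' D by apply: ceq_iso; do 3!(apply: ceq_cons; first exact: rot2); exact: ceq_refl.
have kE : knot_pseudodiagram E by rewrite -(isotopic_knot i1).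
have [wlE _ _] := and3P kE.
rewrite (mono_isotopic A i1) => /(mono_R3 wlE) h.
by apply/(mono_isotopic A i2).
Qed.

Lemma mono_equivalent (A : comNzRingType) D D' : equivalent D D' ->
  monochrome A D <-> monochrome A D'.
Proof.
elim=> {D D'} [D D' [k k' [/mono_same_projection //|/(mono_reidemeister A k k') //]]|D|D D' _ ->|D D1 D2 _ -> _ ->] //.
Qed.

Lemma unknot_mono (A : comNzRingType) D : unknot D -> monochrome A D.
Proof. by move=> /(mono_equivalent A) ->. Qed.

(** * Fractions of tangles and knottedness *)

Definition pq_op (u : int * int) (o : option (option bool)) : int * int :=
  match o with
  | None => (u.2, u.1)
  | Some (Some false) => (u.1 - u.2, u.2)%R
  | Some _ => (u.1 + u.2, u.2)%R
  end.

(* the fraction of a rational tangle *)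
Definition pq (w : word) : int * int := foldl pq_op (1, 0)%R w.

Lemma pq_rcons w o : pq (rcons w o) = pq_op (pq w) o.
Proof. by rewrite /pq foldl_rcons. Qed.

Lemma par_pq w : par w = (odd `|(pq w).1|, odd `|(pq w).2|).
Proof.
elim/last_ind: w => [|w o IH] //; rewrite par_rcons pq_rcons IH.
by case: o => [[[]|]|] //=; congr pair; lia.
Qed.

(* The last clause records why a diagram can fail to see two colours. *)
Lemma word_fox w (t := tangle_word w) : exists c : nat -> int,
  [/\ all (fox c) (tcrossings t), c (nw t) = 0%R, c (ne t) = (pq w).1,
      c (sw t) = (pq w).2 & c (se t) = ((pq w).1 + (pq w).2)%R] /\
  [\/ exists x y, [/\ x \in labels (tcrossings t), y \in labels (tcrossings t),
                      c x = 0%R & c y = 1%R],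
      pq w = (1, 0)%R /\ nw t = sw t | pq w = (0, 1)%R /\ nw t = ne t].
Proof.
rewrite {}/t; elim/last_ind: w => [|w o [c [[h1 h2 h3 h4 h5] h6]]].
  by exists Posz; split; [split|constructor 2].
rewrite pq_rcons tangle_rcons; case: o => [s|]; last first.
  exists c; split.
    split=> //=; last by rewrite addrC.
    rewrite all_map; apply: sub_all h1 => k /=.
    have [s [p [q [r [u ->]]]]] := crossingP k; rewrite /fox /slot /=.
    case: s => [[]|] //=; first by rewrite [(c u + _)%R]addrC.
    by rewrite eq_sym => /andP[/eqP-> ->]; rewrite eqxx.
  case: h6 => [[x [y [hx hy cx cy]]]|[-> e]|[-> e]] /=.
  - constructor 1; exists x, y; rewrite !(perm_mem (labels_reflect _)); split=> //.
  - by constructor 3.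
  by constructor 2.
have h7 := nw_lt w; have h8 := ne_lt w; have h9 := sw_lt w; have h10 := se_lt w.
have hl := @lab_lt w; set t := tangle_word w in h1 h2 h3 h4 h5 h6 h7 h8 h9 h10 hl *.
pose x := nlab t; pose y := x.+1.
have ex : 2 * size (tcrossings t) + 2 = x by [].
have ey : 2 * size (tcrossings t) + 3 = y by rewrite /y /x /nlab addnS.
(* The crossing rule forces the colours of the new endpoints. An unresolved crossing is treated like
   [Some true], in agreement with [pq_op]. *)
pose X := (if s is Some false then 2 * c (ne t) - c (se t) else c (se t))%R.
pose Y := (if s is Some false then c (ne t) else 2 * c (se t) - c (ne t))%R.
pose c' z := if z == x then X else if z == y then Y else c z.
have ce z : z < nlab t -> c' z = c z.
  by move=> hz; rewrite /c' !ltn_eqF // ltnS ltnW.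
have cx : c' x = X by rewrite /c' eqxx.
have cy : c' y = Y by rewrite /c' eqxx gtn_eqF.
exists c'; rewrite /= ex ey; split.
  rewrite (eq_fox (lam' := c)) => [|z hz]; last by rewrite ce ?hl.
  rewrite h1 andbT /fox /slot /= cx cy !ce // h2 h4 /X /Y h3 h5.
  by case: s {X Y c' ce cx cy} => [[]|] /=; clear; split=> //=; lia.
have two z t' : z \in ends t -> t' \in ends t -> c z = 0%R -> c t' = 1%R ->
  [/\ z \in [:: x; ne t; se t; y], t' \in [:: x; ne t; se t; y] & True] ->
  exists u v, [/\ u \in labels ((s, [tuple x; ne t; se t; y]) :: tcrossings t),
     v \in labels ((s, [tuple x; ne t; se t; y]) :: tcrossings t), c' u = 0%R & c' v = 1%R].
  move=> hz ht cz ct [mz mt _]; exists z, t'.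
  by rewrite labels_cons !mem_cat mz mt !ce ?(@word_ends w).
case: h6 => [[u [v [hu hv cu cv]]]|[E e]|[E e]].
- constructor 1; exists u, v; rewrite labels_cons !mem_cat hu hv !orbT.
  by rewrite !ce ?hl.
- by constructor 2; rewrite E; case: (s) => [[]|].
constructor 1; apply: (two (ne t) (se t)); rewrite ?h3 ?h5 ?E ?inE ?eqxx ?orbT //.
Qed.

(** The ends joined by the closure differ in colour by the numerator, so the integer colouring of
    the tangle becomes a colouring of the diagram modulo the numerator. The colours 0 and 1, which
    both occur, stay distinct there. *)
Lemma not_unknot w : 1 < `|(pq w).1| -> ~ unknot (N w).
Proof.
move=> hm; set m := `|(pq w).1| in hm; have [c [[h1 h2 h3 h4 h5] h6]] := word_fox w.
move=> /(@unknot_mono 'Z_m) h.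
pose lam z : 'Z_m := ((c z)%:~R)%R.
have p0 : ((pq w).1%:~R = 0 :> 'Z_m)%R.
  have e : (m%:R = 0 :> 'Z_m)%R by exact: pchar_Zp.
  rewrite [(pq w).1]intEsign rmorphM /= -/m -[((Posz m)%:~R)%R]/(m%:R)%R e mulr0 //.
have hl : all (fox lam) (tcrossings (tangle_word w)).
  apply: sub_all h1 => k; rewrite /fox /lam; case: k.1 => [[]|] // /andP[/eqP e1 /eqP e2].
    by rewrite e1 eqxx -rmorphD e2 rmorphM /= e1.
  by rewrite e1 eqxx -rmorphD e2 rmorphM /= e1.
have g : glues lam [:: (nw (tangle_word w), ne (tangle_word w)); (sw (tangle_word w), se (tangle_word w))].
  move=> x y; rewrite !inE => /orP[]/eqP[-> ->]; rewrite /lam ?h2 ?h3 ?h4 ?h5 ?p0 //.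
  by rewrite rmorphD /= p0 add0r.
have hc := mono_down g h hl.
case: h6 => [[x [y [hx hy cx cy]]]|[E _]|[E _]].
- have := hc x y hx hy; rewrite /lam cx cy => /eqP.
  by rewrite eq_sym /= oner_eq0.
- by move: hm; rewrite /m E.
by move: hm; rewrite /m E.
Qed.

Definition all_true (w : word) : word := [seq omap (fun _ => Some true) o | o <- w].

Lemma par_all_true w : par (all_true w) = par w.
Proof.
elim/last_ind: w => // w o IH; rewrite /all_true map_rcons !par_rcons -/(all_true w) IH.
by case: o.
Qed.

Lemma tangle_all_true w (t := tangle_word w) (t' := tangle_word (all_true w)) :
  [/\ ends t' = ends t, map snd (tcrossings t') = map snd (tcrossings t) &
      all (fun c => c.1 == Some true) (tcrossings t')].
Proof.
rewrite /t /t'; elim/last_ind: w {t t'} => // w o [[e1 e2 e3 e4] e5 e6].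
rewrite /all_true map_rcons !tangle_rcons -/(all_true w).
have es : size (tcrossings (tangle_word (all_true w))) = size (tcrossings (tangle_word w)).
  by rewrite -(size_map snd) e5 size_map.
case: o => [s|]; rewrite /ends /=; last first.
  rewrite e1 e2 e3 e4; split=> //; last by rewrite all_map; apply: sub_all e6.
  rewrite -!map_comp; move: e5; move: (tcrossings _) (tcrossings _).
  elim=> [|a l IH] [|b l'] //= [e /IH ->]; congr cons.
  by rewrite /reflect_crossing /= e.
by rewrite e1 e2 e3 e4 es e5 e6.
Qed.

Lemma N_fuse w (t := tangle_word w) :
  N w = fuse id [:: (nw t, ne t); (sw t, se t)] (PD 0 (tcrossings t)).
Proof. by []. Qed.

(** The number of components does not depend on the states, so all crossings may be resolved, and
    then the integer colouring is constrained everywhere. Modulo 2 it is constant along strands;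
    with an even numerator it would survive the closure and separate two components. *)
Lemma components_par w : num_components (N w) = 1 -> tcrossings (tangle_word w) != [::] ->
  (par w).1.
Proof.
have [[e1 e2 e3 e4] e5 e6] := tangle_all_true w.
rewrite -par_all_true => hc hne.
have [] := @darts_map (N w) (N (all_true w)) id (fun _ => 0) id.
- by rewrite !N_fuse !fuse_fm /= e1 e2 e3 e4.
- by rewrite /num_crossings !N_fuse !fuse_fm /= !size_map -(size_map snd) e5 size_map.
- by move=> i j _ _.
- by [].
- by move=> i j _ _.
- move=> i j hi hj; rewrite addn0 modn_small // /slot -!(nth_map _ (snd default_crossing) snd).
  + congr (nth _ (val (nth _ _ _)) _).
    rewrite !N_fuse e1 e2 e3 e4 !fuse_fm; set g := fm _ _; rewrite /=.
    have E cs : map snd (rl g cs) = map (fun t : 4.-tuple nat => [tuple of map g t]) (map snd cs).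
      by rewrite -!map_comp.
    by rewrite !E e5.
  + by [].
  by move: hi; rewrite /num_crossings !N_fuse !fuse_fm /= !size_map -(size_map snd) -e5 size_map.
- exact: N_wl.
move=> wl; rewrite hc => hc' _.
have hne' : tcrossings (tangle_word (all_true w)) != [::].
  by rewrite -size_eq0 -(size_map snd) e5 size_map size_eq0.
move: (all_true w) e6 hc' hne' wl => u hu {}hc {}hne wl.
have [c [[h1 h2 h3 h4 h5] h6]] := word_fox u.
rewrite par_pq /=; apply/negPn/negP => hp.
pose chi z := odd `|c z|.
have hs : all (strand_const chi) (tcrossings (tangle_word u)).
  apply/allP => k hk; have /eqP e := allP hu k hk; have := allP h1 k hk.
  rewrite /fox /strand_const e /chi => /andP[/eqP-> /eqP]; rewrite eqxx /=; lia.
pose ps := [:: (nw (tangle_word u), ne (tangle_word u)); (sw (tangle_word u), se (tangle_word u))].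
have g : glues chi ps.
  move=> x y; rewrite !inE => /orP[]/eqP[-> ->]; rewrite /chi ?h2 ?h3 ?h4 ?h5; lia.
have gk := gl_univ g.
have hN : crossings (N u) = rl (gl ps) (tcrossings (tangle_word u)) by rewrite N_fuse fuse_fm.
have hcs : all (strand_const chi) (crossings (N u)).
  rewrite hN strands_rl; by apply: sub_all hs => k; rewrite /strand_const /= !gk.
case: h6 => [[x [y [hx hy cx cy]]]|[E _]|[E e]].
- have := components1_const wl hc hcs (x := gl ps x) (y := gl ps y).
  by rewrite hN labels_rl !map_f // !gk /chi cx cy => /(_ isT isT).
- by move: hp; rewrite E.
(* Here the closure has cut off a circle, which is excluded by a single component with crossings. *)
have := loops_components wl hc; rewrite hN -size_eq0 size_map size_eq0 => /(_ hne).
by rewrite N_fuse fuse_fm /= e eqxx.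
Qed.

(** * The game with [k] additional moves that change nothing *)

(** The game ends with the last unresolved crossing, even if tempo moves are left. *)
Inductive twins (p : player) : nat -> player -> pseudodiagram -> Prop :=
| twins_final k m D of (forall i, ~~ unresolved D i) & final_win p D : twins p k m D
| twins_own k D i o of unresolved D i & twins p k (opponent p) (resolve D i o) :
    twins p k p D
| twins_own_tempo k D of twins p k (opponent p) D : twins p k.+1 p D
| twins_opponent k D of (exists i, unresolved D i)
    & (forall i o, unresolved D i -> twins p k p (resolve D i o))
    & (forall k', k = k'.+1 -> twins p k' p D) :
    twins p k (opponent p) D.

Lemma twins_wins p m D : twins p 0 m D -> wins p m D.
Proof.
move: {1 3}0 (erefl 0) => k ek h; elim: h ek => {k m D} [k m D h1 h2|k D i o h1 h2 IH|k D h IH|k D h1 h2 IH _ _] // ek.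
- exact: wins_final.
- exact: wins_own h1 (IH ek).
by apply: wins_opponent h1 _ => i o hi; apply: IH.
Qed.

(** The move as a splitting of the list of crossings instead of an index, which is easier to follow
    through permutations and relabellings. *)
Definition resolves D o E := exists l a t b,
  D = PD l (a ++ (None, t) :: b) /\ E = PD l (a ++ (Some o, t) :: b).

Lemma unresolved_resolves D i o : unresolved D i -> resolves D o (resolve D i o).
Proof.
case: D => l cs /andP[hi /eqP hn]; rewrite /= in hi hn.
exists l, (take i cs), (nth default_crossing cs i).2, (drop i.+1 cs); split.
  rewrite -{1}(cat_take_drop i cs) (drop_nth default_crossing) //; congr (PD _ (_ ++ _ :: _)).
  by rewrite -hn; case: (nth _ _ _).
rewrite /resolve /=; congr PD.
by rewrite set_nthE hi.
Qed.

Lemma resolves_unresolved D o E : resolves D o E ->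
  exists2 i, unresolved D i & E = resolve D i o.
Proof.
case=> l [a [t [b [-> ->]]]]; exists (size a).
  by rewrite /unresolved /num_crossings /= size_cat /= nth_cat ltnn subnn /= -addSnnS leq_addr.
rewrite /resolve /= set_nthE size_cat /= -addSnnS leq_addr take_size_cat //.
rewrite nth_cat ltnn subnn /=; congr (PD _ (_ ++ _ :: _)).
by rewrite -cat_rcons drop_size_cat ?size_rcons.
Qed.

Lemma resolves_knot D o E : resolves D o E -> knot_pseudodiagram E = knot_pseudodiagram D.
Proof.
by case=> l [a [t [b [-> ->]]]]; apply: knot_states; rewrite !map_cat.
Qed.

(** The answer [o'] may differ from [o], because rotating a crossing exchanges the names of its two
    resolutions. *)
Definition sim (R : pseudodiagram -> pseudodiagram -> Prop) D D' :=
  forall o E, resolves D o E -> exists o' E', resolves D' o' E' /\ R E E'.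

Lemma map_split (T T' : Type) (g : T -> T') cs a' x b' :
  map g cs = a' ++ x :: b' ->
  exists a y b, [/\ cs = a ++ y :: b, a' = map g a, x = g y & b' = map g b].
Proof.
elim: a' cs => [|z a' IH] [|c cs] //= [<- h]; first by exists [::], c, cs.
by have [a [y [b [-> -> -> ->]]]] := IH _ h; exists (c :: a), y, b.
Qed.

Definition resolved (c : crossing) := c.1 != None.

Lemma resolves_cat l new cs o E : all resolved new -> resolves (PD l (new ++ cs)) o E ->
  exists a t b, cs = a ++ (None, t) :: b /\ E = PD l (new ++ a ++ (Some o, t) :: b).
Proof.
move=> hn [l' [a [t [b [[<- e] ->]]]]]; elim: new a hn e => [|c new IH] a /=.
  by move=> _ ->; exists a, t, b.
case: a => [|c' a] /andP[hc hn] [e1 e2]; first by rewrite e1 in hc.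
have [a' [t' [b' [-> h]]]] := IH _ hn e2; rewrite e1.
by exists a', t', b'; split=> //; move: h => [<-].
Qed.

Lemma cat_resolves l new a t b o :
  resolves (PD l (new ++ a ++ (None, t) :: b)) o (PD l (new ++ a ++ (Some o, t) :: b)).
Proof. by exists l, (new ++ a), t, b; rewrite !catA. Qed.

(** A change that involves only resolved crossings leaves the rest of the diagram in place up to
    relabelling, so the choices on both sides correspond, and the same change applies after them. *)
Lemma sim_context (R : pseudodiagram -> pseudodiagram -> Prop) l l' new new' g cs :
  all resolved new -> all resolved new' ->
  (forall cs', map snd cs' = map snd cs -> R (PD l (new ++ cs')) (PD l' (new' ++ rl g cs'))) ->
  sim R (PD l (new ++ cs)) (PD l' (new' ++ rl g cs)) /\
  sim (fun D D' => R D' D) (PD l' (new' ++ rl g cs)) (PD l (new ++ cs)).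
Proof.
move=> hn hn' h; split=> o E hE.
  have [a [t [b [e eE]]]] := resolves_cat hn hE.
  have := h (a ++ (Some o, t) :: b); rewrite e !map_cat /= => /(_ erefl) hR.
  rewrite eE; exists o; eexists; split; last exact: hR.
  exact: cat_resolves.
have [a' [t' [b' [e eE]]]] := resolves_cat hn' hE.
have [a [[s t] [b [ecs ea et eb]]]] := map_split e.
case: et => es et; rewrite -es in ecs.
have := h (a ++ (Some o, t) :: b); rewrite ecs !map_cat /= => /(_ erefl) hR.
exists o; eexists; split; first exact: cat_resolves.
rewrite eE ea eb; move: hR; rewrite /relabel_crossing /=; congr R; congr (PD _ (_ ++ _ ++ (_, _) :: _)).
by rewrite et.
Qed.

Lemma knot_states_cat l new cs cs' : map snd cs = map snd cs' ->
  knot_pseudodiagram (PD l (new ++ cs)) = knot_pseudodiagram (PD l (new ++ cs')).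
Proof. by move=> e; apply: knot_states; rewrite !map_cat e. Qed.

Lemma map_snd_rl g cs cs' : map snd cs = map snd cs' :> seq (4.-tuple nat) ->
  map snd (rl g cs) = map snd (rl g cs').
Proof.
have E ds : map snd (rl g ds) = map (fun t : 4.-tuple nat => [tuple of map g t]) (map snd ds).
  by rewrite -!map_comp.
by move=> e; rewrite !E e.
Qed.

Lemma sim_equivalent l l' new new' g cs :
  all resolved new -> all resolved new' ->
  knot_pseudodiagram (PD l (new ++ cs)) -> knot_pseudodiagram (PD l' (new' ++ rl g cs)) ->
  (forall cs', reidemeister (PD l (new ++ cs')) (PD l' (new' ++ rl g cs'))) ->
  sim equivalent (PD l (new ++ cs)) (PD l' (new' ++ rl g cs)) /\
  sim equivalent (PD l' (new' ++ rl g cs)) (PD l (new ++ cs)).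
Proof.
move=> hn hn' k k' h.
have [] := @sim_context equivalent l l' new new' g cs hn hn'.
  move=> cs' e; apply: rst_step; split.
  - by rewrite (knot_states_cat _ _ e).
  - by rewrite (knot_states_cat _ _ (map_snd_rl g e)).
  by right.
move=> h1 h2; split=> // o E /h2 [o' [E' [r e]]].
by exists o', E'; split=> //; apply: eqv_sym.
Qed.

Lemma sim_reidemeister D D' : knot_pseudodiagram D -> knot_pseudodiagram D' ->
  reidemeister D D' -> sim equivalent D D' /\ sim equivalent D' D.
Proof.
move=> k k' h; case: h k k' => {D D'} [o D D' []|o x y a b c d l cs|o o' u v w a1 a2 b1 b2 c1 c2 l cs].
- move=> x a b l cs; rewrite fuse_fm => k k'.
  apply: (@sim_equivalent _ _ [:: (Some o, [tuple x; x; a; b])] [::]) => // cs'.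
  by have := R1 (DeleteKink (Some o) x a b l cs'); rewrite fuse_fm.
- rewrite fuse_fm => k k'.
  apply: (@sim_equivalent _ _ [:: (Some o, [tuple x; a; b; y]); (Some (~~ o), [tuple c; x; y; d])] [::]) => // cs'.
  by have := R2 o x y a b c d l cs'; rewrite fuse_fm.
pose L := [:: (Some o, [tuple w; u; a1; b1]); (Some o, [tuple a2; v; w; c1]);
              (Some o', [tuple b2; c2; u; v])].
pose L' := [:: (Some o, [tuple a2; b2; w; u]); (Some o, [tuple w; c2; a1; v]);
              (Some o', [tuple u; v; b1; c1])].
move=> k k'; have := @sim_equivalent l l L L' id cs isT isT; rewrite rl_id => /(_ k k'); apply.
by move=> cs'; rewrite rl_id; apply: R3.
Qed.

Lemma sim_same_projection D D' : knot_pseudodiagram D -> same_projection D D' ->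
  sim equivalent D D' /\ sim equivalent D' D.
Proof.
move=> k h; have k' : knot_pseudodiagram D' by rewrite -(same_projection_knot h).
have iE E E' : knot_pseudodiagram E -> isotopic E E' -> equivalent E E' /\ equivalent E' E.
  by move=> kE /(isotopic_equivalent kE) i; split=> //; apply: eqv_sym.
case: h k k' => {D D'} [l cs cs' p|f [l cs] fI|l c cs] k k'.
- suff gen a b : perm_eq a b -> knot_pseudodiagram (PD l a) -> sim equivalent (PD l a) (PD l b).
    by split; apply: gen => //; rewrite perm_sym.
  move=> {k k' p} p k o E hE; have kE : knot_pseudodiagram E by rewrite (resolves_knot hE).
  case: hE => l' [a1 [t [b1 [[? ea] eE]]]]; subst l' a E.
  have : ((None, t) : crossing) \in b by rewrite -(perm_mem p) mem_cat mem_head orbT.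
  move=> hin; case/splitPr: hin p => a2 b2 p.
  exists o, (PD l (a2 ++ (Some o, t) :: b2)); split; first by exists l, a2, t, b2.
  apply: isotopic_equivalent kE (iso_perm _ _).
  by move/permP: p => p; apply/permP => f; move: (p f); rewrite !count_cat /=; clear; lia.
- have [] := @sim_context equivalent l l [::] [::] f cs isT isT.
    move=> cs' e; have kc : knot_pseudodiagram (PD l cs') by rewrite (knot_states l e).
    by apply: isotopic_equivalent kc _; apply: rst_step; apply: (@same_relabel f (PD l cs')).
  by move=> h1 h2; split=> // o E /h2 [o' [E' [r /eqv_sym e]]]; exists o', E'.
have simr a t b : rotate_crossing (Some a, t) = (Some (~~ a), [tuple of rot 1 t]) by [].
split=> o E hE; have kE : knot_pseudodiagram E by rewrite (resolves_knot hE).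
  case: hE => l' [[|c' a] [t [b [[? e1 e2] eE]]]]; subst l' cs E.
    exists (~~ o), (PD l (rotate_crossing (Some o, t) :: b)); split.
      by exists l, [::], [tuple of rot 1 t], b; rewrite e1.
    by apply: isotopic_equivalent kE _; apply: rst_step; apply: same_rotate.
  exists o, (PD l (rotate_crossing c :: a ++ (Some o, t) :: b)); split.
    by exists l, (rotate_crossing c :: a), t, b.
  by rewrite -e1; apply: isotopic_equivalent (rst_step _ _ _ _ (same_rotate _ _ _)); rewrite e1.
case: hE => l' [[|c' a] [t [b [eD eE]]]].
  case: c eD k k' => [[s|] t'] [el // et ecs] k k'; subst l' cs E.
  exists (~~ o), (PD l ((Some (~~ o), t') :: b)); split; first by exists l, [::], t', b.
  apply/eqv_sym/isotopic_equivalent; last first.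
    apply: rst_step; have -> : (Some o, t) = rotate_crossing (Some (~~ o), t').
      by rewrite /rotate_crossing /= negbK et.
    exact: same_rotate.
  by rewrite (@knot_states _ _ ((None, t') :: b)).
have [el e1 ecs] : [/\ l = l', rotate_crossing c = c' & cs = a ++ (None, t) :: b].
  by case: eD => -> <- ->.
subst l' cs E.
exists o, (PD l (c :: a ++ (Some o, t) :: b)); split.
  by exists l, (c :: a), t, b.
apply/eqv_sym; rewrite -e1; apply: isotopic_equivalent (rst_step _ _ _ _ (same_rotate _ _ _)).
by rewrite (@knot_states _ _ (c :: a ++ (None, t) :: b)) //= !map_cat.
Qed.

Lemma sim_trans D1 D2 D3 : sim equivalent D1 D2 -> sim equivalent D2 D3 -> sim equivalent D1 D3.
Proof.
move=> h1 h2 o E /h1 [o' [E' [/h2 [o'' [E'' [r e']]] e]]].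
by exists o'', E''; split=> //; apply: eqv_trans e e'.
Qed.

(** Ordinary Reidemeister moves touch no unresolved crossing, and isotopies merely rename the
    choices, so equivalence is a bisimulation of games. *)
Lemma equivalent_sim D D' : equivalent D D' -> sim equivalent D D' /\ sim equivalent D' D.
Proof.
elim=> {D D'} [D D' [k k' [h|h]]|D|D D' _ [h1 h2]|D D1 D2 _ [h1 h2] _ [h3 h4]].
- exact: sim_same_projection.
- exact: sim_reidemeister.
- by split=> o E h; exists o, E; split=> //; apply: eqv_refl.
- by split.
by split; [apply: sim_trans h1 h3|apply: sim_trans h4 h2].
Qed.

Lemma final_win_equivalent p D D' : equivalent D D' -> final_win p D -> final_win p D'.
Proof.
move=> e; have e' := eqv_sym e; case: p => /= h; last exact: eqv_trans e' h.
by move=> h'; apply: h; apply: eqv_trans e h'.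
Qed.

Lemma sim_unresolved R D D' : sim R D D' -> (exists i, unresolved D i) -> exists i, unresolved D' i.
Proof.
move=> h [i hi]; have [o' [E' [/resolves_unresolved[j hj _] _]]] := h _ _ (unresolved_resolves true hi).
by exists j.
Qed.

Lemma twins_equivalent p k m D D' : equivalent D D' -> twins p k m D -> twins p k m D'.
Proof.
move=> e h; elim: h D' e => {k m D} [k m D h1 h2|k D i o h1 h2 IH|k D h IH|k D h1 h2 IH h3 IH3] D' e;
  have [s s'] := equivalent_sim e.
- apply: twins_final (final_win_equivalent e h2) => i; apply/negP => hi.
  have [j hj] : exists i, unresolved D i by apply: sim_unresolved s' _; exists i.
  by rewrite (negbTE (h1 j)) in hj.
- have [o' [E' [/resolves_unresolved[j hj ->] e']]] := s _ _ (unresolved_resolves o h1).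
  by apply: (twins_own hj); apply: IH e'.
- by apply: twins_own_tempo; apply: IH.
apply: twins_opponent; first exact: sim_unresolved s h1.
  move=> i o hi; have [o' [E' [/resolves_unresolved[j hj ->] e']]] := s' _ _ (unresolved_resolves o hi).
  exact: IH hj _ (eqv_sym e').
by move=> k' ek; apply: IH3 ek _ e.
Qed.

Definition kink_step := knot_step (delete_kink None).

(** A kink falls to R1 whichever way it is resolved, so playing in it leads to the diagram without
    it; all other moves commute with its deletion. *)
Lemma kink_step_moves D D' : kink_step D D' ->
  [/\ forall o E', resolves D' o E' -> exists E, resolves D o E /\ kink_step E E',
      forall o E, resolves D o E -> equivalent E D' \/ exists E', resolves D' o E' /\ kink_step E E'
    & exists E, resolves D true E /\ equivalent E D'].
Proof.
case=> k k' h; case: h k k' => {D D'} x a b l cs k k'.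
have eqv o : equivalent (PD l ((Some o, [tuple x; x; a; b]) :: cs)) (fuse id [:: (a, b)] (PD l cs)).
  apply: rst_step; split; [|exact: k'|by right; apply: (@R1 o); apply: DeleteKink].
  have e : map snd ((Some o, [tuple x; x; a; b]) :: cs) = map snd ((None, [tuple x; x; a; b]) :: cs) by [].
  by rewrite (knot_states l e); exact: k.
rewrite fuse_fm in k' *; set g := gl _ in k' *; set l' := l + _ in k' *.
have st cs' : map snd cs' = map snd cs ->
    kink_step (PD l ((None, [tuple x; x; a; b]) :: cs')) (PD l' (rl g cs')).
  move=> e; split.
  - by rewrite (knot_states_cat l [:: (None, [tuple x; x; a; b])] e); exact: k.
  - by rewrite (@knot_states _ _ (rl g cs) (map_snd_rl g e)).
  by have := DeleteKink None x a b l cs'; rewrite fuse_fm.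
split.
- move=> o E' [l2 [a' [t' [b' [[<- e] ->]]]]].
  have [a1 [[s t] [b1 [ecs -> [es ->] ->]]]] := map_split e; rewrite -es in ecs.
  exists (PD l ((None, [tuple x; x; a; b]) :: a1 ++ (Some o, t) :: b1)); split.
    by exists l, ((None, [tuple x; x; a; b]) :: a1), t, b1; rewrite ecs.
  have := st (a1 ++ (Some o, t) :: b1); rewrite ecs !map_cat /=; exact.
- move=> o E [l2 [[|c a1] [t [b1 [eD ->]]]]].
    left; have [<- <- <-] : [/\ l = l2, [tuple x; x; a; b] = t & cs = b1] by case: eD => -> <- ->.
    by have := eqv o; rewrite fuse_fm.
  right; have [<- <- ecs] : [/\ l = l2, (None, [tuple x; x; a; b]) = c & cs = a1 ++ (None, t) :: b1].
    by case: eD => -> <- ->.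
  exists (PD l' (rl g (a1 ++ (Some o, t) :: b1))); split.
    exists l', (rl g a1), [tuple of map g t], (rl g b1); rewrite ecs !map_cat /=.
    by split.
  by apply: st; rewrite ecs !map_cat.
exists (PD l ((Some true, [tuple x; x; a; b]) :: cs)); split.
  by exists l, [::], [tuple x; x; a; b], cs.
by have := eqv true; rewrite fuse_fm.
Qed.

Lemma opponentK p : opponent (opponent p) = p. Proof. by case: p. Qed.

(** The kink is the only crossing left, and resolving it either way yields the finished diagram;
    tempo moves can only delay this. *)
Lemma twins_kink_final p k m D D' : kink_step D D' -> (forall i, ~~ unresolved D' i) ->
  final_win p D' -> twins p k m D.
Proof.
move=> hk nu hf; have [h1 h2 [E0 [r0 e0]]] := kink_step_moves hk.
have fin k' m' E : equivalent E D' -> twins p k' m' E.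
  by move=> e; apply: twins_equivalent (eqv_sym e) _; apply: twins_final.
elim: k m => [|k IH] m; have [-> | ->] : m = p \/ m = opponent p by case: m; case: (p); auto.
- by have [i hi eE] := resolves_unresolved r0; apply: (twins_own (o := true) hi); rewrite -eE; apply: fin.
- have [i0 hi0 _] := resolves_unresolved r0.
  apply: twins_opponent => //; first by exists i0.
  move=> i o hi; case: (h2 _ _ (unresolved_resolves o hi)) => [e|[E' [r _]]]; first exact: fin.
  by have [j hj] := resolves_unresolved r; rewrite (negbTE (nu j)) in hj.
- by have [i hi eE] := resolves_unresolved r0; apply: (twins_own (o := true) hi); rewrite -eE; apply: fin.
have [i0 hi0 _] := resolves_unresolved r0.
apply: twins_opponent => //; first by exists i0.
  move=> i o hi; case: (h2 _ _ (unresolved_resolves o hi)) => [e|[E' [r _]]]; first exact: fin.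
  by have [j hj] := resolves_unresolved r; rewrite (negbTE (nu j)) in hj.
by move=> k' [<-]; apply: IH.
Qed.

(* A kink is a further move that changes nothing. *)
Lemma twins_kink p k m D D' : kink_step D D' -> twins p k.+1 m D' -> twins p k m D.
Proof.
move=> hk h; suff gen K E : twins p K m E -> forall k D, K = k.+1 -> kink_step D E -> twins p k m D.
  exact: gen h _ _ erefl hk.
move=> {k D D' hk h}; elim=> {K m E} K.
- by move=> m D' nu hf k D _ hk; apply: twins_kink_final hk nu hf.
- move=> D' i o hi _ IH k D eK hk; have [h1 h2 _] := kink_step_moves hk.
  have [E [r hE]] := h1 _ _ (unresolved_resolves o hi).
  have [j hj eE] := resolves_unresolved r; apply: (twins_own (o := o) hj); rewrite -eE.
  exact: IH eK hE.
- move=> D' h IH k D [eK] hk; have [_ _ [E [r e]]] := kink_step_moves hk.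
  have [j hj eE] := resolves_unresolved r; apply: (twins_own (o := true) hj); rewrite -eE -eK.
  exact: twins_equivalent (eqv_sym e) h.
move=> D' hu h IH h3 IH3 k D eK hk; have [h1 h2 [E0 [r0 e0]]] := kink_step_moves hk.
have [j hj _] := resolves_unresolved r0.
apply: twins_opponent; first by exists j.
  move=> i o hi; case: (h2 _ _ (unresolved_resolves o hi)) => [e|[E' [r hE]]].
    apply: twins_equivalent (eqv_sym e) _; exact: h3.
  have [j' hj' eE] := resolves_unresolved r; rewrite eE in hE.
  exact: IH hj' _ _ eK hE.
move=> k' ek; exact: IH3 eK _ _ ek hk.
Qed.

(** The form of winning that survives adding kinks: by [twins_kink] each kink takes the place of one
    tempo move. *)
Definition strong_win D := forall k m, twins Unknotter k m D.

Lemma strong_win_R1s D D' : pseudo_R1s D D' -> strong_win D' -> strong_win D.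
Proof.
elim=> {D D'} [D D' [e|h]|//|D D1 D2 _ h1 _ h2] hw; last by auto.
  by move=> k m; apply: twins_equivalent (eqv_sym e) (hw k m).
by move=> k m; apply: twins_kink h (hw _ _).
Qed.

(** * An abstract game: the players assign bits to variables *)

Definition upd (T : Type) (e : nat -> T) i (b : T) j := if j == i then b else e j.

(* [us] lists the free variables, [n] is their number, and the player who wants
   [Phi] to hold in the end is to move iff [mine]. *)
Fixpoint vwin (Phi : (nat -> bool) -> Prop) n (mine : bool) (us : seq nat)
    (e : nat -> bool) : Prop :=
  if n is n'.+1 then
    if mine then exists i b, i \in us /\ vwin Phi n' false (rem i us) (upd e i b)
    else forall i b, i \in us -> vwin Phi n' true (rem i us) (upd e i b)
  else Phi e.

Definition agree (us : seq nat) (e e' : nat -> bool) := forall i, i \notin us -> e' i = e i.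

Lemma agree_upd us e e' i b : uniq us -> i \in us ->
  agree (rem i us) (upd e i b) e' -> agree us e e' /\ e' i = b.
Proof.
move=> u hi h; split=> [j hj|]; last by rewrite h ?mem_rem_uniq ?inE ?eqxx // /upd eqxx.
rewrite h; last by rewrite mem_rem_uniq // inE (negbTE hj) andbF.
by rewrite /upd; case: eqP => // e0; rewrite e0 hi in hj.
Qed.

Lemma vwin_mono (Phi Psi : (nat -> bool) -> Prop) n mine us e : uniq us ->
  (forall e', agree us e e' -> Phi e' -> Psi e') ->
  vwin Phi n mine us e -> vwin Psi n mine us e.
Proof.
elim: n mine us e => [|n IH] mine us e u h /=; first by apply: h.
have h' i b : i \in us -> forall e', agree (rem i us) (upd e i b) e' -> Phi e' -> Psi e'.
  by move=> hi e' /(agree_upd u hi)[/h].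
case: mine => [[i [b [hi w]]]|w i b hi].
  by exists i, b; split=> //; apply: IH w; [exact: rem_uniq|exact: h'].
by apply: IH (w i b hi); [exact: rem_uniq|exact: h'].
Qed.

Lemma perm_rem2 (i : nat) us us' : perm_eq us us' -> perm_eq (rem i us) (rem i us').
Proof.
move=> p; case: (boolP (i \in us)) => [hi|ni]; last by rewrite !rem_id // -(perm_mem p).
rewrite -(perm_cons i); apply: perm_trans (perm_to_rem _); last by rewrite -(perm_mem p).
by apply: perm_trans p; rewrite perm_sym perm_to_rem.
Qed.

Lemma vwin_perm Phi n mine us us' e : perm_eq us us' ->
  vwin Phi n mine us e -> vwin Phi n mine us' e.
Proof.
elim: n mine us us' e => [|n IH] mine us us' e p //=.
have pr i := perm_rem2 i p.
case: mine => [[i [b [hi w]]]|w i b hi].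
  by exists i, b; rewrite -(perm_mem p); split=> //; apply: IH w.
by apply: IH (w i b _) => //; rewrite (perm_mem p).
Qed.

Lemma vwin_all Phi n mine us e : uniq us -> size us = n ->
  (forall e', agree us e e' -> Phi e') -> vwin Phi n mine us e.
Proof.
elim: n mine us e => [|n IH] mine us e u sz h /=; first exact: h.
have w mine' i b : i \in us -> vwin Phi n mine' (rem i us) (upd e i b).
  move=> hi; apply: IH; [exact: rem_uniq|by rewrite size_rem // sz|].
  by move=> e' /(agree_upd u hi)[/h].
case: mine => [|i b hi]; last exact: w.
case: us u sz h w => // i us u sz h w; exists i, true; split; first exact: mem_head.
by apply: w; apply: mem_head.
Qed.

Lemma vwin_end Phi n mine us e : uniq us -> size us = n -> vwin Phi n mine us e ->
  exists2 e', agree us e e' & Phi e'.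
Proof.
elim: n mine us e => [|n IH] mine us e u sz /=; first by exists e.
have go mine' i b : i \in us -> vwin Phi n mine' (rem i us) (upd e i b) ->
    exists2 e', agree us e e' & Phi e'.
  move=> hi /IH; rewrite rem_uniq // size_rem // sz => /(_ erefl erefl) [e' h1 h2].
  by exists e' => //; have [] := agree_upd u hi h1.
case: mine => [[i [b [hi w]]]|w]; first exact: go hi w.
case: us u sz w go => // i us u sz w go.
exact: go (mem_head _ _) (w i true (mem_head _ _)).
Qed.

Definition insensitive (Phi : (nat -> bool) -> Prop) (L : seq nat) :=
  forall e e' : nat -> bool, agree L e e' -> Phi e -> Phi e'.

Lemma vwin_insensitive Phi L n mine us e e' : insensitive Phi L ->
  (forall i, i \in L -> i \notin us) -> uniq us ->
  agree L e e' -> vwin Phi n mine us e -> vwin Phi n mine us e'.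
Proof.
move=> ins; elim: n mine us e e' => [|n IH] mine us e e' dis u ag /=; first exact: ins.
have step mine' i b : i \in us -> vwin Phi n mine' (rem i us) (upd e i b) ->
    vwin Phi n mine' (rem i us) (upd e' i b).
  move=> hi; apply: IH; last 1 first.
  - by move=> j hj; rewrite /upd; case: eqP => // _; apply: ag.
  - by move=> j /dis; rewrite mem_rem_uniq // inE negb_and => ->; rewrite orbT.
  exact: rem_uniq.
case: mine => [[i [b [hi w]]]|w i b hi].
  by exists i, b; split=> //; apply: step.
by apply: step => //; apply: w.
Qed.

(* The player moving last may answer [i] by [j] and vice versa. *)
Lemma vwin_pair Phi Psi i j us e : uniq (i :: j :: us) ->
  insensitive Psi [:: i; j] ->
  (forall e', e' i = ~~ e' j -> Psi e' -> Phi e') ->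
  vwin Psi (size us) (odd (size us)) us e ->
  vwin Phi (size us).+2 (odd (size us)) [:: i, j & us] e.
Proof.
move=> + ins hPP; have [n hn] := ubnP (size us).
elim: n us e hn => // n IH us e hn u w.
have [nij niu nju uu] : [/\ i != j, i \notin us, j \notin us & uniq us].
  by move: u; rewrite /= inE negb_or => /and3P[/andP[-> ->] -> ->].
have dis k : k \in [:: i; j] -> k \notin us.
  by rewrite !inE => /orP[]/eqP->.
case E : (odd (size us)) w => w.
  have [m sz] : exists m, size us = m.+1 by move: E; case: (size us) => // m; exists m.
  rewrite sz in w E hn *; case: w => [k [b [hk w]]].
  have nki : k != i by apply: contraNneq niu => <-.
  have nkj : k != j by apply: contraNneq nju => <-.
  exists k, b; split; first by rewrite !in_cons hk !orbT.
  have sr : size (rem k us) = m by rewrite size_rem // sz.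
  have -> : rem k [:: i, j & us] = [:: i, j & rem k us].
    by rewrite /= ![_ == k]eq_sym (negbTE nki) (negbTE nkj).
  have ur : uniq [:: i, j & rem k us].
    by apply: subseq_uniq u; rewrite /= !eqxx rem_subseq.
  have ev : odd (size (rem k us)) = false by rewrite sr; move: E => /= /negbTE.
  by have := IH (rem k us) (upd e k b) _ ur; rewrite ev sr; apply.
move=> k b; rewrite !inE => /or3P[/eqP->|/eqP->|hk].
- exists j, (~~ b); split; first by rewrite /= eqxx mem_head.
  have -> : rem j (rem i [:: i, j & us]) = us by rewrite /= eqxx /= eqxx.
  apply: (vwin_mono (Phi := Psi)) => //.
    move=> e' ag; apply: hPP; rewrite !ag // /upd eqxx (negbTE nij) eqxx negbK //.
  apply: (vwin_insensitive ins) w => //.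
  by move=> k'; rewrite !inE negb_or /upd => /andP[/negbTE-> /negbTE->].
- exists i, (~~ b); split; first by rewrite /= (negbTE nij) mem_head.
  have -> : rem i (rem j [:: i, j & us]) = us by rewrite /= (negbTE nij) eqxx /= eqxx.
  apply: (vwin_mono (Phi := Psi)) => //.
    by move=> e' ag; apply: hPP; rewrite !ag // /upd eqxx [j == i]eq_sym (negbTE nij) eqxx.
  apply: (vwin_insensitive ins) w => //.
  by move=> k'; rewrite !inE negb_or /upd => /andP[/negbTE-> /negbTE->].
have nki : k != i by apply: contraNneq niu => <-.
have nkj : k != j by apply: contraNneq nju => <-.
have [m sz] : exists m, size us = m.+1 by case: (us) hk => // a us' _; exists (size us').
rewrite sz in w E *; have {}w := w k b hk.
have -> : rem k [:: i, j & us] = [:: i, j & rem k us].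
  by rewrite /= ![_ == k]eq_sym (negbTE nki) (negbTE nkj).
have ur : uniq [:: i, j & rem k us].
  by apply: subseq_uniq u; rewrite /= !eqxx rem_subseq.
have sr : size (rem k us) = m by rewrite size_rem // sz.
have ev : odd (size (rem k us)) = true by rewrite sr; move: E => /= /negbFE.
have := IH (rem k us) (upd e k b) _ ur; rewrite ev sr; apply=> //.
by rewrite -ltnS -sz.
Qed.

Definition sg (b : bool) : int := if b then 1%R else (-1)%R.

Definition net (e : nat -> bool) (u : seq nat) : int := (\sum_(i <- u) sg (e i))%R.

(* A position: free variables without effect, and the twist blocks, each with
   the sum of its resolved crossings and its unresolved ones. *)
Definition blocks := seq (int * seq nat).

Definition vals e (pl : blocks) : seq int := [seq (z.1 + net e z.2)%R | z <- pl].

Definition free_vars (ts : seq nat) (pl : blocks) := ts ++ flatten (map snd pl).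

(** Resolved crossings are recorded in the block sums, so the assignment [e] made so far has no
    influence. *)
Definition PW (G : seq int -> Prop) mine ts pl := forall e,
  vwin (fun e => G (vals e pl)) (size (free_vars ts pl)) mine (free_vars ts pl) e.

Lemma net_cons e i u : net e (i :: u) = (sg (e i) + net e u)%R.
Proof. by rewrite /net big_cons. Qed.

Lemma net_nil e : net e [::] = 0%R.
Proof. by rewrite /net big_nil. Qed.

Lemma net_cat e u v : net e (u ++ v) = (net e u + net e v)%R.
Proof. by rewrite /net big_cat. Qed.

Lemma net_perm e u v : perm_eq u v -> net e u = net e v.
Proof. by move=> p; apply: perm_big. Qed.

Lemma net_rem e i u : i \in u -> net e u = (sg (e i) + net e (rem i u))%R.
Proof. by move=> hi; rewrite -net_cons; apply/net_perm/perm_to_rem. Qed.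

Lemma vals_cat e l r : vals e (l ++ r) = vals e l ++ vals e r.
Proof. exact: map_cat. Qed.

Lemma free_cat ts l z u r : perm_eq (free_vars ts (l ++ (z, u) :: r)) (u ++ free_vars ts (l ++ r)).
Proof.
rewrite /free_vars !map_cat /= !flatten_cat /=; apply/permP => f; rewrite !count_cat; lia.
Qed.

Lemma PW_map (G G' : seq int -> Prop) mine ts pl ts' pl' : uniq (free_vars ts pl) ->
  perm_eq (free_vars ts pl) (free_vars ts' pl') -> (forall e, G (vals e pl) -> G' (vals e pl')) ->
  PW G mine ts pl -> PW G' mine ts' pl'.
Proof.
move=> u p h w e; rewrite -(perm_size p); apply: (vwin_perm p).
by apply: vwin_mono (w e) => // e' _; apply: h.
Qed.

Lemma PW_end (G : seq int -> Prop) mine ts pl : uniq (free_vars ts pl) ->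
  (forall e, G (vals e pl)) -> PW G mine ts pl.
Proof. by move=> u h e; apply: vwin_all. Qed.

Lemma vals_move e l z u r i : i \in u ->
  vals e (l ++ (z, u) :: r) = vals e (l ++ ((z + sg (e i))%R, rem i u) :: r).
Proof. by move=> hi; rewrite !vals_cat /= (net_rem e hi) addrA. Qed.

Lemma rem_free ts l z z' u r i : uniq (free_vars ts (l ++ (z, u) :: r)) -> i \in u ->
  perm_eq (rem i (free_vars ts (l ++ (z, u) :: r))) (free_vars ts (l ++ (z', rem i u) :: r)).
Proof.
move=> hu hi; have hf : i \in free_vars ts (l ++ (z, u) :: r).
  by rewrite (perm_mem (free_cat _ _ _ _ _)) mem_cat hi.
rewrite -(perm_cons i) perm_sym; apply: perm_trans (perm_to_rem hf).
apply: perm_trans (_ : perm_eq _ (i :: rem i u ++ free_vars ts (l ++ r))) _.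
  by rewrite perm_cons; apply: free_cat.
rewrite perm_sym; apply: (perm_trans (free_cat _ _ _ _ _)).
by rewrite -cat_cons perm_cat2r perm_to_rem.
Qed.

Lemma move_vwin G mine ts l z u r i b e n : uniq (free_vars ts (l ++ (z, u) :: r)) -> i \in u ->
  size (free_vars ts (l ++ (z, u) :: r)) = n.+1 ->
  PW G mine ts (l ++ ((z + sg b)%R, rem i u) :: r) ->
  vwin (fun e => G (vals e (l ++ (z, u) :: r))) n mine
       (rem i (free_vars ts (l ++ (z, u) :: r))) (upd e i b).
Proof.
move=> hu hi hn w; have p := rem_free (z + sg b)%R hu hi.
have hf : i \in free_vars ts (l ++ (z, u) :: r).
  by rewrite (perm_mem (free_cat _ _ _ _ _)) mem_cat hi.
have sz : size (free_vars ts (l ++ ((z + sg b)%R, rem i u) :: r)) = n.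
  by rewrite -(perm_size p) size_rem // hn.
have := w (upd e i b); rewrite sz => h.
rewrite perm_sym in p; have {}h := vwin_perm p h.
apply: vwin_mono h; first exact: rem_uniq.
move=> e' /(agree_upd hu hf)[_ eb]; rewrite (vals_move e' l z r hi) eb //.
Qed.

Lemma free_size1 ts pl i : i \in free_vars ts pl -> exists n, size (free_vars ts pl) = n.+1.
Proof. by case: (free_vars ts pl) => // a s _; exists (size s). Qed.

Lemma in_free ts l z u r i : i \in u -> i \in free_vars ts (l ++ (z, u) :: r).
Proof. by move=> hi; rewrite (perm_mem (free_cat _ _ _ _ _)) mem_cat hi. Qed.

Lemma PW_own G ts l z u r i b : uniq (free_vars ts (l ++ (z, u) :: r)) -> i \in u ->
  PW G false ts (l ++ ((z + sg b)%R, rem i u) :: r) -> PW G true ts (l ++ (z, u) :: r).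
Proof.
move=> hu hi w e; have [n sz] := free_size1 (in_free ts l z r hi).
rewrite sz /=; exists i, b; split; first exact: in_free.
exact: move_vwin.
Qed.

Lemma rem_ts ts pl i : i \in ts -> rem i (free_vars ts pl) = free_vars (rem i ts) pl.
Proof.
rewrite /free_vars => hi; elim: ts hi => //= a ts IH; rewrite inE [i == a]eq_sym.
by case: eqP => //= _ /IH ->.
Qed.

Lemma tempo_vwin G mine ts pl i b e n : i \in ts -> size (free_vars ts pl) = n.+1 ->
  PW G mine (rem i ts) pl ->
  vwin (fun e => G (vals e pl)) n mine (rem i (free_vars ts pl)) (upd e i b).
Proof.
move=> hi sz w; have := w (upd e i b); rewrite -rem_ts // size_rem ?sz //.
by rewrite mem_cat hi.
Qed.

Lemma PW_own_tempo G ts pl i : i \in ts ->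
  PW G false (rem i ts) pl -> PW G true ts pl.
Proof.
move=> hi w e; have hf : i \in free_vars ts pl by rewrite mem_cat hi.
have [n sz] := free_size1 hf; rewrite sz /=; exists i, true; split=> //.
exact: tempo_vwin.
Qed.

Lemma mem_blocks i (pl : blocks) : i \in flatten (map snd pl) ->
  exists l z u r, pl = l ++ (z, u) :: r /\ i \in u.
Proof.
case/flattenP => u /mapP[[z u'] h ->] hi.
by case/splitPr: h => l r; exists l, z, u', r.
Qed.

Lemma PW_opp G ts pl : uniq (free_vars ts pl) -> free_vars ts pl != [::] ->
  (forall i, i \in ts -> PW G true (rem i ts) pl) ->
  (forall l z u r i b, pl = l ++ (z, u) :: r -> i \in u ->
     PW G true ts (l ++ ((z + sg b)%R, rem i u) :: r)) ->
  PW G false ts pl.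
Proof.
move=> hu ne h1 h2 e; have [n sz] : exists n, size (free_vars ts pl) = n.+1.
  by move: ne; case: (free_vars ts pl) => // a s _; exists (size s).
rewrite sz /= => i b; rewrite mem_cat => /orP[hi|/mem_blocks[l [z [u [r [epl hi]]]]]].
  by apply: tempo_vwin => //; apply: h1.
by rewrite epl in hu sz *; apply: move_vwin => //; apply: h2.
Qed.

(** A player makes the last move if it is that player's turn exactly when the number of free
    variables is odd. *)
Definition last_mover ts pl := odd (size (free_vars ts pl)).

Lemma PW_pair G ts l z u r i j : uniq (free_vars ts (l ++ (z, [:: i, j & u]) :: r)) ->
  PW G (last_mover ts (l ++ (z, u) :: r)) ts (l ++ (z, u) :: r) ->
  PW G (last_mover ts (l ++ (z, [:: i, j & u]) :: r)) ts (l ++ (z, [:: i, j & u]) :: r).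
Proof.
move=> hu w e; rewrite /last_mover.
have p : perm_eq [:: i, j & free_vars ts (l ++ (z, u) :: r)] (free_vars ts (l ++ (z, [:: i, j & u]) :: r)).
  rewrite perm_sym; apply: (perm_trans (free_cat _ _ _ _ _)).
  by rewrite /= !perm_cons perm_sym free_cat.
have o2 n : odd n.+2 = odd n by rewrite /= negbK.
have sz : size (free_vars ts (l ++ (z, [:: i, j & u]) :: r)) = (size (free_vars ts (l ++ (z, u) :: r))).+2.
  by rewrite -(perm_size p).
rewrite sz o2; apply: (vwin_perm p).
apply: vwin_pair (w e); first by rewrite (perm_uniq p).
  move=> e1 e2 ag; suff -> : vals e2 (l ++ (z, u) :: r) = vals e1 (l ++ (z, u) :: r) by [].
  have nin k : k \in free_vars ts (l ++ (z, u) :: r) -> e2 k = e1 k.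
    move=> hk; apply: ag; have := hu; rewrite -(perm_uniq p) /= inE negb_or -andbA !inE.
    by case/and4P=> _ h1 h2 _; rewrite negb_or; apply/andP; split; [move: h1|move: h2]; apply: contraNneq => <-.
  apply/eq_in_map => -[z' u'] hz /=; congr (_ + _)%R; apply: eq_big_seq => k hk.
  rewrite nin // mem_cat; apply/orP; right; apply/flattenP; exists u' => //.
  by apply/mapP; exists (z', u').
move=> e' eij; rewrite !vals_cat /= !net_cons eij => h; move: h.
suff -> : (z + (sg (~~ e' j) + (sg (e' j) + net e' u)) = z + net e' u)%R by [].
by case: (e' j); rewrite /sg /= ?addrA; lia.
Qed.

Lemma PW_tempo2 G ts pl i j : uniq (free_vars [:: i, j & ts] pl) ->
  PW G (last_mover ts pl) ts pl -> PW G (last_mover [:: i, j & ts] pl) [:: i, j & ts] pl.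
Proof.
move=> hu w e; rewrite /last_mover.
have o2 n : odd n.+2 = odd n by rewrite /= negbK.
rewrite -[size _]/(size (free_vars ts pl)).+2 -[X in odd X]/(size (free_vars ts pl)).+2 o2.
apply: vwin_pair (w e) => // e1 e2 ag.
suff -> : vals e2 pl = vals e1 pl by [].
apply/eq_in_map => -[z' u'] hz /=; congr (_ + _)%R; apply: eq_big_seq => k hk.
have hf : k \in free_vars ts pl.
  rewrite mem_cat; apply/orP; right; apply/flattenP; exists u' => //.
  by apply/mapP; exists (z', u').
rewrite ag //; move: hu; rewrite /= inE negb_or -andbA !inE => /and4P[_ h1 h2 _].
by rewrite negb_or; apply/andP; split; [move: h1|move: h2]; apply: contraNneq => <-.
Qed.

(** * Winning for the player who moves last *)

Definition start (pl : blocks) := all (fun z => z.1 == 0%R) pl.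

Definition W (G : seq int -> Prop) k (a : seq nat) := forall ts pl,
  uniq (free_vars ts pl) -> size ts = k -> map (fun z => size z.2) pl = a -> start pl ->
  PW G (last_mover ts pl) ts pl.

Lemma W_tempo2 G k a : W G k a -> W G k.+2 a.
Proof.
move=> h [|i [|j ts]] pl hu //= [sz] ea st; apply: PW_tempo2 => //.
by apply: h => //; move: hu; rewrite /= => /and3P[].
Qed.

Lemma map_cat_cons (T T' : Type) (f : T -> T') s l x r : map f s = l ++ x :: r ->
  exists l' y r', [/\ s = l' ++ y :: r', map f l' = l, f y = x & map f r' = r].
Proof.
elim: l s => [|a l IH] [|b s] //= [<- h]; first by exists [::], b, s.
by have [l' [y [r' [-> <- <- <-]]]] := IH _ h; exists (b :: l'), y, r'.
Qed.

Lemma start_cat l r : start (l ++ r) = start l && start r.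
Proof. exact: all_cat. Qed.

Lemma uniq_pair ts l z u r i j : uniq (free_vars ts (l ++ (z, [:: i, j & u]) :: r)) ->
  uniq (free_vars ts (l ++ (z, u) :: r)).
Proof.
rewrite (perm_uniq (free_cat _ _ _ _ _)) => h.
by rewrite (perm_uniq (free_cat _ _ _ _ _)); move: h => /= /and3P[].
Qed.

Lemma W_pair G k l x r : W G k (l ++ x :: r) -> W G k (l ++ x.+2 :: r).
Proof.
move=> h ts pl hu sz ea st.
have [l' [[z u0] [r' [epl el ex er]]]] := map_cat_cons ea.
case: u0 ex epl => [|i [|j u]] //= [ex] epl.
rewrite {}epl in hu st *; apply: PW_pair => //; apply: h => //; first exact: uniq_pair hu.
  by rewrite map_cat /= el ex er.
by rewrite !start_cat /= in st *.
Qed.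

Lemma W_map (G G' : seq int -> Prop) k a k' a' :
  (forall ts' pl', uniq (free_vars ts' pl') -> size ts' = k' -> map (fun z => size z.2) pl' = a' -> start pl' ->
    exists ts pl, [/\ perm_eq (free_vars ts' pl') (free_vars ts pl), size ts = k,
      map (fun z => size z.2) pl = a, start pl &
      forall e, G (vals e pl) -> G' (vals e pl')]) ->
  W G k a -> W G' k' a'.
Proof.
move=> h w ts' pl' hu sz ea st; have [ts [pl [p sz' ea' st' hG]]] := h _ _ hu sz ea st.
rewrite /last_mover (perm_size p) -/(last_mover ts pl).
have hu' : uniq (free_vars ts pl) by rewrite -(perm_uniq p).
by apply: PW_map (w ts pl hu' sz' ea' st') => //; rewrite perm_sym.
Qed.

Lemma free_rcons ts pl z : free_vars ts (rcons pl z) = free_vars ts pl ++ z.2.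
Proof. by rewrite /free_vars map_rcons flatten_rcons catA. Qed.

Lemma map_rcons_inv (T T' : Type) (f : T -> T') s l x : map f s = rcons l x ->
  exists l' y, [/\ s = rcons l' y, map f l' = l & f y = x].
Proof.
case/lastP: s => [|s y]; first by case: l.
by rewrite map_rcons => /rcons_inj[<- <-]; exists s, y.
Qed.

Lemma start_rcons pl z : start (rcons pl z) = start pl && (z.1 == 0%R).
Proof. by rewrite /start all_rcons andbC. Qed.

Lemma vals_rcons e pl z : vals e (rcons pl z) = rcons (vals e pl) (z.1 + net e z.2)%R.
Proof. exact: map_rcons. Qed.

(** If an empty last block makes [G] independent of the block before it, the crossings there have no
    effect and count as tempo moves. *)
Lemma W_tail0 (G : seq int -> Prop) k a x : (forall l y, G l -> G (rcons (rcons l y) 0%R)) ->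
  W G (k + x) a -> W G k (rcons (rcons a x) 0).
Proof.
move=> hG; apply: W_map => ts pl' hu sz ea'.
have [pl1 [[z0 u0] [-> ea1 /= /size0nil su0]]] := map_rcons_inv ea'.
have [pl [[z u] [-> ea /= su]]] := map_rcons_inv ea1.
rewrite !start_rcons /= => /andP[/andP[st /eqP ez] /eqP ez0].
exists (ts ++ u), pl; split=> //.
- rewrite !free_rcons /= su0 cats0 /free_vars; apply/permP => f; rewrite !count_cat; lia.
- by rewrite size_cat sz su.
by move=> e h; rewrite !vals_rcons /= su0 net_nil ez0 addr0; apply: hG.
Qed.

(** Whatever sign the last crossing receives, it acts on [G] like one more crossing of the block
    before. *)
Lemma W_tail1 (G : seq int -> Prop) k a x :
  (forall l y b, G (rcons l (y + sg b)%R) -> G (rcons (rcons l y) (sg b))) ->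
  W G k (rcons a x.+1) -> W G k (rcons (rcons a x) 1).
Proof.
move=> hG; apply: W_map => ts pl' hu sz ea'.
have [pl1 [[z0 u0] [-> ea1 /= su0]]] := map_rcons_inv ea'.
have [pl [[z u] [-> ea /= su]]] := map_rcons_inv ea1.
case: u0 su0 => [|i [|]] // _.
rewrite !start_rcons /= => /andP[/andP[st /eqP ez] /eqP ez0].
exists ts, (rcons pl (z, rcons u i)); split=> //.
- by rewrite !free_rcons /= -cats1 !catA.
- by rewrite map_rcons /= ea size_rcons su.
- by rewrite start_rcons st ez eqxx.
move=> e; rewrite !vals_rcons /= ez0 -(cats1 u i) net_cat !net_cons !net_nil !addr0 add0r addrA.
exact: hG.
Qed.

Lemma W_rev (G : seq int -> Prop) k a : (forall l, G (rev l) -> G l) ->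
  W G k (rev a) -> W G k a.
Proof.
move=> hG; apply: W_map => ts pl hu sz ea st; exists ts, (rev pl); split=> //.
- rewrite /free_vars perm_cat2l; apply: perm_flatten; apply: perm_map.
  by rewrite perm_sym perm_rev.
- by rewrite map_rev ea.
- by rewrite /start all_rev.
by move=> e; rewrite /vals map_rev; apply: hG.
Qed.

Lemma W_mid0 (G : seq int -> Prop) k l x y r :
  (forall l' r' x' y', G (l' ++ (x' + y')%R :: r') -> G (l' ++ [:: x', 0%R, y' & r'])) ->
  W G k (l ++ (x + y) :: r) -> W G k (l ++ [:: x, 0, y & r]).
Proof.
move=> hG; apply: W_map => ts pl hu sz ea st.
have [l' [[z u] [r' [epl el /= eu er]]]] := map_cat_cons ea.
case: r' epl er => [|[z0 u0] [|[z1 u1] r']] //= epl [/size0nil e0 e1 er].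
rewrite epl in hu st *; move: st; rewrite start_cat /= => /and5P[sl /eqP ez /eqP ez0 /eqP ez1 sr].
exists ts, (l' ++ (0%R, u ++ u1) :: r'); split=> //.
- by rewrite e0 /free_vars !map_cat /= !flatten_cat /= !catA.
- by rewrite map_cat /= el er size_cat eu e1.
- by rewrite start_cat /= sl.
move=> e; rewrite !vals_cat /= e0 net_nil ez ez0 ez1 !add0r net_cat; exact: hG.
Qed.

(** * From the abstract game to rational shadows *)

Definition block_word (bs : seq (seq (option bool))) : word :=
  flatten [seq None :: map Some b | b <- bs].

Lemma block_word_rcons bs b : block_word (rcons bs b) = rcons (block_word bs) None ++ map Some b.
Proof. by rewrite /block_word map_rcons flatten_rcons -cats1 -catA. Qed.

Lemma tangle_cat w w' : tangle_word (w ++ w') = foldl apply_op (tangle_word w) w'.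
Proof. exact: foldl_cat. Qed.

Lemma rational_shadow_word bs : all (all (fun s => s == None)) bs ->
  rational_shadow (map size bs) = N (block_word bs).
Proof.
move=> h; rewrite /rational_shadow /N; congr tangle_closure.
elim/last_ind: bs h => [|bs b IH] //; rewrite all_rcons => /andP[hb /IH {}IH].
rewrite block_word_rcons tangle_cat tangle_rcons map_rcons /rational_tangle foldl_rcons.
rewrite -/(rational_tangle _) IH /=; move: (Defs.reflect _) => t.
elim: b t hb => //= s b IHb t /andP[/eqP-> hb]; rewrite -IHb //.
by elim: (size b) => //= n <-.
Qed.

(** Labels and the order of crossings depend only on where the twists stand in the word, so a move
    of the game is a change in the list of states. That list is reversed because each twist puts its
    crossing in front. *)
Lemma tangle_states (sh : seq bool) : exists n1 n2 n3 n4 ts, size ts = count id sh /\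
  forall w : word, map isSome w = sh ->
    tangle_word w = Tangle n1 n2 n3 n4 (zip (rev (pmap id w)) ts).
Proof.
elim/last_ind: sh => [|sh b [n1 [n2 [n3 [n4 [ts [sz h]]]]]]].
  by exists 0, 1, 0, 1, [::]; split=> // -[].
have inv w : map isSome w = rcons sh b -> exists w0 o,
    [/\ w = rcons w0 o, map isSome w0 = sh, isSome o = b & size (pmap id w0) = size ts].
  move=> ew; have [w0 [o [-> e eb]]] := map_rcons_inv ew; exists w0, o; split=> //.
  by rewrite size_pmap sz -e count_map.
have pr w o : rev (pmap id (rcons w o)) = (if o is Some s then [:: s] else [::]) ++ rev (pmap id w).
  by rewrite -cats1 pmap_cat rev_cat; case: o.
case: b inv => inv.
  exists n1, (2 * size ts + 2), n3, (2 * size ts + 3),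
    ([tuple 2 * size ts + 2; n2; n4; 2 * size ts + 3] :: ts); split.
    by rewrite -cats1 count_cat /= sz addn1.
  move=> w /inv[w0 [[s|] [-> e eo sw]]] //; rewrite tangle_rcons pr (h _ e) /= /tw /=.
  by rewrite size_zip size_rev sw minnn.
exists n1, n3, n2, n4, [seq [tuple of rot 3 (rev t)] | t : 4.-tuple nat <- ts]; split.
  by rewrite size_map -cats1 count_cat sz /= !addn0.
move=> w /inv[w0 [[s|] [-> e eo sw]]] //; rewrite tangle_rcons pr (h _ e) /Defs.reflect /=.
congr Tangle; elim: (rev _) (ts) => [|s ss IH] [|t ts'] //=; by rewrite IH.
Qed.

Definition with_states (st : nat -> option bool) (bl : seq (seq nat)) :=
  block_word (map (map st) bl).

Lemma shape_with_states st bl :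
  map isSome (with_states st bl) = flatten [seq false :: nseq (size b) true | b <- bl].
Proof.
rewrite /with_states /block_word map_flatten -!map_comp; congr flatten.
by apply: eq_map => b /=; congr cons; elim: b => //= i b ->.
Qed.

Lemma pmap_with_states st bl : pmap id (with_states st bl) = map st (flatten bl).
Proof.
elim: bl => // b bl IH; rewrite /with_states /block_word /= pmap_cat map_cat.
by congr cat => //; elim: b => //= i b ->.
Qed.

Lemma N_with_states bl : exists l ts, size ts = size (flatten bl) /\
  forall st, N (with_states st bl) = PD l (zip (map st (rev (flatten bl))) ts).
Proof.
have [n1 [n2 [n3 [n4 [ts [sz h]]]]]] := tangle_states (flatten [seq false :: nseq (size b) true | b <- bl]).
pose ps := [:: (n1, n2); (n3, n4)].
exists (nloops id ps), [seq [tuple of map (fm id ps) t] | t : 4.-tuple nat <- ts]; split.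
  rewrite size_map sz -(shape_with_states (fun=> None)) -(size_map (fun=> None : option bool) (flatten bl)).
  by rewrite -pmap_with_states size_pmap count_map.
move=> st; rewrite /N (h _ (shape_with_states st bl)) /tangle_closure /= -/ps.
rewrite -[LHS]/(fuse id ps _) fuse_fm add0n pmap_with_states -map_rev; congr PD.
by elim: (map st _) (ts) => [|s ss IH] [|t ts'] //=; rewrite IH.
Qed.

Definition states (us : seq nat) (e : nat -> bool) i : option bool :=
  if i \in us then None else Some (e i).

Lemma eq_with_states st st' bl : {in flatten bl, st =1 st'} ->
  N (with_states st bl) = N (with_states st' bl).
Proof.
have [l [ts [_ E]]] := N_with_states bl; move=> h; rewrite !E; congr (PD _ (zip _ _)).
by apply/eq_in_map => i; rewrite mem_rev; apply: h.
Qed.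

Lemma unresolved_with_states st bl n : unresolved (N (with_states st bl)) n ->
  exists2 i, i \in flatten bl & st i = None /\ (uniq (flatten bl) -> forall o,
    resolve (N (with_states st bl)) n o = N (with_states (upd st i (Some o)) bl)).
Proof.
have [l [ts [sz E]]] := N_with_states bl; set ids := rev (flatten bl) in E *.
rewrite !E /unresolved /num_crossings /= size_zip size_map.
have szi : size ids = size ts by rewrite size_rev.
rewrite szi minnn => /andP[hn]; rewrite nth_zip ?size_map // (nth_map 0) ?szi //= => /eqP e.
exists (nth 0 ids n); first by rewrite -mem_rev mem_nth // szi.
split=> // u o; rewrite E /resolve /=; congr PD.
have ui : uniq ids by rewrite rev_uniq.
have szz f : size (zip (map f ids) ts) = size ts by rewrite size_zip size_map szi minnn.
apply: (@eq_from_nth _ default_crossing); first by rewrite size_set_nth !szz; apply/maxn_idPr.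
move=> k; rewrite size_set_nth szz (maxn_idPr _) // => hk; rewrite nth_set_nth /=.
rewrite !nth_zip ?size_map // !(nth_map 0) ?szi //=; rewrite /upd nth_uniq ?szi //.
by case: eqP => [->|].
Qed.

Lemma resolve_with_states st bl i o : uniq (flatten bl) -> i \in flatten bl -> st i = None ->
  exists2 n, unresolved (N (with_states st bl)) n &
    resolve (N (with_states st bl)) n o = N (with_states (upd st i (Some o)) bl).
Proof.
move=> u hi e; have [l [ts [sz E]]] := N_with_states bl.
have hi' : i \in rev (flatten bl) by rewrite mem_rev.
have hr : unresolved (N (with_states st bl)) (index i (rev (flatten bl))).
  rewrite E /unresolved /num_crossings /= size_zip size_map size_rev sz minnn.
  rewrite -(size_rev (flatten bl)) index_mem hi' /=.
  by rewrite nth_zip ?size_map ?size_rev // (nth_map 0) ?index_mem // nth_index // e.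
exists (index i (rev (flatten bl))) => //.
rewrite !E /resolve /=; congr PD; set ids := rev _ in hi' *.
have szi : size ids = size ts by rewrite size_rev.
have szz f : size (zip (map f ids) ts) = size ts by rewrite size_zip size_map szi minnn.
have hx : index i ids < size ts by rewrite -szi index_mem.
apply: (@eq_from_nth _ default_crossing); first by rewrite size_set_nth !szz; apply/maxn_idPr.
move=> k; rewrite size_set_nth szz (maxn_idPr _) // => hk; rewrite nth_set_nth /=.
rewrite !nth_zip ?size_map // !(nth_map 0) ?szi //=; rewrite /upd.
have -> : (nth 0 ids k == i) = (k == index i ids).
  by rewrite -{1}(nth_index 0 hi') nth_uniq ?szi // rev_uniq.
by case: eqP => [->|].
Qed.

Section Link.
Variables (p : player) (bl : seq (seq nat)) (Phi : (nat -> bool) -> Prop).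
Hypothesis (ubl : uniq (flatten bl)).
Hypothesis PhiP : forall e, Phi e -> final_win p (N (with_states (Some \o e) bl)).

Definition tempos (us : seq nat) := count [pred i | i \notin flatten bl] us.

Lemma states_upd us e i o : uniq us -> i \in us ->
  N (with_states (upd (states us e) i (Some o)) bl) = N (with_states (states (rem i us) (upd e i o)) bl).
Proof.
move=> u hi; apply: eq_with_states => j _; rewrite /upd /states mem_rem_uniq // inE.
by case: (j == i).
Qed.

Lemma tempos_rem us i : i \in us -> tempos us = (i \notin flatten bl) + tempos (rem i us).
Proof. by move=> hi; rewrite /tempos (permP (perm_to_rem hi)). Qed.

(** Variables outside the blocks belong to no crossing; choosing one of them is a tempo move. *)
Lemma vwin_twins n mine us e : uniq us -> size us = n -> vwin Phi n mine us e ->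
  twins p (tempos us) (if mine then p else opponent p) (N (with_states (states us e) bl)).
Proof.
elim: n mine us e => [|n IH] mine us e u sz w.
  have [e' ag he'] := vwin_end u sz w; apply: twins_final.
    move=> i; apply/negP => /unresolved_with_states[j _ [+ _]].
    by rewrite (size0nil sz).
  rewrite (@eq_with_states _ (Some \o e')); first exact: PhiP.
  by move=> i _; rewrite /states (size0nil sz) /= ag ?(size0nil sz).
(* Once all crossings are resolved the game on the diagram is over, although tempo variables may be
   left. The outcome is read off from any end of the abstract game, since those variables do not
   affect the diagram. *)
have [/hasP[i0 i0u i0b]|/hasPn no] := boolP (has (mem (flatten bl)) us); last first.
  have [e' ag he'] := vwin_end u sz w.
  have nou i : i \in flatten bl -> i \notin us by move=> hi; apply/negP => /no; rewrite /= hi.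
  apply: twins_final.
    move=> i; apply/negP => /unresolved_with_states[j /nou hj [+ _]].
    by rewrite /states (negbTE hj).
  rewrite (@eq_with_states _ (Some \o e')); first exact: PhiP.
  by move=> i /nou hi; rewrite /states (negbTE hi) /= ag.
case: mine w => [[i [b [hi w]]]|w].
  have {}IH : twins p (tempos (rem i us)) (opponent p) (N (with_states (states (rem i us) (upd e i b)) bl)).
    by apply: (IH false) => //; [exact: rem_uniq|rewrite size_rem // sz].
  rewrite (tempos_rem hi); case: (boolP (i \in flatten bl)) => hb.
    have [k hk ek] := resolve_with_states (st := states us e) b ubl hb (ifT _ _ hi).
    by apply: (twins_own (o := b) hk); rewrite ek states_upd.
  apply: twins_own_tempo; rewrite (@eq_with_states _ (states (rem i us) (upd e i b))) // => j hj.
  have nji : j != i by apply: contraNneq hb => <-.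
  by rewrite /states mem_rem_uniq // inE nji /upd (negbTE nji).
have step i b : i \in us -> twins p (tempos (rem i us)) p (N (with_states (states (rem i us) (upd e i b)) bl)).
  by move=> hi; apply: (IH true); [exact: rem_uniq|rewrite size_rem // sz|exact: w].
apply: twins_opponent.
- have [k hk _] := resolve_with_states (st := states us e) true ubl i0b (ifT _ _ i0u).
  by exists k.
- move=> k o /unresolved_with_states[i hb [hs ek]]; rewrite ek //.
  have hi : i \in us by move: hs; rewrite /states; case: ifP.
  by rewrite states_upd //; move: (step i o hi); rewrite (tempos_rem hi) hb add0n.
move=> k ek; have : 0 < tempos us by rewrite ek.
rewrite -has_count => /hasP[i hi /= hb].
have := step i true hi; move: ek; rewrite (tempos_rem hi) hb /= add1n => -[->].
congr twins; apply: eq_with_states => j hj.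
have nji : j != i by apply: contraNneq hb => <-.
by rewrite /states mem_rem_uniq // inE nji /upd (negbTE nji).
Qed.

End Link.

Definition blocks_of (bl : seq (seq nat)) : blocks := map (pair 0%R) bl.

Lemma rational_shadow_states a : exists bl, [/\ uniq (flatten bl), map size bl = a,
  forall i, i \in flatten bl -> i < sumn a &
  forall e, rational_shadow a = N (with_states (states (flatten bl) e) bl)].
Proof.
exists (reshape a (iota 0 (sumn a))).
have fl : flatten (reshape a (iota 0 (sumn a))) = iota 0 (sumn a).
  by rewrite reshapeKr // size_iota.
have sh : map size (reshape a (iota 0 (sumn a))) = a.
  by rewrite -[map size _]/(shape _) reshapeKl // size_iota.
split=> //; first by rewrite fl iota_uniq.
  by move=> i; rewrite fl mem_iota.
move=> e; rewrite -rational_shadow_word.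
  by congr rational_shadow; rewrite -[in LHS]sh -map_comp; apply: eq_map => b; rewrite /= size_map.
apply/allP => b /mapP[b0 hb ->]; apply/allP => s /mapP[i hi ->].
rewrite /states ifT //; apply/flattenP; by exists b0.
Qed.

Lemma vals_blocks_of e bl : vals e (blocks_of bl) = map (net e) bl.
Proof. by rewrite /vals -map_comp; apply: eq_map => b; rewrite /= add0r. Qed.

(* The variables with an index beyond the crossings serve as tempo moves. *)
Lemma game_shadow p (G : seq int -> Prop) k m a :
  (forall e bl, map size bl = a -> G (map (net e) bl) ->
     final_win p (N (with_states (Some \o e) bl))) ->
  (forall ts pl, uniq (free_vars ts pl) -> size ts = k -> map (fun z => size z.2) pl = a ->
     start pl -> PW G m ts pl) ->
  twins p k (if m then p else opponent p) (rational_shadow a).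
Proof.
move=> hG w; have [bl [ub sb bb E]] := rational_shadow_states a.
pose ts := iota (sumn a) k; pose pl := blocks_of bl.
have fl : flatten (map snd pl) = flatten bl by rewrite -map_comp map_id.
have nts i : i \in ts -> i \notin flatten bl.
  by rewrite mem_iota => /andP[h _]; apply/negP => /bb; rewrite ltnNge h.
have uf : uniq (free_vars ts pl).
  rewrite /free_vars fl cat_uniq iota_uniq ub andbT /=; apply/hasPn => i hi /=.
  by apply: contraL hi => /nts.
have := w ts pl uf (size_iota _ _).
have -> : map (fun z => size z.2) pl = a by rewrite -map_comp.
have st : start pl by apply/allP => z /mapP[b _ ->] /=.
move=> /(_ erefl st (fun=> true)) h.
have {h} := vwin_twins ub _ uf erefl h.
have -> : tempos bl (free_vars ts pl) = k.
  rewrite /tempos /free_vars fl count_cat [X in _ + X](_ : _ = 0).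
    have /eq_in_count-> : {in ts, [pred i | i \notin flatten bl] =1 predT} by move=> i /nts.
    by rewrite count_predT size_iota addn0.
  by apply/eqP; rewrite -leqn0 leqNgt -has_count; apply/hasPn => i /= ->.
rewrite (E (fun=> true)).
rewrite (@eq_with_states (states (free_vars ts pl) _) (states (flatten bl) (fun=> true))); last first.
  by move=> i hi; rewrite /states hi /free_vars fl mem_cat hi orbT.
by apply=> e; rewrite vals_blocks_of; apply: hG.
Qed.

(** * Continuants *)

(** The action of a reflection followed by [a] half twists on the fraction. Hence [continuant] is
    Euler's continuant, the numerator of a continued fraction. *)
Definition cf_step (u : int * int) (a : int) : int * int := (u.2 + a * u.1, u.1)%R.

Definition cf (l : seq int) := foldl cf_step (1, 0)%R l.

Definition continuant l := (cf l).1.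

Lemma cf_rcons l a : cf (rcons l a) = cf_step (cf l) a.
Proof. exact: foldl_rcons. Qed.

Lemma cf_tail0 l y : cf (rcons (rcons l y) 0%R) = ((cf l).1, (cf (rcons l y)).1)%R.
Proof. by rewrite !cf_rcons /cf_step /= mul0r addr0. Qed.

Lemma continuant_tail0 l y : continuant (rcons (rcons l y) 0%R) = continuant l.
Proof. by rewrite /continuant cf_tail0. Qed.

Lemma continuant_tail1 l y b :
  continuant (rcons (rcons l y) (sg b)) = (sg b * continuant (rcons l (y + sg b)))%R.
Proof. by rewrite /continuant !cf_rcons /cf_step /=; case: b; rewrite /sg; ring. Qed.

(** The form for which each [cf_step] is self-adjoint; this is the reason why continuants are
    invariant under reversal. *)
Definition dot (u v : int * int) : int := (u.1 * v.1 + u.2 * v.2)%R.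

Lemma dot_step u v a : dot (cf_step u a) v = dot u (cf_step v a).
Proof. rewrite /dot /cf_step /=; ring. Qed.

Lemma dot_foldl u v l : dot (foldl cf_step u l) v = dot u (foldl cf_step v (rev l)).
Proof.
elim: l u v => [|a l IH] u v //=; rewrite IH dot_step.
by rewrite rev_cons foldl_rcons.
Qed.

Lemma continuant_rev l : continuant (rev l) = continuant l.
Proof.
have e u : u.1 = dot u (1, 0)%R by rewrite /dot /= mulr1 mulr0 addr0.
rewrite /continuant /cf [RHS]e dot_foldl /dot /=; lia.
Qed.

Lemma continuant_mid0 l r x y :
  continuant (l ++ [:: x, 0, y & r]%R) = continuant (l ++ (x + y)%R :: r).
Proof.
rewrite /continuant /cf !foldl_cat /=; congr (foldl _ _ _).1; rewrite /cf_step /=; congr pair; ring.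
Qed.

Lemma odd_sg b : odd `|sg b|. Proof. by case: b. Qed.

Lemma odd_abszD (m n : int) : odd `|(m + n)%R| = odd `|m| (+) odd `|n|.
Proof. lia. Qed.

Lemma continuant_parity l l' :
  map (fun n : int => odd `|n|) l = map (fun n : int => odd `|n|) l' ->
  odd `|continuant l| = odd `|continuant l'|.
Proof.
have gen u u' : odd `|u.1| = odd `|u'.1| -> odd `|u.2| = odd `|u'.2| ->
    map (fun n : int => odd `|n|) l = map (fun n : int => odd `|n|) l' ->
    odd `|(foldl cf_step u l).1| = odd `|(foldl cf_step u' l').1|.
  elim: l l' u u' => [|a l IH] [|a' l'] // u u' h1 h2 [ea el]; rewrite [foldl _ u _]/= [foldl _ u' _]/=; apply: IH; [|exact: h1|exact: el].
  rewrite /cf_step [_.1]/= [X in _ = odd `|X|]/=.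
  by rewrite (odd_abszD u.2) (odd_abszD u'.2) !abszM !oddM h1 h2 ea.
exact: gen.
Qed.

(** * Resolved rational diagrams up to equivalence *)

Definition bnet (b : seq bool) : int := (\sum_(s <- b) sg s)%R.

Lemma bnet_cons s b : bnet (s :: b) = (sg s + bnet b)%R.
Proof. exact: big_cons. Qed.

Lemma bnet1 s : bnet [:: s] = sg s.
Proof. exact: big_seq1. Qed.

Lemma bnet_cat b b' : bnet (b ++ b') = (bnet b + bnet b')%R.
Proof. exact: big_cat. Qed.

Definition canon (n : int) : seq bool := nseq `|n| (0 < n)%R.

Lemma bnet_canon n : bnet (canon n) = n.
Proof.
rewrite /canon; case: n => [n|n]; last first.
  have -> : (0 < Negz n)%R = false by [].
  rewrite /= NegzE; elim: n => [|n IH]; rewrite [nseq _ _]/= bnet_cons ?IH /sg; last by lia.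
  by rewrite /bnet big_nil.
case: n => [|n]; first by rewrite /bnet big_nil.
elim: n => [|n IH]; first by rewrite /= bnet_cons /bnet big_nil.
rewrite [nseq _ _]/= bnet_cons; move: IH; rewrite /= => ->; rewrite /sg; lia.
Qed.

Definition bool_word (b : seq bool) : word := map (Some \o Some) b.

Definition bword (bs : seq (seq bool)) : word := flatten [seq None :: bool_word b | b <- bs].

Definition cword (l : seq int) : word := bword (map canon l).

Lemma pq_bool_word u b : foldl pq_op u (bool_word b) = (u.1 + bnet b * u.2, u.2)%R.
Proof.
elim: b u => [|s b IH] [p q] /=; first by rewrite /bnet big_nil mul0r addr0.
by rewrite IH bnet_cons; case: s; rewrite /= /sg; congr pair; ring.
Qed.

Lemma pq_bword bs : pq (bword bs) = cf (map bnet bs).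
Proof.
rewrite /pq /cf; elim: bs (1, 0)%R => //= b bs IH u; rewrite /bword /= foldl_cat -/(bword bs).
by rewrite pq_bool_word IH.
Qed.

Lemma par_bword bs : (par (bword bs)).1 = odd `|continuant (map bnet bs)|.
Proof. by rewrite par_pq pq_bword. Qed.

Lemma canon_cons s n : canon (sg s + n)%R = s :: canon n \/ canon n = ~~ s :: canon (sg s + n)%R.
Proof.
rewrite /canon; case: s; rewrite /sg; case: n => [[|n]|[|n]].
- by left.
- by left; have -> : (1 + Posz n.+1 = Posz n.+2)%R by lia.
- by right.
- by right; have -> : (1 + Negz n.+1 = Negz n)%R by lia.
- by left.
- right; have -> : (-1 + Posz n.+1 = Posz n)%R by lia.
  by case: n.
- by left.
by left; have -> : (-1 + Negz n.+1 = Negz n.+2)%R by lia.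
Qed.

Lemma odd_bnet b : odd `|bnet b| = odd (size b).
Proof.
elim: b => [|x b IH]; first by rewrite /bnet big_nil.
by rewrite bnet_cons /= -IH; case: x; rewrite /sg; lia.
Qed.

Lemma par_bool_word u b :
  foldl par_op u (bool_word b) = (u.1 (+) (odd `|bnet b| && u.2), u.2).
Proof.
rewrite odd_bnet; elim: b u => [|x b IH] [p q] /=; first by rewrite addbF.
by rewrite IH /=; case: p; case: q; case: (odd _).
Qed.

(** Each crossing put in front of a reduced block either lengthens it or cancels its first crossing
    by a Reidemeister II move. *)
Lemma N_canon w1 b w2 : (par (w1 ++ bool_word b ++ w2)).1 ->
  equivalent (N (w1 ++ bool_word b ++ w2)) (N (w1 ++ bool_word (canon (bnet b)) ++ w2)).
Proof.
elim: b w1 => [|s b IH] w1 hp; first by rewrite /bnet big_nil; apply: eqv_refl.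
have {}IH := IH (rcons w1 (Some (Some s))); rewrite !cat_rcons in IH.
apply: eqv_trans (IH hp) _; rewrite bnet_cons.
case: (canon_cons s (bnet b)) => [->|E]; first exact: eqv_refl.
rewrite E /=; apply: N_R2; move: hp.
by rewrite !par_cat !foldl_cat !par_bool_word bnet_canon bnet_cons.
Qed.

Lemma N_bword bs : odd `|continuant (map bnet bs)| ->
  equivalent (N (bword bs)) (N (cword (map bnet bs))).
Proof.
suff gen w : (par (w ++ bword bs)).1 -> equivalent (N (w ++ bword bs)) (N (w ++ cword (map bnet bs))).
  by rewrite -par_bword => h; apply: (gen [::]).
elim: bs w => [|b bs IH] w hp; first exact: eqv_refl.
rewrite /bword /= -/(bword bs) -cat_rcons in hp *; apply: (eqv_trans (N_canon hp)).
rewrite /cword /bword /= -/(bword _) -/(cword _) -cat_rcons !catA; apply: IH.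
by move: hp; rewrite !par_cat !foldl_cat !par_bool_word bnet_canon.
Qed.

Lemma par_tail_none w b : (par (w ++ None :: bool_word b ++ [:: None])).1 = (par w).1.
Proof. by rewrite par_cat /= foldl_cat par_bool_word. Qed.

(** Between two reflections at the end of the word all twists are kinks; without them the
    reflections cancel. *)
Lemma N_tail_kinks w b : (par w).1 ->
  equivalent (N (w ++ None :: bool_word b ++ [:: None])) (N w).
Proof.
elim/last_ind: b => [|b s IH] hp.
  by rewrite [bool_word _ ++ _]/= -cat_rcons cats1 N_RR; apply: eqv_refl.
apply: eqv_trans (IH hp); set W := w ++ None :: bool_word b.
have hk c : knot_pseudodiagram (N (w ++ None :: bool_word c ++ [:: None])).
  by apply: N_knot; rewrite par_tail_none.
have -> : w ++ None :: bool_word b ++ [:: None] = rcons W None by rewrite -cats1 -catA.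
have := hk (rcons b s).
have -> : w ++ None :: bool_word (rcons b s) ++ [:: None] = rcons (rcons W (Some (Some s))) None.
  by rewrite /bool_word map_rcons cats1 /W !rcons_cat.
have [D [D' [h1 h2 h3]]] := N_kink W (Some s); rewrite {}h2 => kD.
have kD' : knot_pseudodiagram D'.
  by rewrite (isotopic_knot h3) -cats1 /W -catA; exact: (hk b).
apply: (@eqv_trans D'); last exact: isotopic_equivalent h3.
by apply: rst_step; split=> //; right; apply: R1 h1.
Qed.

(** The closure surrounds a final crossing by the four endpoints of the tangle, and a reflection
    before it only mirrors this picture. This lets a last block of one crossing join the block
    before it. *)
Lemma N_T2 w s : N (rcons (rcons w None) (Some s)) = refl (N (rcons w (Some s))).
Proof. by rewrite !N_tw tangle_rcons /refl /=; congr (PD _ ((_, _) :: _)); apply: val_inj. Qed.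

(** The condition makes the closure a knot; its parity is the same for all resolutions of a shadow
    by [odd_fraction_nets]. *)
Definition unknotted l := odd `|continuant l| -> unknot (N (cword l)).

Lemma bword_rcons bs b : bword (rcons bs b) = bword bs ++ None :: bool_word b.
Proof. by rewrite /bword map_rcons flatten_rcons. Qed.

Lemma cword_rcons l n : cword (rcons l n) = cword l ++ None :: bool_word (canon n).
Proof. by rewrite /cword map_rcons bword_rcons. Qed.

Lemma map_bnet_canon l : map bnet (map canon l) = l.
Proof. by rewrite -map_comp -[RHS]map_id; apply: eq_map => n /=; rewrite bnet_canon. Qed.

Lemma par_cword l : (par (cword l)).1 = odd `|continuant l|.
Proof. by rewrite par_bword map_bnet_canon. Qed.

Lemma unknotted_tail0 l y : unknotted l -> unknotted (rcons (rcons l y) 0%R).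
Proof.
rewrite /unknotted continuant_tail0 => h hl.
apply: eqv_trans (h hl); rewrite !cword_rcons -catA; apply: N_tail_kinks.
by rewrite par_cword.
Qed.

Lemma unknotted_tail1 l y b :
  unknotted (rcons l (y + sg b)%R) -> unknotted (rcons (rcons l y) (sg b)).
Proof.
rewrite /unknotted continuant_tail1 abszM => h hl.
have {h} : unknot (N (cword (rcons l (y + sg b)%R))).
  by apply: h; move: hl; rewrite oddM odd_sg.
have cs : canon (sg b) = [:: b] by case: (b).
have e1 : cword (rcons (rcons l y) (sg b)) = rcons (rcons (cword (rcons l y)) None) (Some (Some b)).
  by rewrite cword_rcons cs -!cats1 -catA.
(* Appending [b] to the block [canon y] gives a diagram that reduces to the known unknot, and the
   given diagram is its mirror image by [N_T2]. *)
have hk : odd `|continuant (map bnet (rcons (map canon l) (rcons (canon y) b)))|.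
  rewrite map_rcons map_bnet_canon -(cats1 (canon y)) bnet_cat bnet_canon bnet1.
  by move: hl; rewrite oddM odd_sg.
have := N_bword hk; rewrite map_rcons map_bnet_canon -(cats1 (canon y)) bnet_cat bnet_canon.
rewrite bnet1 => e u; have {e u} u := eqv_trans e u.
rewrite e1 N_T2; apply: unknot_refl; move: u.
rewrite cword_rcons bword_rcons /bool_word map_cat /= -/(bool_word _) -/(cword l).
by rewrite cats1 -rcons_cons -rcons_cat.
Qed.

Lemma negrev_cat w w' : negrev (w ++ w') = negrev w' ++ negrev w.
Proof. by rewrite /negrev rev_cat map_cat. Qed.

Lemma negrev_block_word bs :
  rcons (block_word (rev [seq rev (map (omap negb) b) | b <- bs])) None = None :: negrev (block_word bs).
Proof.
elim: bs => // b bs IH; rewrite map_cons rev_cons block_word_rcons IH.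
rewrite /block_word /= -/(block_word bs) -[None :: _ ++ _]/([:: None] ++ _ ++ _) !negrev_cat.
rewrite -cats1 /= -!catA; congr (_ :: _ ++ (_ ++ _)).
by rewrite /negrev !map_rev; congr rev; rewrite -!map_comp.
Qed.

Lemma bword_block_word bs : bword bs = block_word (map (map Some) bs).
Proof.
rewrite /bword /block_word -map_comp; congr flatten; apply: eq_map => b /=.
by rewrite /bool_word map_comp.
Qed.

Lemma canonN n : canon (- n)%R = map negb (canon n).
Proof.
rewrite /canon map_nseq abszN; case: n => [[|n]|n] //=.
Qed.

Lemma cword_rev l :
  rcons (cword (rev [seq (- n)%R | n <- l])) None = None :: negrev (cword l).
Proof.
rewrite /cword !bword_block_word -negrev_block_word; congr (rcons (block_word _) _).
rewrite !map_rev; congr rev; rewrite -!map_comp; apply: eq_map => n /=.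
rewrite canonN -map_comp -(map_comp _ Some) -map_rev; congr map; rewrite /canon.
by elim: `|n| => //= k IH; rewrite rev_cons -{1}IH; elim: {IH} k => //= k ->.
Qed.

Lemma continuantN l : `|continuant [seq (- n)%R | n <- l]| = `|continuant l|.
Proof.
(* Negating the entries makes the signs alternate: [c] is the current sign of the first component,
   and the second has the opposite one. *)
suff gen (c : bool) (u : int * int) :
    `|(foldl cf_step (sg c * u.1, - sg c * u.2)%R [seq (- n)%R | n <- l]).1| = `|(foldl cf_step u l).1|.
  by have := gen true (1, 0)%R; rewrite /sg mul1r mulr0.
elim: l c u => [|a l IH] c u; first by rewrite [_.1]/= abszM; case: c; rewrite mul1n.
rewrite [foldl _ u _]/= -(IH (~~ c)) [LHS]/=; congr (absz (foldl _ _ _).1).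
by rewrite /cf_step [_.1]/=; case: c; rewrite /sg /=; congr pair; ring.
Qed.

(** Turning the diagram around reverses the word and negates its states, up to mirror images, which
    keep the unknot. *)
Lemma unknotted_negrev l : unknotted (rev [seq (- n)%R | n <- l]) -> unknotted l.
Proof.
rewrite /unknotted continuant_rev continuantN => h hl.
have hw : (par (cword l)).1 by rewrite par_cword.
have := isotopic_equivalent (N_knot hw) (N_rev hw (cword_rev l)).
move=> e; apply: eqv_trans e _; elim: (num_refl _) => [|k IH]; first exact: h.
exact: unknot_refl IH.
Qed.

Lemma unknotted_lead l x b : unknotted ((x + sg b)%R :: l) -> unknotted (sg b :: x :: l).
Proof.
move=> h; apply: unknotted_negrev; rewrite /= !rev_cons.
have sN c : (- sg c)%R = sg (~~ c) by case: c.
rewrite sN; apply: unknotted_tail1; rewrite -sN -opprD -rev_cons -map_cons.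
apply: unknotted_negrev; rewrite map_rev revK -map_comp (eq_map (g := id)) ?map_id //.
by move=> n /=; rewrite opprK.
Qed.

Lemma unknotted_nil : unknotted [::].
Proof. by move=> _; apply: eqv_refl. Qed.

Lemma unknotted_single b : unknotted [:: sg b].
Proof.
move=> _; have -> : cword [:: sg b] = rcons (rcons [::] None) (Some (Some b)) by case: b.
rewrite N_T2; apply: unknot_refl.
have k : knot_pseudodiagram (N (rcons [::] (Some (Some b)))) by exact: N_knot.
apply: (move_equivalent k knot_circle (D1 := PD 0 [:: (Some (~~ b), [tuple 0; 0; 1; 1])])).
- apply: iso_sym; apply: rst_step; rewrite N_tw.
  have -> : (Some b, [tuple 0; 1; 1; 0]) = rotate_crossing (Some (~~ b), [tuple 0; 0; 1; 1]).
    by rewrite /rotate_crossing /= negbK; congr pair; apply: val_inj.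
  exact: same_rotate.
- by apply: R1; apply: DeleteKink.
exact: iso_refl.
Qed.

(** * The Unknotter moving last *)

(** The arithmetic form of being a knot shadow, by [shadow_knot] and [odd_fraction_knot]. *)
Definition odd_fraction (a : seq nat) := odd `|continuant (map Posz a)|.

Lemma odd_net e u : odd `|net e u| = odd (size u).
Proof.
elim: u => [|i u IH]; first by rewrite net_nil.
by rewrite net_cons /= -IH; case: (e i); rewrite /sg; lia.
Qed.

Lemma odd_fraction_nets e (bl : seq (seq nat)) :
  odd `|continuant (map (net e) bl)| = odd_fraction (map size bl).
Proof.
rewrite /odd_fraction; apply: continuant_parity; rewrite -!map_comp.
by apply: eq_map => b /=; rewrite odd_net.
Qed.

Lemma with_states_bword e bl : with_states (Some \o e) bl = bword (map (map e) bl).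
Proof.
rewrite bword_block_word /with_states; congr block_word; rewrite -map_comp.
by apply: eq_map => b /=; rewrite -map_comp.
Qed.

Lemma bnet_net e b : bnet (map e b) = net e b.
Proof. by rewrite /bnet big_map. Qed.

Lemma bnets_nets e bl : map bnet (map (map e) bl) = map (net e) bl.
Proof. by rewrite -map_comp; apply: eq_map => b /=; rewrite bnet_net. Qed.

Lemma unknotted_final e bl : odd_fraction (map size bl) ->
  unknotted (map (net e) bl) -> unknot (N (with_states (Some \o e) bl)).
Proof.
rewrite -(odd_fraction_nets e) with_states_bword => ho h.
have := N_bword (bs := map (map e) bl); rewrite bnets_nets => /(_ ho) E.
exact: eqv_trans E (h ho).
Qed.

Definition knotted l := 1 < `|continuant l|.

Lemma knotted_final e bl :
  knotted (map (net e) bl) -> ~ unknot (N (with_states (Some \o e) bl)).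
Proof. by rewrite with_states_bword => h; apply: not_unknot; rewrite pq_bword bnets_nets. Qed.

Lemma size_free_vars ts pl :
  size (free_vars ts pl) = size ts + sumn (map (fun z => size z.2) pl).
Proof. by rewrite size_cat size_flatten /shape -map_comp. Qed.

Lemma W_twins p (G : seq int -> Prop) k a :
  (forall e bl, map size bl = a -> G (map (net e) bl) ->
     final_win p (N (with_states (Some \o e) bl))) ->
  W G k a -> twins p k (if odd (sumn a + k) then p else opponent p) (rational_shadow a).
Proof.
move=> hG h; apply: game_shadow hG _ => ts pl hu sz ea st; have := h ts pl hu sz ea st.
by rewrite /last_mover size_free_vars sz ea addnC.
Qed.

Lemma W_nil (G : seq int -> Prop) k : G [::] -> W G k [::].
Proof. by move=> g ts [|z pl] // hu _ _ _; apply: PW_end. Qed.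

Lemma W_single1 (G : seq int -> Prop) k : (forall b, G [:: sg b]) -> W G k [:: 1].
Proof.
move=> g ts [|[z [|i [|]]] [|]] // hu _ _ /= /andP[/eqP e0 _] e; apply: PW_end => // e'.
by rewrite /= e0 net_cons net_nil addr0 add0r; apply: g.
Qed.

Lemma odd_fraction_pair l x r : odd_fraction (l ++ x.+2 :: r) = odd_fraction (l ++ x :: r).
Proof.
apply: continuant_parity; rewrite !map_cat /=; congr (_ ++ _ :: _).
by rewrite negbK.
Qed.

Lemma odd_fraction_tail0 a x : odd_fraction (rcons (rcons a x) 0) = odd_fraction a.
Proof. by rewrite /odd_fraction !map_rcons continuant_tail0. Qed.

Lemma odd_fraction_tail1 a x : odd_fraction (rcons (rcons a x) 1) = odd_fraction (rcons a x.+1).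
Proof.
rewrite /odd_fraction !map_rcons (continuant_tail1 _ _ true) abszM oddM odd_sg.
by congr (odd (absz (continuant (rcons _ _)))); rewrite /sg; lia.
Qed.

(** The last entry decides: from two on it loses a pair of crossings, a single crossing joins the
    block before, and an empty block turns the one before it into tempo moves. The numerator stays
    odd, so the reduction ends with the empty sequence or a single crossing. *)
Lemma unknotter_moving_last k a : odd_fraction a -> W unknotted k a.
Proof.
have [n hn] := ubnP (sumn a + size a); elim: n a k hn => // n IH a k hn ho.
case/lastP: a hn ho => [|a x] hn ho; first exact: W_nil unknotted_nil.
case: x hn ho => [|[|x]] hn ho; last first.
- rewrite -cats1; apply: W_pair; apply: IH; first by move: hn; rewrite -cats1 !sumn_cat !size_cat /=; lia.
  by rewrite -odd_fraction_pair cats1.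
- case/lastP: a hn ho => [|a x] hn ho; first exact: W_single1 unknotted_single.
  apply: W_tail1 => [l y b|]; first exact: unknotted_tail1.
  apply: IH; last by rewrite -odd_fraction_tail1.
  by move: hn; rewrite !sumn_rcons !size_rcons; lia.
case/lastP: a hn ho => [|a x] hn ho //.
apply: W_tail0 => [l y|]; first exact: unknotted_tail0.
apply: IH; last by rewrite -(odd_fraction_tail0 _ x).
by move: hn; rewrite !sumn_rcons !size_rcons; lia.
Qed.

Lemma unknotter_last_twins k a : odd_fraction a ->
  twins Unknotter k (if odd (sumn a + k) then Unknotter else Knotter) (rational_shadow a).
Proof.
move=> ho; apply: (@W_twins Unknotter) (unknotter_moving_last ho) => e bl ea.
by apply: unknotted_final; rewrite ea.
Qed.

(** * Odd-even shadows *)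

Section OddEven.
Variable G : seq int -> Prop.
Hypothesis G1 : forall b, G [:: sg b].
Hypothesis G_lead : forall x b l, G ((x + sg b)%R :: l) -> G (sg b :: x :: l).

Definition balanced (z : int * seq nat) := (z.1 == 0%R) && ~~ odd (size z.2).

Lemma even_nonnil (i : nat) u : ~~ odd (size u) -> i \in u ->
  exists j, j \in rem i u.
Proof.
case: u => [|x [|y u]] //= _ _; case: ifP => _; first by exists y; rewrite mem_head.
by exists x; rewrite mem_head.
Qed.

Lemma even_rem2 (i j : nat) u : ~~ odd (size u) -> i \in u -> j \in rem i u ->
  ~~ odd (size (rem j (rem i u))).
Proof. by move=> o hi hj; rewrite !size_rem //; case: (size u) o => [|[]] //= n; rewrite negbK. Qed.

Lemma uniq_move ts l z u r i z' : uniq (free_vars ts (l ++ (z, u) :: r)) -> i \in u ->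
  uniq (free_vars ts (l ++ (z', rem i u) :: r)).
Proof. by move=> hu hi; rewrite -(perm_uniq (rem_free z' hu hi)) rem_uniq. Qed.

Lemma size_move ts l z u r i z' : i \in u ->
  size (free_vars ts (l ++ (z, u) :: r)) = (size (free_vars ts (l ++ (z', rem i u) :: r))).+1.
Proof.
move=> hi; rewrite !(perm_size (free_cat _ _ _ _ _)) !size_cat size_rem //.
by case: u hi => // a u _; rewrite addSn.
Qed.

Lemma size_tempo ts pl i : i \in ts ->
  size (free_vars ts pl) = (size (free_vars (rem i ts) pl)).+1.
Proof. by move=> hi; rewrite !size_cat size_rem //; case: ts hi. Qed.

Lemma uniq_tempo ts pl i : i \in ts -> uniq (free_vars ts pl) -> uniq (free_vars (rem i ts) pl).
Proof. by move=> hi hu; rewrite -rem_ts // rem_uniq. Qed.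

(* The Unknotter keeps all blocks but the first one balanced; once the first block
   is used up, it stands for a single crossing and is absorbed by the next one. *)
Lemma odd_even_strategy n ts z u r :
  size (free_vars ts ((z, u) :: r)) + size r < n ->
  uniq (free_vars ts ((z, u) :: r)) -> ~~ odd (size ts) -> all balanced r ->
  (z = 0%R -> odd (size u) -> PW G false ts ((z, u) :: r)) /\
  (forall b, z = sg b -> ~~ odd (size u) -> PW G true ts ((z, u) :: r)).
Proof.
have drop1 a b d n' : a = b.+1 -> a + d < n'.+1 -> b + d < n' by lia.
have drop2 a b c d n' : a = b.+1 -> b = c.+1 -> a + d < n'.+1 -> c + d < n' by lia.
have sgN (b : bool) : (sg b + sg (~~ b) = 0)%R by case: b.
elim: n ts z u r => // n IH ts z u r hn hu hts hr; split=> [ez ou|b ez eu]; rewrite {}ez {z} in hn hu *.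
  apply: PW_opp => //.
  - by rewrite -size_eq0 size_cat /= size_cat; case: u ou {hn hu} => //= a u _; lia.
  (* The opponent spends a tempo move; as their number is even, another one is there to answer
     it. *)
  - move=> i hi; have [j hj] := even_nonnil hts hi; apply: (PW_own_tempo hj).
    have s1 := size_tempo ((0%R, u) :: r) hi; have s2 := size_tempo ((0%R, u) :: r) hj.
    have u2 := uniq_tempo hj (uniq_tempo hi hu).
    have [] // := IH (rem j (rem i ts)) 0%R u r _ u2 (even_rem2 hts hi hj) hr; first exact: drop2 s1 s2 hn.
    by move=> q _; apply: q.
  (* A move in the first block leads to the second claim with sum [sg b]; a move in a balanced block
     is answered there by the opposite sign. *)
  move=> l z1 u1 r1 i b epl hi; case: l epl => [[e1 e2 e3]|z0 l [e1 e2]].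
    rewrite /= -e1 add0r -e3; rewrite -{}e2 {u1 e1 e3} in hi *.
    have s1 := @size_move ts [::] 0%R u r i (sg b) hi; have u2 := @uniq_move ts [::] 0%R u r i (sg b) hu hi.
    have [] := IH ts (sg b) (rem i u) r _ u2 hts hr; first exact: drop1 s1 hn.
    move=> _; apply=> //; rewrite size_rem //; case: (size u) ou => //=.
  rewrite {}e2 -{}e1 {r z0} in hn hu hr *; move: hr; rewrite all_cat /=.
  case/and3P=> hl /andP[/= /eqP e0 eu1] hr1; rewrite {}e0 {z1} add0r in hn hu *.
  have [j hj] := even_nonnil eu1 hi; apply: (@PW_own _ _ ((0%R, u) :: l) _ _ _ _ (~~ b)).
  - exact: (@uniq_move ts ((0%R, u) :: l) 0%R u1 r1 i (sg b)).
  - exact: hj.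
  rewrite sgN.
  have s1 := @size_move ts ((0%R, u) :: l) 0%R u1 r1 i (sg b) hi.
  have s2 := @size_move ts ((0%R, u) :: l) (sg b) (rem i u1) r1 j 0%R hj.
  have u2 := @uniq_move ts ((0%R, u) :: l) (sg b) (rem i u1) r1 j 0%R (@uniq_move ts ((0%R, u) :: l) 0%R u1 r1 i (sg b) hu hi) hj.
  have [] := IH ts 0%R u (l ++ (0%R, rem j (rem i u1)) :: r1) _ u2 hts.
  - have -> : size (l ++ (0%R, rem j (rem i u1)) :: r1) = size (l ++ (0%R, u1) :: r1).
      by rewrite !(size_cat l).
    exact: drop2 s1 s2 hn.
  - by rewrite all_cat /= hl hr1 /balanced eqxx /= even_rem2.
  by move=> q _; apply: q.
(* If crossings are left in the first block, its sum is brought back to 0. Otherwise the block is a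
   single sign and joins the next one, which is balanced, so that the claim recurs with the same
   player to move. *)
case: u hn hu eu => [|i u] hn hu eu; last first.
  have hi : i \in i :: u by exact: mem_head.
  apply: (@PW_own _ _ [::] _ _ _ i (~~ b)) => //; rewrite sgN.
  have s1 := @size_move ts [::] (sg b) (i :: u) r i 0%R hi.
  have u2 := @uniq_move ts [::] (sg b) (i :: u) r i 0%R hu hi.
  have [] := IH ts 0%R (rem i (i :: u)) r _ u2 hts hr; first exact: drop1 s1 hn.
  by move=> q _; apply: q => //; rewrite /= eqxx; move: eu => /= /negbNE.
case: r hr hn hu => [|[x u1] r] /= hr hn hu.
  by apply: PW_end => // e; rewrite /= net_nil addr0; apply: G1.
case/andP: hr => /andP[/= /eqP ex eu1] hr; rewrite {}ex {x} in hn hu *.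
have [] := IH ts (sg b) u1 r _ hu hts hr; first by move: hn; rewrite /free_vars /=; lia.
move=> _ /(_ b erefl eu1); apply: PW_map => //.
by move=> e /= h; rewrite net_nil addr0 add0r; apply: G_lead; rewrite addrC.
Qed.

(** With an odd number of tempo moves the player begins by spending one, which leaves the even case
    with the opponent to move. *)
Lemma PW_odd_even ts u r mine : uniq (free_vars ts ((0%R, u) :: r)) -> odd (size u) ->
  all balanced r -> mine = odd (size ts) -> PW G mine ts ((0%R, u) :: r).
Proof.
move=> hu ou hr ->; have st ts' : uniq (free_vars ts' ((0%R, u) :: r)) -> ~~ odd (size ts') ->
    PW G false ts' ((0%R, u) :: r).
  by move=> hu' ho; have [q _] := odd_even_strategy (ltnSn _) hu' ho hr; apply: q.
case E: (odd _); last by apply: st => //; rewrite E.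
case: ts E hu => // i ts E hu; apply: (PW_own_tempo (mem_head i ts)); rewrite /= eqxx.
by apply: st; [move: hu => /andP[]|move: E => /= ->].
Qed.

End OddEven.

Definition evens_only (a : seq nat) := all (fun x => ~~ odd x) a.

Lemma odd_even_head x r : odd x -> evens_only r -> odd_even (x :: r).
Proof.
move=> ox /allP er; exists 0; split=> //; first by left.
by case=> [|j] //= hj; rewrite (negbTE (er _ (mem_nth 0 hj))).
Qed.

Lemma odd_even_tail r x : odd x -> evens_only r -> odd_even (rcons r x).
Proof.
move=> ox /allP er; exists (size r); rewrite size_rcons; split=> //; first by right.
move=> j; rewrite ltnS nth_rcons => hj.
case: ltngtP hj => // hj _.
by rewrite (negbTE (er _ (mem_nth 0 hj))).
Qed.

Lemma odd_evenP a : odd_even a ->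
  (exists x r, [/\ a = x :: r, odd x & evens_only r]) \/
  (exists x r, [/\ a = rcons r x, odd x & evens_only r]).
Proof.
case=> i [hi he h]; case: he => ei; subst i; [left|right].
  case: a hi h => [|x r] // hi h; exists x, r; split=> //; first exact: h 0 hi.
  by apply/allP => y /(nthP 0)[j hj <-]; have /= -> := h j.+1.
case/lastP: a hi h => [|r x] //; rewrite size_rcons /= => hi h; exists x, r; split=> //.
  by have := h (size r) (ltnSn _); rewrite nth_rcons ltnn !eqxx.
apply/allP => y /(nthP 0)[j hj <-]; have := h j (ltnW hj); rewrite nth_rcons hj => ->.
by rewrite ltn_eqF.
Qed.

Lemma odd_fraction_head x r : odd x -> evens_only r -> odd_fraction (x :: r).
Proof.
move=> ox er; rewrite /odd_fraction.
rewrite (@continuant_parity _ (1%R :: nseq (size r) 0%R)).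
  rewrite /continuant /cf /= /cf_step /= mulr1 add0r.
  by elim: (size r) => //= n IH; rewrite /cf_step /= mul0r addr0.
rewrite /= ox; congr cons; elim: r er => //= y r IH /andP[/negbTE-> /IH->] //.
Qed.

Lemma odd_fraction_rev a : odd_fraction (rev a) = odd_fraction a.
Proof. by rewrite /odd_fraction map_rev continuant_rev. Qed.

Lemma odd_even_odd_fraction a : odd_even a -> odd_fraction a.
Proof.
case/odd_evenP=> [[x [r [-> ox er]]]|[x [r [-> ox er]]]]; first exact: odd_fraction_head.
by rewrite -odd_fraction_rev rev_rcons; apply: odd_fraction_head => //; rewrite /evens_only all_rev.
Qed.

Lemma odd_sumn_evens r : evens_only r -> odd (sumn r) = false.
Proof. by elim: r => //= x r IH /andP[/negbTE ex /IH]; rewrite oddD ex. Qed.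

Lemma start_balanced r : all (fun z : int * seq nat => z.1 == 0%R) r ->
  evens_only (map (fun z => size z.2) r) -> all balanced r.
Proof.
elim: r => //= z r IH /andP[h1 h2] /andP[h3 h4]; rewrite /balanced h1 h3 /=; exact: IH.
Qed.

Lemma game_odd_even a k ts pl : odd_even a -> uniq (free_vars ts pl) -> size ts = k ->
  map (fun z => size z.2) pl = a -> start pl -> PW unknotted (odd k) ts pl.
Proof.
move=> /odd_evenP[[x [r [-> ox er]]]|[x [r [-> ox er]]]] hu sz ea st.
  case: pl ea hu st => // -[z u] pl [ex ea] hu /= /andP[/eqP /= ez st]; rewrite ez in hu *.
  apply: PW_odd_even hu _ _ _; rewrite /= ?ex ?sz //.
  - exact: unknotted_single.
  - move=> y b l; exact: unknotted_lead.
  by apply: start_balanced => //; rewrite ea.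
(* Here the odd block stands last; the list of blocks is reversed to bring it to the front. *)
have [pl1 [[z u] [epl ea1 /= ex]]] := map_rcons_inv ea.
move: st; rewrite epl start_rcons => /andP[st /eqP /= ez]; rewrite epl ez in hu *.
have p : perm_eq (free_vars ts ((0%R, u) :: rev pl1)) (free_vars ts (rcons pl1 (0%R, u))).
  rewrite /free_vars perm_cat2l; apply: perm_flatten; apply: perm_map.
  by rewrite -rev_rcons perm_rev.
apply: (@PW_map (fun l => unknotted (rev l)) _ _ ts ((0%R, u) :: rev pl1)) => //.
- by rewrite (perm_uniq p).
- by move=> e; rewrite -rev_rcons /vals map_rev revK.
apply: PW_odd_even; rewrite ?(perm_uniq p) ?ex ?sz //.
- by move=> b; apply: unknotted_single.
- move=> y b l; rewrite !rev_cons; exact: unknotted_tail1.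
rewrite all_rev; apply: start_balanced => //; by rewrite ea1.
Qed.

(** The number of crossings is odd, so for any [k] the Unknotter either moves last or is in the
    situation of [game_odd_even]. *)
Lemma strong_win_odd_even a : odd_even a -> strong_win (rational_shadow a).
Proof.
move=> oe k m; have ho := odd_even_odd_fraction oe.
have os : odd (sumn a).
  case/odd_evenP: oe => [[x [r [-> ox er]]]|[x [r [-> ox er]]]].
    by rewrite /= oddD ox odd_sumn_evens.
  by rewrite sumn_rcons oddD ox odd_sumn_evens.
have h1 := unknotter_last_twins k ho.
have h2 : twins Unknotter k (if odd k then Unknotter else opponent Unknotter) (rational_shadow a).
  apply: (@game_shadow Unknotter unknotted) => [e bl ea|ts pl]; last exact: game_odd_even.
  by apply: unknotted_final; rewrite ea.
by move: h1 h2; rewrite oddD os; case: (odd k); case: m.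
Qed.

(** * Certificates for the player moving last *)

(** The rules do not distinguish the two bits, so a strategy can be read with all bits negated; this
    is the mirror symmetry of positions. *)
Lemma vwin_negb (Phi Psi : (nat -> bool) -> Prop) n mine us e e' :
  (forall e1 e2, (forall i, e2 i = ~~ e1 i) -> Phi e1 -> Psi e2) ->
  (forall i, e' i = ~~ e i) -> vwin Phi n mine us e -> vwin Psi n mine us e'.
Proof.
move=> h; elim: n mine us e e' => [|n IH] mine us e e' he /=; first exact: h.
have hu i b : forall j, upd e' i (~~ b) j = ~~ upd e i b j.
  by move=> j; rewrite /upd; case: eqP.
case: mine => [[i [b [hi w]]]|w i b hi].
  by exists i, (~~ b); split=> //; apply: IH w.
by apply: IH (w i (~~ b) hi) => j; rewrite -hu negbK.
Qed.

(* The number of tempo moves, and for each block the sum of its resolved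
   crossings and the number of its unresolved ones. *)
Definition position : Type := nat * seq (int * nat).

Definition total (x : position) := x.1 + sumn (map snd x.2).

Definition profile (pl : blocks) := [seq (z.1, size z.2) | z <- pl].

Definition Wpos (x : position) := forall ts pl,
  uniq (free_vars ts pl) -> size ts = x.1 -> profile pl = x.2 ->
  PW knotted (last_mover ts pl) ts pl.

Fixpoint block_moves (s : seq (int * nat)) :=
  if s is (z, c) :: r then
    (if c is c'.+1 then [:: ((z + 1)%R, c') :: r; ((z - 1)%R, c') :: r] else [::])
    ++ map (cons (z, c)) (block_moves r)
  else [::].

Fixpoint block_pairs (s : seq (int * nat)) :=
  if s is (z, c) :: r then
    (if c is c'.+2 then [:: (z, c') :: r] else [::]) ++ map (cons (z, c)) (block_pairs r)
  else [::].

Definition moves (x : position) : seq position :=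
  (if x.1 is k.+1 then [:: (k, x.2)] else [::]) ++ map (pair x.1) (block_moves x.2).

Definition pairs (x : position) : seq position :=
  (if x.1 is k.+2 then [:: (k, x.2)] else [::]) ++ map (pair x.1) (block_pairs x.2).

(** One step of a proof that the Knotter, moving last, wins: a finished position is judged by its
    continuant; otherwise a pair is dropped or the game tree is unfolded by one move, an odd total
    meaning that the Knotter is to move. *)
Definition justified (P : position -> bool) (x : position) :=
  if total x == 0 then 1 < `|continuant (map fst x.2)|
  else has P (pairs x) || (if odd (total x) then has P (moves x) else all P (moves x)).

Definition opposite_position (x : position) : position :=
  (x.1, [seq ((- z.1)%R, z.2) | z <- x.2]).

Definition reverse_position (x : position) : position := (x.1, rev x.2).

(** Reversal and change of sign keep the absolute value of the continuant, so a certificate may list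
    one position in place of all its variants. *)
Definition variants x :=
  [:: x; reverse_position x; opposite_position x; opposite_position (reverse_position x)].

Fixpoint solvable n x := if n is n'.+1 then justified (solvable n') x else false.

(** Depth 4 exhausts every position with at most three free variables, one level being spent on the
    finished position. *)
Definition certified (L : seq position) x := has (mem L) (variants x) || solvable 4 x.

Lemma total_size ts pl k s : size ts = k -> profile pl = s ->
  total (k, s) = size (free_vars ts pl).
Proof.
move=> <- <-; rewrite size_free_vars /total /profile /= -map_comp; congr (_ + sumn _).
Qed.

Lemma Wpos_opposite x : Wpos (opposite_position x) -> Wpos x.
Proof.
move=> w ts pl hu hk hs e.
pose pl' := [seq ((- z.1)%R, z.2) | z <- pl] : blocks.
have ef : free_vars ts pl' = free_vars ts pl.
  by rewrite /free_vars /pl' -map_comp; congr (_ ++ flatten _); apply: eq_map.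
have := w ts pl'; rewrite /last_mover ef => /(_ hu hk) {}w.
have /w {}w : profile pl' = (opposite_position x).2.
  by rewrite /= -hs /profile /pl' -!map_comp; apply: eq_map.
have := w (fun i => ~~ e i); rewrite ef; apply: vwin_negb; last by move=> i; rewrite negbK.
move=> e1 e2 he; rewrite /knotted -continuantN; congr (_ < `|continuant _|).
rewrite /vals /pl' -!map_comp; apply: eq_map => z /=.
rewrite opprD opprK; congr (_ + _)%R; rewrite /net -sumrN; apply: eq_bigr => i _.
by rewrite he; case: (e1 i).
Qed.

Lemma Wpos_reverse x : Wpos (reverse_position x) -> Wpos x.
Proof.
move=> w ts pl hu hk hs.
have p : perm_eq (free_vars ts (rev pl)) (free_vars ts pl).
  rewrite /free_vars perm_cat2l; apply: perm_flatten; apply: perm_map.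
  by rewrite perm_rev.
rewrite /last_mover -(perm_size p); have hu' := hu; rewrite -(perm_uniq p) in hu'.
apply: (PW_map hu' p) (w _ _ hu' hk _); last by rewrite /profile map_rev -/(profile pl) hs.
by move=> e; rewrite /knotted /vals map_rev continuant_rev.
Qed.

Lemma block_movesP s l z c r b : s = l ++ (z, c.+1) :: r ->
  l ++ ((z + sg b)%R, c) :: r \in block_moves s.
Proof.
move=> ->; elim: l => [|[z' c'] l IH] /=.
  by rewrite !inE; case: b; rewrite /sg eqxx ?orbT.
by rewrite mem_cat map_f ?orbT.
Qed.

Lemma block_moves_inv s s' : s' \in block_moves s ->
  exists l z c r b, s = l ++ (z, c.+1) :: r /\ s' = l ++ ((z + sg b)%R, c) :: r.
Proof.
elim: s s' => // -[z c] r IH s' /=; rewrite mem_cat => /orP[|/mapP[s1 /IH h ->]].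
  case: c => // c; rewrite !inE => /orP[]/eqP->.
    by exists [::], z, c, r, true.
  by exists [::], z, c, r, false.
have [l [z1 [c1 [r1 [b [-> ->]]]]]] := h.
by exists ((z, c) :: l), z1, c1, r1, b.
Qed.

Lemma block_pairs_inv s s' : s' \in block_pairs s ->
  exists l z c r, s = l ++ (z, c.+2) :: r /\ s' = l ++ (z, c) :: r.
Proof.
elim: s s' => // -[z c] r IH s' /=; rewrite mem_cat => /orP[|/mapP[s1 /IH h ->]].
  by case: c => [|[|c]] //; rewrite !inE => /eqP->; exists [::], z, c, r.
have [l [z1 [c1 [r1 [-> ->]]]]] := h.
by exists ((z, c) :: l), z1, c1, r1.
Qed.

Lemma profile_split pl l z c r : profile pl = l ++ (z, c) :: r ->
  exists l' u r', [/\ pl = l' ++ (z, u) :: r', profile l' = l, size u = c & profile r' = r].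
Proof.
move=> e; have [l' [[z' u] [r' [-> el [<- eu] er]]]] := map_cat_cons e.
by exists l', u, r'.
Qed.

Lemma profile_put l z u r : profile (l ++ (z, u) :: r) = profile l ++ (z, size u) :: profile r.
Proof. by rewrite /profile map_cat. Qed.

Lemma total_put k l z c r : total (k, l ++ (z, c) :: r) = c + total (k, l ++ r).
Proof. by rewrite /total /= !map_cat !sumn_cat /=; lia. Qed.

Lemma Wpos_total0 x : total x = 0 -> 1 < `|continuant (map fst x.2)| -> Wpos x.
Proof.
case: x => k s t0 h ts pl hu hk hs e.
have nil : free_vars ts pl = [::] by apply: size0nil; rewrite -(total_size hk hs) t0.
rewrite nil /= /knotted; move: h => /=; congr (_ < `|continuant _|).
rewrite -[s]hs /profile /vals -map_comp; apply/eq_in_map => z hz /=.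
suff -> : z.2 = [::] by rewrite net_nil addr0.
case E : z.2 => [|i u] //; have : i \in free_vars ts pl; last by rewrite nil.
rewrite mem_cat; apply/orP; right; apply/flattenP; exists z.2; first exact: map_f.
by rewrite E mem_head.
Qed.

Lemma Wpos_pair x y : y \in pairs x -> Wpos y -> Wpos x.
Proof.
case: x => k s; rewrite /pairs /= mem_cat => /orP[|/mapP[s1 hs1 ->]].
  case: k => [|[|k]] //; rewrite inE => /eqP-> w [|i [|j ts]] pl hu // [hk] hs.
  by apply: PW_tempo2 => //; apply: w => //; move: hu => /= /and3P[].
have [l [z [c [r [-> ->]]]]] := block_pairs_inv hs1.
move=> w ts pl hu hk /profile_split[l' [u [r' [epl el eu er]]]].
case: u eu epl => [|i [|j u]] // [eu] epl; rewrite epl in hu *.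
apply: PW_pair => //; apply: w => //; first exact: uniq_pair hu.
by rewrite profile_put el er eu.
Qed.

Lemma Wpos_own x y : odd (total x) -> y \in moves x -> Wpos y -> Wpos x.
Proof.
case: x => k s ho hy w ts pl hu /= hk hs; rewrite /last_mover -(total_size hk hs) ho.
move: hy w; rewrite /moves /= mem_cat => /orP[|/mapP[s1 hs1 ->]].
  case: k hk ho => // k hk ho; rewrite inE => /eqP-> w.
  case: ts hk hu => // i ts [hk] hu; apply: (PW_own_tempo (mem_head i ts)); rewrite /= eqxx.
  have := w ts pl _ hk hs; rewrite /last_mover -(total_size hk hs).
  have -> : odd (total (k, s)) = false by move: ho; rewrite /total /= => /negbTE.
  by apply; move: hu => /= /andP[].
have [l [z [c [r [b [es ->]]]]]] := block_moves_inv hs1; rewrite es in hs ho => w.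
have [l' [u [r' [epl el eu er]]]] := profile_split hs.
case: u eu epl => // i u [eu] epl; rewrite epl in hu *.
have hi : i \in i :: u by exact: mem_head.
apply: (PW_own (b := b) hu hi); have ru : rem i (i :: u) = u by rewrite /= eqxx.
have hs' : profile (l' ++ ((z + sg b)%R, rem i (i :: u)) :: r') = l ++ ((z + sg b)%R, c) :: r.
  by rewrite ru profile_put el er eu.
have := w ts _ (uniq_move _ hu hi) hk hs'; rewrite /last_mover -(total_size hk hs').
by move: ho; rewrite !total_put addSn /= => /negbTE->.
Qed.

Lemma Wpos_opponent x : ~~ odd (total x) -> total x != 0 ->
  (forall y, y \in moves x -> Wpos y) -> Wpos x.
Proof.
case: x => k s ho hn w ts pl hu /= hk hs; rewrite /last_mover -(total_size hk hs) (negbTE ho).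
apply: PW_opp => //; first by rewrite -size_eq0 -(total_size hk hs).
  move=> i hi; case: k hk ho hn w => [|k] hk ho hn w; first by rewrite (size0nil hk) in hi.
  have hk' : size (rem i ts) = k by rewrite size_rem // hk.
  have := w (k, s) (mem_head _ _) (rem i ts) pl (uniq_tempo hi hu) hk' hs.
  rewrite /last_mover -(total_size hk' hs).
  by have -> : odd (total (k, s)) by move: ho; rewrite /total /= negbK.
move=> l z u r i b epl hi; rewrite epl in hu hs.
have [c ec] : exists c, size u = c.+1 by case: u hi {epl hu hs} => // a u _; exists (size u).
have es : s = profile l ++ (z, c.+1) :: profile r by rewrite -hs profile_put ec.
have hm : (k, profile l ++ ((z + sg b)%R, c) :: profile r) \in moves (k, s).
  by rewrite mem_cat map_f ?orbT // (block_movesP b es).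
have hs' : profile (l ++ ((z + sg b)%R, rem i u) :: r) = profile l ++ ((z + sg b)%R, c) :: profile r.
  by rewrite profile_put size_rem // ec.
have := w _ hm ts _ (uniq_move _ hu hi) hk hs'; rewrite /last_mover -(total_size hk hs').
by move: ho; rewrite es !total_put addSn /= negbK => ->.
Qed.

Lemma total_moves x y : y \in moves x -> total x = (total y).+1.
Proof.
case: x => k s; rewrite /moves /= mem_cat => /orP[|/mapP[s1 hs1 ->]].
  by case: k => // k; rewrite inE => /eqP->.
have [l [z [c [r [b [-> ->]]]]]] := block_moves_inv hs1.
by rewrite !total_put.
Qed.

Lemma total_pairs x y : y \in pairs x -> total x = (total y).+2.
Proof.
case: x => k s; rewrite /pairs /= mem_cat => /orP[|/mapP[s1 hs1 ->]].
  by case: k => [|[|k]] //; rewrite inE => /eqP->.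
have [l [z [c [r [-> ->]]]]] := block_pairs_inv hs1.
by rewrite !total_put.
Qed.

Lemma Wpos_justified (P : position -> bool) x :
  (forall y, total y < total x -> P y -> Wpos y) -> justified P x -> Wpos x.
Proof.
move=> hP; rewrite /justified; case: (eqVneq (total x) 0) => [t0|tn]; first exact: Wpos_total0.
case/orP=> [/hasP[y hy Py]|].
  by apply: (Wpos_pair hy); apply: hP Py; rewrite (total_pairs hy) ltnW.
case E : (odd (total x)).
  move=> /hasP[y hy Py]; by apply: (Wpos_own E hy); apply: hP Py; rewrite (total_moves hy).
move/allP=> h; apply: Wpos_opponent => [|//|y hy]; first by rewrite E.
by apply: hP (h _ hy); rewrite (total_moves hy).
Qed.

Lemma Wpos_solvable n x : solvable n x -> Wpos x.
Proof. by elim: n x => //= n IH x; apply: Wpos_justified => y _; apply: IH. Qed.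

Lemma Wpos_variant x y : y \in variants x -> Wpos y -> Wpos x.
Proof.
rewrite !inE => /or4P[]/eqP-> //; first exact: Wpos_reverse.
  exact: Wpos_opposite.
by move/Wpos_opposite/Wpos_reverse.
Qed.

(** Members of [L] may appeal to each other, but [justified] consults only positions with a smaller
    [total], and the symmetries preserve it; so the appeals are not circular. *)
Lemma Wpos_certified L x : all (justified (certified L)) L -> certified L x -> Wpos x.
Proof.
move=> /allP hL; have [n hn] := ubnP (total x); elim: n x hn => // n IH x hn.
case/orP=> [/hasP[y hy hyL]|]; last exact: Wpos_solvable.
apply: (Wpos_variant hy); apply: Wpos_justified (hL _ hyL) => z hz; apply: IH.
have tv : total y = total x.
  have tr u : total (reverse_position u) = total u by rewrite /total /= map_rev sumn_rev.
  have to u : total (opposite_position u) = total u.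
    by rewrite /total /= -map_comp; congr (_ + sumn _); apply: eq_map.
  by move: hy; rewrite !inE => /or4P[]/eqP->; rewrite ?tr ?to.
by apply: leq_trans hz _; rewrite tv -ltnS.
Qed.

(* Found by computer search: these positions with more than three free crossings
   justify one another. *)
Definition family k (c : seq nat) (vs : seq (seq int)) : seq position :=
  [seq (k, zip v c) | v <- vs].

Definition certificate : seq position := flatten
  [:: family 1 [:: 2; 2; 1; 2; 2] [:: [:: 0; 0; 0; 0; 0]]%Z;
   family 0 [:: 2; 2; 1; 2; 2] [:: [:: 0; 0; 0; 0; 0]]%Z;
   family 1 [:: 1; 2; 1; 2; 2] [:: [:: -1; 0; 0; 0; 0]]%Z;
   family 1 [:: 2; 1; 1; 2; 2] [:: [:: 0; -1; 0; 0; 0]]%Z;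
   family 1 [:: 2; 2; 0; 2; 2] [:: [:: 0; 0; -1; 0; 0]]%Z;
   family 0 [:: 2; 2; 0; 2; 2] [:: [:: 0; 0; -1; 0; 0]]%Z;
   family 1 [:: 3; 1; 3] [:: [:: 0; 0; 0]]%Z;
   family 0 [:: 1; 2; 0; 2; 2] [:: [:: -1; 0; -1; 0; 0]; [:: -1; 0; 1; 0; 0]]%Z;
   family 0 [:: 2; 1; 0; 2; 2] [:: [:: 0; -1; -1; 0; 0]; [:: 0; -1; 1; 0; 0]]%Z;
   family 0 [:: 3; 1; 3] [:: [:: 0; 0; 0]]%Z;
   family 1 [:: 1; 2; 1; 0; 2] [:: [:: -1; 0; 0; 0; 0]]%Z;
   family 1 [:: 2; 1; 3] [:: [:: -1; 0; 0]]%Z;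
   family 1 [:: 2; 1; 1; 0; 2] [:: [:: 0; -1; 0; 0; 0]]%Z;
   family 1 [:: 2; 1; 1; 2] [:: [:: 0; 0; 0; 0]]%Z;
   family 1 [:: 3; 0; 3] [:: [:: 0; -1; 0]]%Z;
   family 0 [:: 2; 1; 1; 2] [:: [:: 0; 0; 0; 0]]%Z;
   family 0 [:: 3; 0; 3] [:: [:: 0; -1; 0]]%Z;
   family 1 [:: 2; 0; 1; 0; 2] [:: [:: 0; -2; 0; 0; 0]]%Z;
   family 0 [:: 1; 0; 0; 2; 2] [:: [:: -1; 0; -1; 0; 0]]%Z;
   family 0 [:: 1; 1; 1; 2] [:: [:: -1; 0; 0; 0]]%Z;
   family 0 [:: 1; 2; 0; 0; 2] [:: [:: -1; 0; 1; 0; 0]]%Z;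
   family 0 [:: 2; 0; 3] [:: [:: -1; -1; 0]; [:: -1; 1; 0]]%Z;
   family 0 [:: 2; 0; 1; 0; 2] [:: [:: 0; -2; 0; 0; 0]]%Z;
   family 0 [:: 2; 0; 1; 2] [:: [:: 0; -1; 0; 0]]%Z;
   family 0 [:: 2; 1; 0; 0; 2] [:: [:: 0; -1; -1; 0; 0]; [:: 0; -1; 1; 0; 0]]%Z;
   family 1 [:: 0; 1; 3] [:: [:: -1; 0; 0]]%Z;
   family 1 [:: 1; 0; 1; 0; 2] [:: [:: -1; -2; 0; 0; 0]; [:: -1; 0; 0; -2; 0]; [:: -1; 0; 0; 2; 0]; [:: -1; 2; 0; 0; 0]]%Z;
   family 1 [:: 1; 2; 1; 0; 0] [:: [:: -1; 0; 0; 0; 0]]%Z;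
   family 1 [:: 2; 0; 0; 0; 2] [:: [:: 0; -2; -1; 0; 0]; [:: 0; -2; 1; 0; 0]]%Z;
   family 1 [:: 2; 2] [:: [:: 0; 0]]%Z;
   family 0 [:: 0; 1; 1; 2] [:: [:: -2; 0; 0; 0]]%Z;
   family 0 [:: 1; 0; 1; 0; 2] [:: [:: -1; 0; 0; 2; 0]]%Z;
   family 0 [:: 2; 0; 0; 0; 2] [:: [:: 0; -2; 1; 0; 0]]%Z;
   family 0 [:: 2; 0; 0; 2] [:: [:: 0; -1; -1; 0]]%Z;
   family 0 [:: 2; 2] [:: [:: 0; 0]]%Z;
   family 1 [:: 0; 0; 1; 0; 2] [:: [:: -2; 0; 0; -2; 0]; [:: -2; 2; 0; 0; 0]]%Z;
   family 1 [:: 0; 2; 1; 0; 0] [:: [:: -2; 0; 0; 0; 0]]%Z;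
   family 1 [:: 0; 0; 3] [:: [:: -1; -1; 0]]%Z].

Lemma certificateP : all (justified (certified certificate)) certificate.
Proof. exact (erefl true). Qed.

Lemma profile_start pl : start pl -> profile pl = map (pair 0%R) (map (fun z => size z.2) pl).
Proof.
by elim: pl => //= -[z u] pl IH /andP[/eqP /= -> /IH h]; rewrite /profile /= -h.
Qed.

Lemma W_Wpos k a : Wpos (k, map (pair 0%R) a) -> W knotted k a.
Proof. by move=> w ts pl hu hk ha st; apply: w => //=; rewrite profile_start // ha. Qed.

(** The sequences at which the descent of [knotter_wins_target] stops. They have none, two, three
    and one odd entries. *)
Definition bases := [:: [:: 2; 2]; [:: 2; 1; 1; 2]; [:: 3; 1; 3]; [:: 2; 2; 1; 2; 2]].

(** Pairs of tempo moves cancel, so only the cases of none and of one come from the certificate. *)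
Lemma W_base k a : a \in bases -> W knotted k a.
Proof.
move=> ha; have : forall b : bool, W knotted b a.
  move=> b; apply: W_Wpos; apply: (Wpos_certified certificateP).
  by move: ha; rewrite !inE => /or4P[]/eqP->; case: b.
move=> h; have [n hn] := ubnP k; elim: n k hn => // n IH [|[|k']] hn; first exact: (h false).
  exact: (h true).
by apply: W_tempo2; apply: IH; rewrite -ltnS ltnW.
Qed.

(** * Sequences that are not odd-even *)

(** Stated for all numbers of tempo moves because removing a trailing zero turns a block into such
    moves. *)
Definition knotter_wins a := forall k, W knotted k a.

Lemma knotter_wins_pair l x r : knotter_wins (l ++ x :: r) -> knotter_wins (l ++ x.+2 :: r).
Proof. by move=> h k; apply: W_pair. Qed.

Lemma knotter_wins_tail0 a x : knotter_wins a -> knotter_wins (rcons (rcons a x) 0).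
Proof. by move=> h k; apply: W_tail0 => // l y; rewrite /knotted continuant_tail0. Qed.

Lemma knotter_wins_tail1 a x : knotter_wins (rcons a x.+1) -> knotter_wins (rcons (rcons a x) 1).
Proof.
move=> h k; apply: W_tail1 => // l y b.
by rewrite /knotted continuant_tail1 abszM; case: b; rewrite mul1n.
Qed.

Lemma knotter_wins_rev a : knotter_wins (rev a) -> knotter_wins a.
Proof. by move=> h k; apply: W_rev (h k) => l; rewrite /knotted continuant_rev. Qed.

Lemma knotter_wins_mid0 l x y r :
  knotter_wins (l ++ (x + y) :: r) -> knotter_wins (l ++ [:: x, 0, y & r]).
Proof. by move=> h k; apply: W_mid0 => // *; rewrite /knotted continuant_mid0. Qed.

Lemma knotter_wins_head0 x a : knotter_wins a -> knotter_wins [:: 0, x & a].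
Proof.
move=> h; apply: knotter_wins_rev; rewrite !rev_cons; apply: knotter_wins_tail0.
by apply: knotter_wins_rev; rewrite revK.
Qed.

Lemma knotter_wins_head1 x a : knotter_wins (x.+1 :: a) -> knotter_wins [:: 1, x & a].
Proof.
move=> h; apply: knotter_wins_rev; rewrite !rev_cons; apply: knotter_wins_tail1.
by apply: knotter_wins_rev; rewrite rev_rcons revK.
Qed.

Definition reduce_head a :=
  match a with 0 :: _ :: r => r | 1 :: x :: r => x.+1 :: r | _ => a end.

Fixpoint merge_zero a :=
  match a with x :: ((0 :: y :: r) as s) => x + y :: r | x :: s => x :: merge_zero s | _ => a end.

(** Each round is sound by itself, whatever the fuel; whether the result is normal is tested
    afterwards in [descent]. *)
Fixpoint normalize n a :=
  if n is n'.+1 then normalize n' (reduce_head (rev (reduce_head (rev (merge_zero a))))) else a.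

Lemma knotter_wins_reduce_head a : knotter_wins (reduce_head a) -> knotter_wins a.
Proof.
case: a => [|[|[|x]] [|y a]] //; [exact: knotter_wins_head0|exact: knotter_wins_head1].
Qed.

Lemma knotter_wins_merge_zero a : knotter_wins (merge_zero a) -> knotter_wins a.
Proof.
suff gen l : knotter_wins (l ++ merge_zero a) -> knotter_wins (l ++ a) by apply: (gen [::]).
elim: a l => // x s IH l; case: s IH => [|[|z] [|y r]] IH //=; first exact: knotter_wins_mid0.
by rewrite -!(cat_rcons x); apply: IH.
Qed.

Lemma knotter_wins_normalize n a : knotter_wins (normalize n a) -> knotter_wins a.
Proof.
elim: n a => //= n IH a /IH/knotter_wins_reduce_head/knotter_wins_rev/knotter_wins_reduce_head.
by move/knotter_wins_rev/knotter_wins_merge_zero.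
Qed.

Definition oe a := (count odd a == 1) && (odd (head 0 a) || odd (last 0 a)).

(** The nonempty sequences to which no reduction at a zero or at a short end applies. *)
Definition normal a := [&& all (ltn 0) a, 1 < head 0 a & 1 < last 0 a].

Definition target a := [&& normal a, odd_fraction a & ~~ oe a].

Lemma target_pair l x r : 0 < x -> normal (l ++ x :: r) ->
  target (l ++ x.+2 :: r) -> target (l ++ x :: r).
Proof.
move=> hx hn /and3P[_ ho hoe]; apply/and3P; split=> //; first by rewrite -odd_fraction_pair.
move: hoe; rewrite /oe !count_cat /= negbK; case: l {hn ho} => [|y l]; rewrite /= ?negbK.
  by case: r => [|z r] //=; rewrite negbK.
by rewrite !last_cat /=; case: r => [|z r] //=; rewrite negbK.
Qed.

Fixpoint ones_twos n : seq (seq nat) :=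
  if n is n'.+1 then map (cons 1) (ones_twos n') ++ map (cons 2) (ones_twos n') else [:: [::]].

Lemma mem_ones_twos m : all (fun z => 0 < z < 3) m -> m \in ones_twos (size m).
Proof.
elim: m => //= z m IH /andP[hz /IH hm]; rewrite mem_cat.
by case: z hz => [|[|[|]]] // _; rewrite map_f ?orbT.
Qed.

Definition lower i a := take i a ++ (nth 0 a i - 2) :: drop i.+1 a.

Definition descent a i :=
  let b := normalize 4 (lower i a) in [&& 1 < nth 0 a i, target b & sumn b < sumn a].

Definition reducible a := [|| ~~ target a, a \in bases | has (descent a) (iota 0 (size a))].

(** The finite part of the descent, settled by computation: up to five inner entries, each 1 or 2,
    between outer entries 2 or 3. A target among these is a base or has an entry whose lowering by
    two normalizes to a smaller target. *)
Lemma reducible_small : all (fun n => all (fun m => all (fun e1 => all (fun e2 =>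
  reducible (e1 :: rcons m e2)) [:: 2; 3]) [:: 2; 3]) (ones_twos n)) (iota 0 6).
Proof. exact (erefl true). Qed.

Lemma lowerK i a : i < size a -> 1 < nth 0 a i ->
  knotter_wins (lower i a) -> knotter_wins a.
Proof.
move=> hi hn /knotter_wins_pair; rewrite -[X in _ ++ X.+2 :: _ ]/(nth 0 a i - 2).
by rewrite -addn2 subnK // -drop_nth // cat_take_drop.
Qed.

Lemma not_oe h m t : has odd m -> t != [::] -> ~~ oe (h :: m ++ t).
Proof.
rewrite has_count /oe => hm; case/lastP: t => [|t x] // _.
rewrite /= last_cat last_rcons -cats1 !count_cat /=.
by case: (odd h); case: (odd x); apply/negP => /andP[/eqP h1 //]; lia.
Qed.

Lemma odd_fraction_mid0 l x y r :
  odd_fraction (l ++ [:: x, 0, y & r]) = odd_fraction (l ++ (x + y) :: r).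
Proof. by rewrite /odd_fraction !map_cat /= continuant_mid0. Qed.

Lemma odd_fraction_head0 x a : odd_fraction [:: 0, x & a] = odd_fraction a.
Proof. by rewrite -odd_fraction_rev !rev_cons odd_fraction_tail0 odd_fraction_rev. Qed.

Lemma odd_fraction_head1 x a : odd_fraction [:: 1, x & a] = odd_fraction (x.+1 :: a).
Proof.
by rewrite -odd_fraction_rev !rev_cons odd_fraction_tail1 -rev_cons odd_fraction_rev.
Qed.

Lemma odd_fraction1 x : odd_fraction [:: x] = odd x.
Proof. by rewrite /odd_fraction -[continuant _]/(0 + Posz x * 1)%R mulr1 add0r. Qed.

Lemma target_ends a : target a -> exists e1 m e2,
  [/\ a = e1 :: rcons m e2, 1 < e1, 1 < e2 & all (ltn 0) m].
Proof.
case: a => [|e1 s]; first by case/and3P=> /and3P[].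
case/lastP: s => [|m e2].
  by case/and3P=> _; rewrite odd_fraction1 /oe /= => ->.
case/and3P=> /and3P[/= /andP[_ +] h1]; rewrite last_rcons all_rcons => /andP[_ hm] h2 _ _.
by exists e1, m, e2.
Qed.

(** Dropping the two crossings of the middle block lets its even neighbours merge into an even
    entry. The number of odd entries and the parities at both ends stay as they are, so no odd-even
    sequence arises. *)
Lemma target_merge l x y r : ~~ odd x -> ~~ odd y ->
  target (l ++ [:: x, 2, y & r]) -> target (l ++ (x + y) :: r).
Proof.
move=> ox oy /and3P[/and3P[hp h1 h2] ho hoe]; apply/and3P; split.
- move: hp h1 h2; rewrite /normal !all_cat /= => /andP[-> /and3P[px py ->]] h1 h2.
  rewrite andbT /=; apply/and3P; split; first by lia.
    by clear -px py h1; case: l h1 => //= h1; lia.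
  clear -px py h2; move: h2; rewrite !last_cat /=; case: r => //= h2; lia.
- by rewrite -odd_fraction_mid0 -(cat_rcons x) -odd_fraction_pair cat_rcons.
move: hoe; rewrite /oe !count_cat /= oddD (negbTE ox) (negbTE oy).
case: l {hp h1 h2 ho} => [|z l]; rewrite /= ?(negbTE ox).
  by case: r => [|w r] /=; rewrite ?oddD ?(negbTE ox) ?(negbTE oy).
rewrite !last_cat /=; case: r => [|w r] //=.
by rewrite oddD (negbTE ox) (negbTE oy).
Qed.

Definition no_evens3 a := all (fun i => [|| odd (nth 0 a i), odd (nth 0 a i.+1) | odd (nth 0 a i.+2)])
  (iota 0 (size a - 2)).

Lemma no_evens3P s x y z t : no_evens3 (s ++ [:: x, y, z & t]) -> has odd [:: x; y; z].
Proof.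
move/allP/(_ (size s)); rewrite mem_iota size_cat /= => /(_ ltac:(lia)).
by rewrite !nth_cat ltnn !ltnNge leqnSn ltnW //= subnn !subSn ?subnn ?leqnSn //= orbF.
Qed.

(* A long sequence without three consecutive even entries can be shortened at
   the left end; the remaining ones are checked one by one. *)
Lemma knotter_wins_target a : target a -> knotter_wins a.
Proof.
have [n hn] := ubnP (sumn a); elim: n a hn => // n IH a hn ha.
have red l x r : 0 < x -> normal (l ++ x :: r) -> a = l ++ x.+2 :: r -> knotter_wins a.
  move=> hx hnn ea; rewrite ea; apply: knotter_wins_pair; apply: IH.
    by move: hn; rewrite ea !sumn_cat /=; lia.
  by apply: target_pair => //; rewrite -ea.
have [e1 [m [e2 [ea h1 h2 hm]]]] := target_ends ha.
(* Entries from 4 on at the ends, and from 3 on inside, can be lowered by two within the normal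
   sequences. *)
case: (leqP 4 e1) => he1.
  have e : a = [::] ++ (e1 - 2).+2 :: rcons m e2 by rewrite ea -addn2 subnK.
  apply: red e; first by lia.
  by rewrite /normal /= all_rcons last_rcons hm h2 /=; clear -he1 h2; lia.
case: (leqP 4 e2) => he2.
  have e : a = (e1 :: m) ++ (e2 - 2).+2 :: [::] by rewrite ea -addn2 subnK // cats1.
  apply: red e; first by lia.
  by rewrite /normal /= all_cat last_cat /= hm h1 /=; clear -he2 h1; lia.
have [/hasP[z hz z3]|/hasPn m3] := boolP (has (fun z => 2 < z) m).
  have z2 : 1 < z by exact: ltnW z3.
  case/splitPr: hz ea hm => m1 m2 ea hm.
  have e : a = (e1 :: m1) ++ (z - 2).+2 :: rcons m2 e2.
    by rewrite ea -addn2 (subnK z2) rcons_cat.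
  apply: red e; first by rewrite subn_gt0.
  move: hm; rewrite /normal /= !all_cat /= all_rcons last_cat /= last_rcons => /andP[-> /andP[_ ->]].
  by rewrite h1 h2 /=; clear -h1 h2 z3; move: z3 => /=; lia.
have {}hm : all (fun z => 0 < z < 3) m.
  by apply/allP => z hz; have /= -> := allP hm z hz; rewrite ltnS leqNgt m3.
(* Of three consecutive even entries the middle one is an inner entry, hence equal to 2, and its
   neighbours can be merged. *)
have [ne3|/allPn[i]] := boolP (no_evens3 a); last first.
  rewrite mem_iota add0n !negb_or => /andP[_ hi] /and3P[o0 o1 o2].
  have hi2 : i.+2 < size a by lia.
  have en1 : nth 0 a i.+1 = 2.
    have : nth 0 a i.+1 \in m.
      have si : i < size m by move: hi2; rewrite ea /= size_rcons.
      by rewrite ea /= nth_rcons si mem_nth.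
    by move/(allP hm); case: (nth _ _ _) o1 => [|[|[|]]].
  have e : a = take i a ++ [:: nth 0 a i, 2, nth 0 a i.+2 & drop i.+3 a].
    rewrite -{1}(cat_take_drop i a) (drop_nth 0) ?(drop_nth 0 (n := i.+1)) ?(drop_nth 0 (n := i.+2)) ?en1 //; lia.
  have tm : target (take i a ++ (nth 0 a i + nth 0 a i.+2) :: drop i.+3 a).
    by apply: target_merge => //; rewrite -e.
  rewrite e -(cat_rcons (nth 0 a i)); apply: knotter_wins_pair; rewrite cat_rcons.
  apply: knotter_wins_mid0; apply: IH => //.
  by move: hn; rewrite {1}e !sumn_cat /=; lia.
case: (leqP (size m) 5) => sm.
  have ha1 : e1 \in [:: 2; 3] by rewrite !inE; clear -h1 he1; lia.
  have ha2 : e2 \in [:: 2; 3] by rewrite !inE; clear -h2 he2; lia.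
  have hs : size m \in iota 0 6 by rewrite mem_iota.
  have := allP (allP (allP (allP reducible_small _ hs) _ (mem_ones_twos hm)) _ ha1) _ ha2.
  rewrite -ea; case/or3P; first by rewrite ha.
    by move=> hb k; apply: W_base.
  case/hasP=> i; rewrite mem_iota => /andP[_ hi] /and3P[hi1 tb sb]; apply: (lowerK hi hi1).
  by apply: knotter_wins_normalize (IH _ _ tb); apply: leq_trans sb hn.
have mk h m' : 1 < h -> all (fun z => 0 < z < 3) m' -> has odd m' ->
    odd_fraction (h :: rcons m' e2) -> target (h :: rcons m' e2).
  move=> hh hm' ho of'; apply/and3P; split=> //; last by rewrite -cats1; apply: not_oe.
  rewrite /normal /= last_rcons all_rcons hh h2 /= !andbT (ltnW hh) (ltnW h2) /=.
  by apply: sub_all hm' => z /andP[].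
(* Six inner entries: up to three are used up at the left end, and one of the next three is odd. It
   remains an inner entry and prevents the shortened sequence from being odd-even. *)
clear m3; case: m hm sm ea => [|y [|z [|w [|t0 [|t1 [|t2 t]]]]]] // hm _ ea.
have ho : has odd [:: t0; t1; t2].
  by move: ne3; rewrite ea -[e1 :: _]/([:: e1; y; z; w] ++ [:: t0, t1, t2 & rcons t e2]) => /no_evens3P.
have {}ho l : has odd (l ++ [:: t0, t1, t2 & t]).
  by rewrite has_cat -[[:: t0, t1, t2 & t]]/([:: t0; t1; t2] ++ t) has_cat ho orbT.
have hw : all (fun z => 0 < z < 3) [:: z, w, t0, t1, t2 & t] by case/andP: hm.
have /and3P[z12 /andP[w0 w3] ht] := hw.
have of' : odd_fraction a by case/and3P: ha.
move: hn of'; rewrite ea => hn of'.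
(* An end 2 drops to 0 and takes [y] along; an end 3 drops to 1 and joins [y]. *)
have /orP[/eqP e1v|/eqP e1v] : (e1 == 2) || (e1 == 3) by clear -h1 he1; lia.
  rewrite e1v in hn of' *; apply: (@knotter_wins_pair [::]); apply: knotter_wins_head0.
  rewrite -[_ :: _]/([::] ++ 2 :: rcons [:: y, z, w, t0, t1, t2 & t] e2) odd_fraction_pair /= odd_fraction_head0 in of'.
  (* Now [z] is the end; a 1 is too short for a normal sequence and joins [w]. *)
  have /orP[/eqP zv|/eqP zv] : (z == 1) || (z == 2) by clear -z12; lia.
    rewrite zv in hn of' *; apply: knotter_wins_head1; rewrite odd_fraction_head1 in of'.
    apply: (IH (w.+1 :: rcons [:: t0, t1, t2 & t] e2)); first by move: hn => /=; clear; lia.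
    by apply: (mk w.+1 [:: t0, t1, t2 & t] _ _ (ho [::]) of').
  rewrite zv in hn of' *; apply: (IH (2 :: rcons [:: w, t0, t1, t2 & t] e2)); first by move: hn => /=; clear; lia.
  by apply: (mk 2 [:: w, t0, t1, t2 & t] _ _ (ho [:: w]) of') => //; apply/andP; rewrite w0.
rewrite e1v in hn of' *; apply: (@knotter_wins_pair [::] 1); apply: knotter_wins_head1.
rewrite -[_ :: _]/([::] ++ 3 :: rcons [:: y, z, w, t0, t1, t2 & t] e2) odd_fraction_pair /= odd_fraction_head1 in of'.
apply: (IH (y.+1 :: rcons [:: z, w, t0, t1, t2 & t] e2)); first by move: hn => /=; clear; lia.
by apply: (mk y.+1 [:: z, w, t0, t1, t2 & t] _ hw (ho [:: z; w]) of'); case/andP: hm => /andP[].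
Qed.

(** * Pseudo Reidemeister moves on rational shadows *)

Definition twists n : word := nseq n (Some None).

Definition shadow_word (a : seq nat) : word := flatten [seq None :: twists n | n <- a].

Lemma shadow_word_block a : shadow_word a = block_word [seq nseq n None | n <- a].
Proof.
rewrite /shadow_word /block_word -map_comp; congr flatten; apply: eq_map => n /=.
by rewrite map_nseq.
Qed.

Lemma rational_shadowE a : rational_shadow a = N (shadow_word a).
Proof.
rewrite shadow_word_block -rational_shadow_word.
  by rewrite -map_comp (eq_map (g := id)) ?map_id // => n /=; rewrite size_nseq.
by apply/allP => b /mapP[n _ ->]; rewrite all_nseq eqxx orbT.
Qed.

Lemma shadow_word_rcons a n : shadow_word (rcons a n) = shadow_word a ++ None :: twists n.
Proof. by rewrite /shadow_word map_rcons flatten_rcons. Qed.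

Lemma shadow_word_cat a b : shadow_word (a ++ b) = shadow_word a ++ shadow_word b.
Proof. by rewrite /shadow_word map_cat flatten_cat. Qed.

Lemma twistsD m n : twists (m + n) = twists m ++ twists n.
Proof. by rewrite /twists nseqD. Qed.

Lemma twistsS n : twists n.+1 = rcons (twists n) (Some None).
Proof. by rewrite -addn1 twistsD cats1. Qed.

Lemma par_shadow_word a : (par (shadow_word a)).1 = odd_fraction a.
Proof.
rewrite par_pq /odd_fraction /pq /continuant /cf.
have tw n (u : int * int) : foldl pq_op u (twists n) = (u.1 + Posz n * u.2, u.2)%R.
  elim: n u => [|n IH] u /=; first by rewrite mul0r addr0; case: u.
  by rewrite IH /=; congr pair; rewrite -addn1 PoszD; ring.
elim: a (1, 0)%R => //= n a IH u; rewrite foldl_cat tw IH /cf_step //=.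
Qed.

Lemma shadow_knot a : odd_fraction a -> knot_pseudodiagram (rational_shadow a).
Proof. by move=> h; rewrite rational_shadowE; apply: N_knot; rewrite par_shadow_word. Qed.

Lemma shadow_rev a : odd_fraction a ->
  isotopic (rational_shadow a) (iter (num_refl (shadow_word a)) refl (rational_shadow (rev a))).
Proof.
move=> h; rewrite !rational_shadowE; apply: N_rev; first by rewrite par_shadow_word.
rewrite !shadow_word_block -negrev_block_word map_rev; congr (rcons (block_word (rev _)) _).
rewrite -map_comp; apply: eq_map => n /=; rewrite map_nseq /=.
by elim: n => //= n IH; rewrite rev_cons -IH; elim: {IH} n => //= n ->.
Qed.

Lemma shadow_tail1 a x :
  rational_shadow (rcons (rcons a x) 1) = refl (rational_shadow (rcons a x.+1)).
Proof.
rewrite !rational_shadowE !shadow_word_rcons (twistsS x) -rcons_cons -rcons_cat -N_T2.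
by rewrite -!cats1 -!catA.
Qed.

Lemma tangle_RR w w' : tangle_word (w ++ [:: None, None & w']) = tangle_word (w ++ w').
Proof.
rewrite /tangle_word !foldl_cat /=; congr foldl; case: (foldl _ _ _) => n1 n2 n3 n4 cs.
rewrite /Defs.reflect /= -map_comp; congr Tangle; rewrite -[RHS]map_id.
by apply: eq_map => c; apply: reflect_crossingK.
Qed.

Lemma shadow_mid0 l x y r :
  rational_shadow (l ++ [:: x, 0, y & r]) = rational_shadow (l ++ (x + y) :: r).
Proof.
rewrite !rational_shadowE /N !shadow_word_cat; congr tangle_closure.
have -> : shadow_word l ++ shadow_word [:: x, 0, y & r]
    = (shadow_word l ++ None :: twists x) ++ [:: None, None & twists y ++ shadow_word r].
  by rewrite /shadow_word /= -!catA.
by rewrite tangle_RR /shadow_word /= twistsD -!catA.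
Qed.

Definition reduces D := exists2 O, odd_even_shadow O & pseudo_R1s D O.

Lemma reduces_equivalent D D' : equivalent D D' -> reduces D' -> reduces D.
Proof.
by move=> e [O oO h]; exists O => //; apply: rt_trans h; apply: rt_step; left.
Qed.

Lemma odd_even_isotopic O O' : isotopic O O' -> odd_even_shadow O' -> odd_even_shadow O.
Proof. by move=> i [a oa h]; exists a => //; apply: iso_trans h. Qed.

(** By [shadow_tail1] the mirror image of a shadow ending in an odd entry [x.+1] is the one ending
    in [x] and 1, where [x] is even and 1 is the new odd end. A second mirror undoes the first. *)
Lemma odd_even_shadow_tail r x n : odd x -> evens_only r ->
  odd_even_shadow (iter n refl (rational_shadow (rcons r x))).
Proof.
move=> ox er; have h0 : odd_even_shadow (rational_shadow (rcons r x)).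
  by exists (rcons r x); [apply: odd_even_tail|apply: iso_refl].
have h1 : odd_even_shadow (refl (rational_shadow (rcons r x))).
  case: x ox {h0} => // x ox; exists (rcons (rcons r x) 1).
    by apply: odd_even_tail => //; rewrite /evens_only all_rcons -/(evens_only r) er andbT.
  by rewrite shadow_tail1; apply: iso_refl.
suff [] : odd_even_shadow (iter n refl (rational_shadow (rcons r x))) /\
   odd_even_shadow (iter n.+1 refl (rational_shadow (rcons r x))) by [].
by elim: n => // n [h2 h3]; split=> //; rewrite !iterS reflK.
Qed.

(** An odd first entry is brought to the end by turning the diagram around, which costs only further
    mirrors. *)
Lemma odd_even_shadow_refl O : odd_even_shadow O -> odd_even_shadow (refl O).
Proof.
case=> a oa /refl_isotopic h; apply: odd_even_isotopic h _ => {O}.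
have := odd_evenP oa; case=> [] [x [r [ea ox er]]]; last first.
  by rewrite ea; apply: (@odd_even_shadow_tail r x 1).
have ha := odd_even_odd_fraction oa.
apply: odd_even_isotopic (refl_isotopic (shadow_rev ha)) _.
rewrite -iterS ea rev_cons; apply: odd_even_shadow_tail => //.
by rewrite /evens_only all_rev.
Qed.

Lemma reduces_refl D : reduces D -> reduces (refl D).
Proof.
by case=> O oO h; exists (refl O); [apply: odd_even_shadow_refl|apply: refl_pseudo_R1s].
Qed.

Lemma reduces_shadow a : odd_even a -> reduces (rational_shadow a).
Proof. by move=> h; exists (rational_shadow a); [exists a => //; apply: iso_refl|apply: rt_refl]. Qed.

Lemma reduces_rev a : odd_fraction a -> reduces (rational_shadow (rev a)) -> reduces (rational_shadow a).
Proof.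
move=> h hr; apply: reduces_equivalent (isotopic_equivalent (shadow_knot h) (shadow_rev h)) _.
by elim: (num_refl _) => //= n; apply: reduces_refl.
Qed.

(** In front of an empty last block all crossings are kinks, deleted here one at a time. *)
Lemma shadow_kinks a x y : odd_fraction a ->
  pseudo_R1s (rational_shadow (rcons (rcons a (x + y)) 0)) (rational_shadow (rcons (rcons a x) 0)).
Proof.
move=> h; elim: y => [|y IH]; first by rewrite addn0; apply: rt_refl.
apply: rt_trans IH; have hk z : knot_pseudodiagram (rational_shadow (rcons (rcons a z) 0)).
  by apply: shadow_knot; rewrite odd_fraction_tail0.
have e z : rational_shadow (rcons (rcons a z) 0) =
    N (rcons (shadow_word (rcons a z)) None).
  by rewrite rational_shadowE shadow_word_rcons cats1.
have := hk (x + y); have := hk (x + y.+1); rewrite !e addnS !shadow_word_rcons twistsS.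
rewrite -rcons_cons -rcons_cat; have [D [D' [h1 -> h3]]] := N_kink (shadow_word a ++ None :: twists (x + y)) None.
move=> k k'; have kD' : knot_pseudodiagram D' by rewrite (isotopic_knot h3).
apply: (rt_trans _ _ _ D'); apply: rt_step; first by right; split.
by left; apply: isotopic_equivalent.
Qed.

Lemma reduces_tail0 a x : odd_fraction a -> reduces (rational_shadow a) ->
  reduces (rational_shadow (rcons (rcons a x) 0)).
Proof.
move=> h [O oO hO]; exists O => //; apply: rt_trans hO.
have := @shadow_kinks a 0 x h; rewrite add0n.
rewrite [X in pseudo_R1s _ X](_ : _ = rational_shadow a) // !rational_shadowE.
by rewrite !shadow_word_rcons -catA /N tangle_RR cats0.
Qed.

Lemma reduces_tail1 a x : reduces (rational_shadow (rcons a x.+1)) ->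
  reduces (rational_shadow (rcons (rcons a x) 1)).
Proof. by rewrite shadow_tail1; apply: reduces_refl. Qed.

(** One kink is kept, because [[:: 1; 0]] is odd-even while the empty sequence is not. *)
Lemma reduces_circle_kinks x : 0 < x -> reduces (rational_shadow [:: x; 0]).
Proof.
case: x => // x _; exists (rational_shadow [:: 1; 0]).
  by exists [:: 1; 0]; [apply: (@odd_even_head 1 [:: 0])|apply: iso_refl].
by have := @shadow_kinks [::] 1 x isT; rewrite add1n.
Qed.

(** A disjunction proved outright, so that the negative hypothesis of the theorem yields a strategy
    without excluded middle. *)
Definition dichotomy a := reduces (rational_shadow a) \/ knotter_wins a.

Lemma dichotomy_rev a : odd_fraction a -> dichotomy (rev a) -> dichotomy a.
Proof. by move=> h [hr|hk]; [left; apply: reduces_rev|right; apply: knotter_wins_rev]. Qed.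

Lemma dichotomy_tail0 a x : odd_fraction a -> dichotomy a -> dichotomy (rcons (rcons a x) 0).
Proof. by move=> h [hr|hk]; [left; apply: reduces_tail0|right; apply: knotter_wins_tail0]. Qed.

Lemma dichotomy_tail1 a x : dichotomy (rcons a x.+1) -> dichotomy (rcons (rcons a x) 1).
Proof. by move=> [hr|hk]; [left; apply: reduces_tail1|right; apply: knotter_wins_tail1]. Qed.

Lemma dichotomy_mid0 l x y r : dichotomy (l ++ (x + y) :: r) -> dichotomy (l ++ [:: x, 0, y & r]).
Proof.
by move=> [hr|hk]; [left; rewrite shadow_mid0|right; apply: knotter_wins_mid0].
Qed.

Lemma oe_odd_even a : oe a -> odd_even a.
Proof.
have ev s : count odd s = 0 -> evens_only s.
  by move=> h; rewrite /evens_only (all_predC odd) has_count h.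
case: a => [|x r] // /andP[/eqP hc] /orP[/= ox|].
  by apply: odd_even_head => //; apply: ev; move: hc; rewrite /= ox; case.
rewrite lastI last_rcons in hc *; move: (belast x r) (last x r) hc => s y.
rewrite -cats1 count_cat /= addn0 => hc oy; rewrite cats1.
by apply: odd_even_tail => //; apply: ev; move: hc; rewrite oy addn1 => -[].
Qed.

(* Kinks at the ends and zeros in the middle are removed first. *)
Lemma dichotomyP a : odd_fraction a -> 0 < sumn a -> dichotomy a.
Proof.
have [n hn] := ubnP (size a); elim: n a hn => // n IH a hn ha hs.
(* A last entry 0 or 1 is removed here; a first entry 0 or 1 is reduced to this case by turning
   around. *)
have tail e1 m e2 : size m < n.-1 -> all (ltn 0) m -> e2 < 2 ->
    odd_fraction (e1 :: rcons m e2) -> 0 < sumn (e1 :: rcons m e2) -> dichotomy (e1 :: rcons m e2).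
  case/lastP: m => [|m x] sm pm; rewrite -rcons_cons.
    case: e2 => [|[|]] // _ hf hp; first by left; apply: reduces_circle_kinks; move: hp; rewrite /= !addn0.
    apply: (@dichotomy_tail1 [::]); apply: IH => //; first by clear -sm; move: sm => /=; lia.
    by rewrite -(odd_fraction_tail1 [::]).
  rewrite all_rcons size_rcons in sm pm; rewrite -rcons_cons.
  case: e2 => [|[|]] // _; last first.
    rewrite odd_fraction_tail1 => hf _; apply: dichotomy_tail1; apply: IH => //.
      by rewrite /= size_rcons; clear -sm; lia.
    by rewrite /= sumn_rcons !addnS.
  rewrite odd_fraction_tail0 => hf _; apply: dichotomy_tail0 => //; apply: IH => //.
    by rewrite /=; clear -sm; lia.
  case/andP: pm => _; case: m hf {sm} => [|z m] /=; last by move=> _ /andP[pz _]; clear -pz; lia.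
  by rewrite odd_fraction1 addn0 => /odd_gt0.
case: a hn ha hs => [|e1 s] // hn ha hs; case/lastP: s hn ha hs => [|m e2] hn ha hs.
  left; apply: reduces_shadow; apply: (@odd_even_head e1 [::]) => //.
  by rewrite -odd_fraction1.
rewrite /= size_rcons in hn.
have [z0|nz] := boolP (0 \in m).
  case/splitPr: z0 hn ha hs => m1 m2.
  have [l [x em1]] : exists l x, e1 :: m1 = rcons l x by exists (belast e1 m1), (last e1 m1); apply: lastI.
  have [y [r em2]] : exists y r, rcons m2 e2 = y :: r by case: (m2) => [|y r]; [exists e2, [::]|exists y, (rcons r e2)].
  move=> hn; rewrite size_cat /= in hn.
  have -> : e1 :: rcons (m1 ++ 0 :: m2) e2 = l ++ [:: x, 0, y & r].
    by rewrite rcons_cat -cat_cons em1 rcons_cons em2 cat_rcons.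
  have := congr1 size em1; have := congr1 size em2; rewrite /= !size_rcons => s1 s2.
  rewrite odd_fraction_mid0 => ha hs; apply: dichotomy_mid0; apply: IH => //.
    by rewrite size_cat /=; clear -hn s1 s2; lia.
  by move: hs; rewrite !sumn_cat /=; clear; lia.
have pm : all (ltn 0) m by apply/allP => z hz; rewrite /= lt0n; apply: contraNneq nz => <-.
have sm : size m < n.-1 by clear -hn; lia.
case: (ltnP e2 2) => he2; first exact: tail.
case: (ltnP e1 2) => he1.
  apply: dichotomy_rev => //; have er : rev (e1 :: rcons m e2) = e2 :: rcons (rev m) e1.
    by rewrite rev_cons rev_rcons.
  by rewrite er; apply: tail; rewrite ?size_rev ?all_rev -?er ?odd_fraction_rev ?sumn_rev.
case: (boolP (oe (e1 :: rcons m e2))) => ho; first by left; apply/reduces_shadow/oe_odd_even.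
right; apply: knotter_wins_target; apply/and3P; split=> //.
by rewrite /normal /= all_rcons last_rcons pm he1 he2 /= (ltnW he1) (ltnW he2).
Qed.

(** * Outcome of the game on a rational knot shadow *)

Lemma num_crossings_shadow a : num_crossings (rational_shadow a) = sumn a.
Proof.
have [bl [_ sb _ E]] := rational_shadow_states a; rewrite (E xpredT).
have [l [ts [sz ->]]] := N_with_states bl.
by rewrite /num_crossings /= size_zip size_map size_rev sz minnn size_flatten -sb.
Qed.

Lemma odd_fraction_knot a : num_components (rational_shadow a) = 1 -> 0 < sumn a -> odd_fraction a.
Proof.
rewrite -num_crossings_shadow rational_shadowE -par_shadow_word => hc hn; apply: components_par hc _.
move: hn; rewrite /N /tangle_closure fuse_fm /num_crossings /= size_map.
by rewrite lt0n size_eq0.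
Qed.

Lemma last_mover_twins p a : odd_fraction a -> ~ reduces (rational_shadow a) -> 0 < sumn a ->
  twins p 0 (if odd (sumn a) then p else opponent p) (rational_shadow a).
Proof.
move=> ho hr hs; case: p; last first.
  by have := unknotter_last_twins 0 ho; rewrite addn0.
have [//|hk] := dichotomyP ho hs.
have := W_twins (p := Knotter) _ (hk 0); rewrite addn0; apply=> e bl _.
exact: knotted_final.
Qed.

Theorem theorem6p4 (T : pseudodiagram) :
  rational_knot_shadow T -> 0 < num_crossings T ->
  ((exists2 O, odd_even_shadow O & pseudo_R1s T O) ->
     forall first : player, wins Unknotter first T) /\
  (~ (exists2 O, odd_even_shadow O & pseudo_R1s T O) ->
     (~~ odd (num_crossings T) ->
        forall first : player, wins (opponent first) first T) /\
     (odd (num_crossings T) -> forall first : player, wins first first T)).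
Proof.
move=> [[a iT] hc] hn; have [_ hT] := isotopic_shape iT.
have wl : well_labelled (rational_shadow a) by rewrite rational_shadowE; apply: N_wl.
have [_ ec _ _ en] := hT wl; rewrite num_crossings_shadow in en.
have ho : odd_fraction a by apply: odd_fraction_knot; rewrite -?ec -?en.
have kT : knot_pseudodiagram T by rewrite (isotopic_knot iT) shadow_knot.
have eT := isotopic_equivalent kT iT.
split=> [[O [b ob iO] hO] first|hr].
  apply: twins_wins; apply: strong_win_R1s hO _ _ _.
  apply: strong_win_R1s (strong_win_odd_even ob); apply: rt_step; left.
  apply: (isotopic_equivalent _ iO); rewrite (isotopic_knot iO).
  exact/shadow_knot/odd_even_odd_fraction.
have hr' : ~ reduces (rational_shadow a) by move=> h; apply/hr/(reduces_equivalent eT h).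
rewrite en in hn *; have win p := last_mover_twins p ho hr' hn.
split=> par first; apply/twins_wins/(twins_equivalent (eqv_sym eT)).
  by have := win (opponent first); rewrite (negbTE par) opponentK.
by have := win first; rewrite par.
Qed.
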